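(* Let $\mathfrak g$ be a Lie algebra endowed with a Banach–Lie norm $\|\cdot\|_{\mathfrak g}$, and let $\alpha$ be a $\mathfrak g$-valued continuous measure of finite variation on an interval $I$, with total variation $\int\|\alpha\|_{\mathfrak g}$. Let $\zeta^{\leftarrow}_{\mathrm R,n}(\alpha)$ and $\zeta^{\rightarrow}_{\mathrm R,n}(\alpha)$ ($n\geq1$) be the terms of the left and right expanding Wilcox expansions of $\alpha$. Then, coefficientwise in the powers of the formal variable $T$ (i.e. for each $n\geq1$ the coefficient of $T^n$ on the left is at most the coefficient of $T^n$ on the right, the right side being expanded as a power series at $T=0$), $$\sum_{n=1}^\infty T^n\cdot\|\zeta^{\leftarrow}_{\mathrm R,n}(\alpha)\|_{\mathfrak g}\ \leq\ 1-\sqrt{\frac12\left(2-T\cdot\left(\int\|\alpha\|_{\mathfrak g}\right)\right)^2-1}.$$ In particular, the Wilcox expansion is convergent, in the sense that $\sum_{n=1}^\infty\|\zeta^{\leftarrow}_{\mathrm R,n}(\alpha)\|_{\mathfrak g}<+\infty$, if $\int\|\alpha\|_{\mathfrak g}<2-\sqrt2$. The same statements (the same coefficientwise bound and the same convergence criterion) hold with $\zeta^{\rightarrow}_{\mathrm R,n}(\alpha)$ in place of $\zeta^{\leftarrow}_{\mathrm R,n}(\alpha)$.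
   Context: A Banach–Lie norm on a (real or complex) Lie algebra $\mathfrak g$ is a complete norm with $\|[X,Y]\|_{\mathfrak g}\leq\|X\|_{\mathfrak g}\|Y\|_{\mathfrak g}$. Measures: a continuous measure of finite variation on a (possibly infinite) interval $I$ with values in a Banach space is a countably additive vector-valued Borel measure $\alpha$ on $I$ with $\alpha(\{t\})=0$ for all $t\in I$ and finite total variation $\int\|\alpha\|=\sup\sum_i\|\alpha(J_i)\|$, the supremum being over finite partitions of $I$ into subintervals. For example, $\alpha$ may be given by a Bochner integrable density. For a continuous $n$-linear map $P$, the integral $\int_{t_1\leq\ldots\leq t_n\in I}P(\alpha(t_1),\ldots,\alpha(t_n))$ is the integral of $P$ against the product measure over the ordered simplex, i.e. the limit of $\sum_{i_1<\ldots<i_n}P(\alpha(J_{i_1}),\ldots,\alpha(J_{i_n}))$ over ordered finite partitions $J_1<\ldots<J_N$ of $I$ into intervals, as the maximal variation of $\alpha$ on the $J_i$ tends to $0$. Time-ordered exponential: for a Banach algebra valued continuous measure $\phi$ of finite variation and a formal commuting variable $T$, $$\exp_{\mathrm R}(T\cdot\phi)=1+\sum_{n=1}^\infty T^n\int_{t_1\leq\ldots\leq t_n\in I}\phi(t_1)\cdots\phi(t_n).$$ Wilcox expansions: there are unique universal commutator (Lie) polynomials $\zeta^{\leftarrow}_n(X_1,\ldots,X_n)$ and $\zeta^{\rightarrow}_n(X_1,\ldots,X_n)$, linear in each variable, such that for every such $\phi$, as formal power series in $T$, $$\exp_{\mathrm R}(T\cdot\phi)=\ldots\exp(T^3\zeta^{\leftarrow}_{\mathrm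 R,3}(\phi))\exp(T^2\zeta^{\leftarrow}_{\mathrm R,2}(\phi))\exp(T\zeta^{\leftarrow}_{\mathrm R,1}(\phi)),$$ $$\exp_{\mathrm R}(T\cdot\phi)=\exp(T\zeta^{\rightarrow}_{\mathrm R,1}(\phi))\exp(T^2\zeta^{\rightarrow}_{\mathrm R,2}(\phi))\exp(T^3\zeta^{\rightarrow}_{\mathrm R,3}(\phi))\ldots,$$ where $$\zeta^{\leftarrow}_{\mathrm R,n}(\phi)=\int_{t_1\leq\ldots\leq t_n\in I}\zeta^{\leftarrow}_n(\phi(t_1),\ldots,\phi(t_n)),\qquad \zeta^{\rightarrow}_{\mathrm R,n}(\phi)=\int_{t_1\leq\ldots\leq t_n\in I}\zeta^{\rightarrow}_n(\phi(t_1),\ldots,\phi(t_n)).$$ Equivalently, $\zeta^{\leftarrow}_n(X_1,\ldots,X_n)$ is the part linear in each of $X_1,\ldots,X_n$ of the Lie polynomial $L_n$ in the unique factorization $\exp(TX_1)\cdots\exp(TX_n)=\ldots\exp(T^3L_3)\exp(T^2L_2)\exp(TL_1)$ in noncommuting formal variables (with $L_m$ homogeneous of degree $m$ and free of $T$), and analogously for $\zeta^{\rightarrow}_n$ with the factors in the opposite order. E.g. $\zeta^{\leftarrow}_1(X_1)=X_1$, $\zeta^{\leftarrow}_2(X_1,X_2)=\frac12[X_1,X_2]$, $\zeta^{\leftarrow}_3(X_1,X_2,X_3)=\frac13[X_2,[X_1,X_3]]+\frac13[X_1,[X_2,X_3]]$; moreover $\zeta^{\rightarrow}_n(X_1,\ldots,X_n)=-\zeta^{\leftarrow}_n(-X_n,\ldots,-X_1)$.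 Since these are Lie polynomials, $\zeta^{\leftarrow}_{\mathrm R,n}(\alpha)$ and $\zeta^{\rightarrow}_{\mathrm R,n}(\alpha)$ are defined by the same integral formulas for $\mathfrak g$-valued $\alpha$. *)

(* Defs.v *)
From HB Require Import structures.
From mathcomp Require Import all_boot all_order all_algebra.
From mathcomp Require Import complex.
From mathcomp Require Import all_classical all_reals all_analysis.
From mathcomp.multinomials Require Import -(notations) monalg.

Set Implicit Arguments.
Unset Strict Implicit.
Unset Printing Implicit Defensive.

Import Order.TTheory GRing.Theory Num.Theory.
Import numFieldNormedType.Exports.

Local Open Scope classical_set_scope.
Local Open Scope ring_scope.

Inductive scalars := RealScalars | ComplexScalars.

Definition scalar_field (R : realType) (s : scalars) : numFieldType :=
  match s with RealScalars => R | ComplexScalars => R[i]%C end.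

(* The norm of a [normedModType K] takes its values in [K]; over [R[i]] these
   values are real, and [rnorm] is the norm seen as an element of [R]. *)
Definition scalar_re (R : realType) (s : scalars) : scalar_field R s -> R :=
  match s with RealScalars => id | ComplexScalars => @complex.Re R end.

Definition rnorm (R : realType) (s : scalars)
    (g : completeNormedModType (scalar_field R s)) (x : g) : R :=
  scalar_re `|x|.

Record banach_lie (K : numFieldType) (g : completeNormedModType K)
    (br : g -> g -> g) : Prop := BanachLie {
  br_linearl : forall (a : K) (x y z : g),
    br (a *: x + y) z = a *: br x z + br y z;
  br_linearr : forall (a : K) (x y z : g),
    br x (a *: y + z) = a *: br x y + br x z;
  br_alternating : forall x : g, br x x = 0;
  br_jacobi : forall x y z : g,
    br x (br y z) + br y (br z x) + br z (br x y) = 0;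
  br_norm : forall x y : g, `|br x y| <= `|x| * `|y| }.

Section ContinuousMeasures.
Variables (R : realType) (s : scalars).
Variable g : completeNormedModType (scalar_field R s).
Implicit Types (I : interval R) (J : seq (interval R)).

(* [J] lists the pieces of a partition of [I] from left to right; pieces may be
   empty, which adds nothing to the sums below. *)
Definition ordered_partition I J : Prop :=
  [set` I] = [set x | exists2 j, j \in J & x \in j] /\
  forall a b : 'I_(size J), (a < b)%N ->
    forall x y : R, x \in tnth (in_tuple J) a -> y \in tnth (in_tuple J) b ->
    x < y.

Definition vector_variation (alpha : set R -> g) I : \bar R :=
  ereal_sup [set (\sum_(j <- J) rnorm (alpha [set` j]))%:E |
             J in [set J | ordered_partition I J]].

(* The values of [alpha] outside the Borel subsets of [I] are irrelevant. *)
Record continuous_measure_fv I (alpha : set R -> g) : Prop :=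
  ContinuousMeasureFV {
  cm_sigma_additive : forall F : nat -> set (measurableTypeR R),
    (forall k, measurable (F k)) -> (forall k, F k `<=` [set` I]) ->
    trivIset setT F ->
    (\sum_(0 <= k < m) alpha (F k)) @[m --> \oo] --> alpha (\bigcup_k F k);
  cm_atomless : forall t : R, t \in I -> alpha [set t] = 0;
  cm_finite_variation : (vector_variation alpha I < +oo)%E }.

Definition fine_partitions (alpha : set R -> g) I :
    set_system (seq (interval R)) :=
  filter_from [set e : R | 0 < e] (fun e =>
    [set J | ordered_partition I J /\
             forall j, j \in J -> (vector_variation alpha j < e%:E)%E]).

Definition ordered_sum n (P : ('I_n -> g) -> g) (alpha : set R -> g) J : g :=
  \sum_(i : {ffun 'I_n -> 'I_(size J)} |
        [forall a : 'I_n, forall b : 'I_n, (a < b)%N ==> (i a < i b)%N])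
    P (fun a => alpha [set` tnth (in_tuple J) (i a)]).

Definition ordered_integral n (P : ('I_n -> g) -> g) (alpha : set R -> g) I
    : g :=
  lim (ordered_sum P alpha @ fine_partitions alpha I).

Definition ordered_integrable n (P : ('I_n -> g) -> g) (alpha : set R -> g) I
    : Prop :=
  cvg (ordered_sum P alpha @ fine_partitions alpha I).

End ContinuousMeasures.

Inductive lie_expr (n : nat) : Type :=
| LieVar of 'I_n
| LieZero
| LieAdd of lie_expr n & lie_expr n
| LieScale of rat & lie_expr n
| LieBr of lie_expr n & lie_expr n.

Fixpoint lie_eval n (V : zmodType) (scale : rat -> V -> V) (br : V -> V -> V)
    (x : 'I_n -> V) (e : lie_expr n) : V :=
  match e with
  | LieVar i => x i
  | LieZero => 0
  | LieAdd e1 e2 => lie_eval scale br x e1 + lie_eval scale br x e2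
  | LieScale q e1 => scale q (lie_eval scale br x e1)
  | LieBr e1 e2 => br (lie_eval scale br x e1) (lie_eval scale br x e2)
  end.

Definition lie_value n (K : numFieldType) (g : completeNormedModType K)
    (br : g -> g -> g) (e : lie_expr n) (x : 'I_n -> g) : g :=
  lie_eval (fun q v => (ratr q : K) *: v) br x e.

(* The free associative algebra over [rat] on [n] noncommuting variables; a
   [fmonom 'I_n] is a word, i.e. a sequence of indices. *)
Definition ncpoly (n : nat) := malg (fmonom 'I_n) rat.

Definition ncvar n (i : 'I_n) : ncpoly n := mkmalgU (fmu i) 1.

Definition ncpoly_of_lie n (e : lie_expr n) : ncpoly n :=
  lie_eval (fun q p => q *: p) (fun p q => p * q - q * p) (@ncvar n) e.

Definition nc_homogeneous n (m : nat) (p : ncpoly n) : Prop :=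
  forall w : fmonom 'I_n,
    mcoeff w p != 0 -> size (fmonom_val w) = m.

Definition multilinear_part n (p : ncpoly n) : ncpoly n :=
  \sum_(w <- finmap.enum_fset (msupp p) |
         perm_eq (fmonom_val w) (enum 'I_n))
    mkmalgU w (mcoeff w p).

(* [exp (T ^ m * p)] up to degree [N] in [T], where the formal variable [T] is
   the ['X] of [{poly ncpoly n}] and commutes with the coefficients. *)
Definition texp n (N m : nat) (p : ncpoly n) : {poly ncpoly n} :=
  \sum_(k < N.+1) ((k`!%:R^-1 : rat) *: p ^+ k)%:P * 'X^(m * k).

(* The factorizations are identities of formal power series in [T].  The
   coefficient of [T ^ N] only involves the exponentials up to degree [N] and
   the factors with [m <= N]. *)
Definition left_factorization n (L : nat -> ncpoly n) : Prop :=
  forall N : nat,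
    (\prod_(i < n) texp N 1 (ncvar i))`_N =
    (\prod_(m <- rev (index_iota 1 N.+1)) texp N m (L m))`_N.

Definition right_factorization n (L : nat -> ncpoly n) : Prop :=
  forall N : nat,
    (\prod_(i < n) texp N 1 (ncvar i))`_N =
    (\prod_(m <- index_iota 1 N.+1) texp N m (L m))`_N.

Definition homogeneous_lie n (L : nat -> ncpoly n) : Prop :=
  forall m : nat, (0 < m)%N ->
    (exists e : lie_expr n, L m = ncpoly_of_lie e) /\ nc_homogeneous m (L m).

Definition wilcox_left n (z : lie_expr n) : Prop :=
  exists L : nat -> ncpoly n,
    [/\ homogeneous_lie L, left_factorization L &
        ncpoly_of_lie z = multilinear_part (L n)].

Definition wilcox_right n (z : lie_expr n) : Prop :=
  exists L : nat -> ncpoly n,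
    [/\ homogeneous_lie L, right_factorization L &
        ncpoly_of_lie z = multilinear_part (L n)].

(* [zeta_{R,n}(alpha)], for the Lie polynomial [z] in [n] variables. *)
Definition wilcox_term (R : realType) (s : scalars)
    (g : completeNormedModType (scalar_field R s)) (br : g -> g -> g)
    (alpha : set R -> g) (I : interval R) n (z : lie_expr n) : g :=
  ordered_integral (lie_value br z) alpha I.

Definition wilcox_term_exists (R : realType) (s : scalars)
    (g : completeNormedModType (scalar_field R s)) (br : g -> g -> g)
    (alpha : set R -> g) (I : interval R) n (z : lie_expr n) : Prop :=
  ordered_integrable (lie_value br z) alpha I.

Definition taylor_coef (R : realType) (f : R -> R) (n : nat) : R :=
  derive1n n f 0 / n`!%:R.

Definition wilcox_majorant (R : realType) (v : R) (T : R) : R :=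
  1 - Num.sqrt (2^-1 * (2 - T * v) ^+ 2 - 1).

(* Main.v *)
Require Import Defs.
From HB Require Import structures.
From mathcomp Require Import all_boot all_order all_algebra perm.
From mathcomp Require Import boolp.
From mathcomp.multinomials Require Import -(notations) monalg.
From mathcomp Require Import finmap.
From mathcomp Require Import ring lra zify.

Set Implicit Arguments.
Unset Strict Implicit.
Unset Printing Implicit Defensive.

Import Order.TTheory GRing.Theory Num.Theory.
Local Open Scope ring_scope.

(** The right-hand side of the bound is the power series [f(x)], [x] standing
    for [T] times the total variation, that vanishes at [0] and satisfies
    [(1 - f)^2 = 1 - 2x + x^2/2], that is [f = x - x^2/4 + f^2/2]; let [f_n] be
    its coefficients ([maj_coef]).  Everything follows from a bound on the Lie
    polynomials alone:
      [norm (zeta_n(x_1, .., x_n)) <= n! f_n norm x_1 .. norm x_n],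
    proved in [factorization_value_bound].  Integrating a multilinear map
    bounded by [C] over an ordered simplex costs a factor [V^n / n!]
    ([ordered_integral_bound]), so that the [n]-th term is at most [f_n V^n];
    and if [V < 2 - sqrt 2] the partial sums of the series of these numbers
    stay below [1] ([maj_coef_sum_le1]).

    Bound on the polynomials.  Give each variable [X_i] a commuting parameter
    of square zero, and replace it by [x_i] times its parameter.  A Lie
    polynomial then takes its values in functions from sets of variables to
    [g], with the convolution bracket, and its part linear in every variable is
    the coefficient of the full set.  Adjoin to this Lie algebra the
    derivation [delta] that multiplies by the degree ([deg_ext],
    [degree_elt]).  Words in the variables act on the right by iterated
    brackets, Lie polynomials act by brackets with their value ([act_lie]), and
    [delta] applied to a homogeneous Lie polynomial is its degree times its
    value.  Thus the value of a Lie expression is determined by its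
    noncommutative polynomial, as in the theorem of Dynkin, Specht and Wever
    ([lie_value_words], [lie_value_ev]), and the factorization of the ordered
    exponential becomes an identity about the orbit of [delta]
    ([factorization_expad]),
      [delta . exp X_1 .. exp X_n = delta . exp L_n .. exp L_2 exp L_1].

    Write [delta + F_k] for [delta . exp L_n .. exp L_k], and [l_k] for the
    value of [L_k].  By the identity, the coefficients of [F_1] are plain nested
    brackets, so [F_1] is majorized by [e^x - 1] ([ordered_exp_bound]).  As
    [l_k] commutes with itself, [F_k = k l_k + exp(ad l_k) F_(k+1)]
    ([tail_part_step]): the lowest part of [F_k] is [k l_k], and [F_(k+1)] is
    obtained from the other parts by [exp(- ad l_k)].  By induction [F_(k+1)]
    is majorized by [(e^x - 1 - x)] times the product of the [exp(f_j x^j)] for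
    [j <= k], and that series has its coefficient of degree [k + 1] at most
    [(k + 1) f_(k+1)] ([exp_tail_prod_le]), which bounds [l_(k+1)] and
    continues the induction ([factor_bound]).  The factorization with the
    factors in the opposite order is treated in the same way, with words read
    backwards and the bracket exchanged for the opposite one. *)

(** * The majorant series *)

Section Majorant.
Variable R : realFieldType.

(** Iterates for the fixed point equation [f = x - x^2/4 + f^2/2].  Since [f]
    has no constant term, each iteration makes one more coefficient exact. *)
Fixpoint picard (N : nat) : {poly R} :=
  if N is N'.+1 then 'X - 4^-1 *: 'X^2 + 2^-1 *: picard N' ^+ 2 else 'X.

Definition maj_coef n : R := (picard n)`_n.

Lemma picardS_coef N i : (picard N.+1)`_i = (i == 1%N)%:R - 4^-1 * (i == 2%N)%:R
  + 2^-1 * \sum_(j < i.+1) (picard N)`_j * (picard N)`_(i - j).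
Proof. by rewrite /= coefD coefB !coefZ coefX coefXn expr2 coefM. Qed.

Lemma picard_coef0 N : (picard N)`_0 = 0.
Proof.
elim: N => [|N IH]; first by rewrite coefX.
by rewrite picardS_coef big_ord1 IH !mulr0 subr0 addr0.
Qed.

Lemma picard_stable N i : (i <= N.+1)%N -> (picard N.+1)`_i = (picard N)`_i.
Proof.
elim: N i => [|N IH] i hi.
  rewrite picardS_coef /= coefX.
  case: i hi => [|[|i]] // _; rewrite !big_ord_recl big_ord0 !coefX /=; ring.
rewrite !(picardS_coef _ i); congr (_ + _ * _).
apply: eq_bigr => j _.
have [j0|jN0] := eqVneq (j : nat) 0%N.
  by rewrite j0 !picard_coef0 !mul0r.
have [ji|jNi] := eqVneq (j : nat) i.
  by rewrite ji subnn !picard_coef0 !mulr0.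
by rewrite !IH //; have := ltn_ord j; lia.
Qed.

Lemma picard_coef N i : (i <= N.+1)%N -> (picard N)`_i = maj_coef i.
Proof.
move=> hi; rewrite /maj_coef.
have stab m k : (i <= m.+1)%N -> (picard (m + k))`_i = (picard m)`_i.
  by elim: k => [|k IH] hm; rewrite ?addn0 // addnS picard_stable ?IH //; lia.
have [le|lt] := leqP N i; last first.
  by have := stab i (N - i)%N (leqnSn i); rewrite (subnKC (ltnW lt)) => ->.
by have := stab N (i - N)%N hi; rewrite subnKC // => ->.
Qed.

Opaque maj_coef.

Lemma maj_coef0 : maj_coef 0 = 0. Proof. exact: picard_coef0. Qed.

Lemma maj_coef1 : maj_coef 1 = 1.
Proof. by rewrite -(@picard_coef 0) //= coefX. Qed.

Lemma maj_coef_rec n : maj_coef n = (n == 1%N)%:R - 4^-1 * (n == 2%N)%:R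
  + 2^-1 * \sum_(i < n.+1) maj_coef i * maj_coef (n - i).
Proof.
rewrite -(@picard_coef n.+1) ?(leqW) //= !coefE expr2 coefM.
congr (_ + _ * _); apply: eq_bigr => i _.
by rewrite !picard_coef //; have := ltn_ord i; lia.
Qed.

Lemma maj_coef2 : maj_coef 2 = 4^-1.
Proof.
by rewrite maj_coef_rec !big_ord_recl big_ord0 /= !maj_coef0 maj_coef1; field.
Qed.

(** The only negative coefficient of the iteration, [- 1/4] in degree 2, is
    compensated by the square of the linear term. *)
Lemma picard_ge0 N i : 0 <= (picard N)`_i.
Proof.
elim: N i => [|N IH] i; first by rewrite coefX ler0n.
rewrite picardS_coef.
have pos (j : 'I_i.+1) : 0 <= (picard N)`_j * (picard N)`_(i - j).
  by rewrite mulr_ge0.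
have [->|_] := eqVneq i 2%N; last first.
  by rewrite mulr0 subr0 addr_ge0 ?ler0n // mulr_ge0 ?invr_ge0 ?sumr_ge0.
have p1 : (picard N)`_1 = 1 by rewrite picard_coef // maj_coef1.
rewrite !big_ord_recl big_ord0 /= !picard_coef0 p1; lra.
Qed.

Lemma maj_coef_ge0 n : 0 <= maj_coef n. Proof. exact: picard_ge0. Qed.

(** The iterates have nonnegative coefficients and their values at [x] stay in
    [[0, 1]]: as [x^2 - 4 x + 2 >= 0] means [x - x^2/4 + 1/2 <= 1], an iterate
    at most 1 is followed by one at most 1. *)
Lemma maj_coef_sum_le1 (x : R) N : 0 <= x -> x <= 1 -> 0 <= x ^+ 2 - 4 * x + 2 ->
  \sum_(1 <= n < N.+1) maj_coef n * x ^+ n <= 1.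
Proof.
move=> x0 x1 hx.
have picard01 M : 0 <= (picard M).[x] <= 1.
  apply/andP; split.
    by rewrite horner_coef sumr_ge0 // => i _; rewrite mulr_ge0 ?picard_ge0 ?exprn_ge0.
  elim: M => [|M IH] /=; rewrite ?hornerX //.
  rewrite !hornerD hornerN !hornerZ hornerX hornerXn horner_exp.
  suff : (picard M).[x] ^+ 2 <= 1 by move: hx; lra.
  rewrite expr_le1 // horner_coef sumr_ge0 // => i _.
  by rewrite mulr_ge0 ?picard_ge0 ?exprn_ge0.
apply: le_trans (_ : (picard N).[x] <= 1); last by case/andP: (picard01 N).
rewrite (@horner_coef_wide _ (maxn N.+1 (size (picard N)))) ?leq_maxr //.
rewrite -(big_mkord xpredT (fun i => (picard N)`_i * x ^+ i)).
have lemax : (N.+1 <= maxn N.+1 (size (picard N)))%N by rewrite leq_maxl.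
rewrite [leRHS]big_ltn ?(leq_trans _ lemax) // picard_coef0 mul0r add0r.
rewrite [leRHS](@big_cat_nat _ _ _ N.+1 1) //= ler_wpDr //; last first.
  by apply: ler_sum_nat => i hi; rewrite picard_coef //; lia.
by rewrite sumr_ge0 // => i _; rewrite mulr_ge0 ?picard_ge0 ?exprn_ge0.
Qed.

(** The coefficients of [r = 1/(1 - f)], read off from the derivative [f' = (1
    - x/2) r] of the fixed point equation. *)
Fixpoint inv_coef n : R :=
  if n is k.+1 then (n.+1)%:R * maj_coef n.+1 + 2^-1 * inv_coef k else 1.
Arguments inv_coef : simpl never.

Lemma inv_coefS k : inv_coef k.+1 = k.+2%:R * maj_coef k.+2 + 2^-1 * inv_coef k.
Proof. by []. Qed.

Lemma maj_coef_inv_coef k : k.+2%:R * maj_coef k.+2 = inv_coef k.+1 - 2^-1 * inv_coef k.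
Proof. by rewrite inv_coefS addrK. Qed.

Lemma inv_coef_ge0 n : 0 <= inv_coef n.
Proof.
elim: n => [|n IH]; first exact: ler01.
by rewrite inv_coefS addr_ge0 ?mulr_ge0 ?maj_coef_ge0 ?invr_ge0.
Qed.

(** This is the equation [f' = 1 - x/2 + f f'], coefficient by coefficient. *)
Lemma maj_coef_deriv n : (n.+1)%:R * maj_coef n.+1 =
  (n == 0%N)%:R - 2^-1 * (n == 1%N)%:R
  + \sum_(i < n.+1) maj_coef i * ((n - i).+1%:R * maj_coef (n - i).+1).
Proof.
have -> : \sum_(i < n.+1) maj_coef i * ((n - i).+1%:R * maj_coef (n - i).+1) =
    2^-1 * (n.+1%:R * \sum_(i < n.+2) maj_coef i * maj_coef (n.+1 - i)).
  set S := LHS.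
  have S1 : S = \sum_(i < n.+2) (n.+1 - i)%:R * (maj_coef i * maj_coef (n.+1 - i)).
    rewrite big_ord_recr /= subnn mul0r addr0; apply: eq_bigr => i _.
    have hi : (i <= n)%N by rewrite -ltnS ltn_ord.
    by rewrite subSn // mulrCA.
  have S2 : S = \sum_(i < n.+2) (i : nat)%:R * (maj_coef i * maj_coef (n.+1 - i)).
    rewrite S1 (reindex_inj rev_ord_inj) /=; apply: eq_bigr => i _.
    have hi : (i <= n.+1)%N by have := ltn_ord i; lia.
    by rewrite !subSS subKn // (mulrC (maj_coef _)).
  have : S + S = n.+1%:R * \sum_(i < n.+2) maj_coef i * maj_coef (n.+1 - i).
    rewrite {1}S1 S2 -big_split mulr_sumr; apply: eq_bigr => i _ /=.
    rewrite -mulrDl -natrD subnK //; by have := ltn_ord i; lia.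
  by move=> <-; lra.
rewrite {1}maj_coef_rec eqSS.
case: n => [|[|n]] /=; rewrite ?eqxx /=; set T := \sum_(_ < _) _.
- by field.
- by field.
- by ring.
Qed.

(** This is [r = 1 + f r]: multiplying [f' = (1 - x/2) r] by [f] and comparing
    with [f' = 1 - x/2 + f f'] gives [(1 - x/2)(r - 1 - f r) = 0]. *)
Lemma inv_coef_rec n : inv_coef n.+1 = \sum_(j < n.+1) maj_coef j.+1 * inv_coef (n - j).
Proof.
pose e k := \sum_(i < k.+1) maj_coef i * inv_coef (k - i).
have e0 : e 0%N = 0 by rewrite /e big_ord1 maj_coef0 mul0r.
have drec k : inv_coef k.+1 - 2^-1 * inv_coef k =
    - 2^-1 * (k == 0)%:R + (e k.+1 - 2^-1 * e k).
  rewrite -maj_coef_inv_coef maj_coef_deriv /= sub0r mulNr; congr (_ + _).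
  rewrite /e [\sum_(i < k.+2) _ in RHS]big_ord_recr [LHS]big_ord_recr /=.
  rewrite !subnn /= maj_coef1 [inv_coef 0]/1 mulr1 mulr_sumr mulr1.
  rewrite [RHS]addrAC -sumrB; congr (_ + _).
  apply: eq_bigr => i _.
  have -> : (k.+1 - i = (k - i).+1)%N by have := ltn_ord i; lia.
  by rewrite maj_coef_inv_coef; ring.
have rE k : inv_coef k.+1 = e k.+1.
  elim: k => [|k IH].
    have := drec 0%N; rewrite e0 eqxx [inv_coef 0]/1 !mulr1 mulr0 subr0; lra.
  by have := drec k.+1; rewrite /= IH; lra.
by rewrite rE /e big_ord_recl maj_coef0 mul0r add0r; apply: eq_bigr => i _.
Qed.

Lemma maj_coef_le_succ n : (2 <= n)%N -> maj_coef n <= maj_coef n.+1.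
Proof.
move=> n2; rewrite [leRHS]maj_coef_rec.
have h1 : (1 < n.+2)%N by []. have hn : (n < n.+2)%N by [].
rewrite (bigD1 (Ordinal h1)) //= (bigD1 (Ordinal hn)) /=; last first.
  by apply/eqP => /(congr1 val) /=; lia.
have -> : (n.+1 == 1%N) = false by lia.
have -> : (n.+1 == 2%N) = false by lia.
rewrite subn1 subSn // subnn maj_coef1 /= mul1r mulr1.
set S := \sum_(_ < _ | _) _.
have : 0 <= S by rewrite sumr_ge0 // => i _; rewrite mulr_ge0 ?maj_coef_ge0.
lra.
Qed.

(** From degree 2 on, the [f_j] increase, and they start at [1/4 >= 1/3!]. *)
Lemma fact_inv_le_maj_coef j : (2 <= j)%N -> (j.+1)`!%:R^-1 <= maj_coef j.
Proof.
move=> j2; apply: (@le_trans _ _ 4^-1).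
  rewrite lef_pV2 ?posrE ?ltr0n ?fact_gt0 // ler_nat.
  by case: j j2 => [|[|j]] // _; rewrite !factS; have := fact_gt0 j; nia.
rewrite -maj_coef2; elim: j j2 => [|j IH] // j2.
have [->//|j1] := eqVneq j 1%N.
by apply: le_trans (maj_coef_le_succ _); [apply: IH|]; lia.
Qed.

(** The exponential of [f_j x^j], truncated. *)
Definition exp_mono n j : {poly R} := \sum_(k < n.+1) k`!%:R^-1 *: (maj_coef j *: 'X^j) ^+ k.

Definition exp_prod n m : {poly R} := \prod_(1 <= j < m.+1) exp_mono n j.

(** Coefficientwise inequalities [p <= q] are expressed as [nneg (q - p)]. *)
Definition nneg (p : {poly R}) := forall i, 0 <= p`_i.

Lemma nnegD p q : nneg p -> nneg q -> nneg (p + q).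
Proof. by move=> hp hq i; rewrite coefD addr_ge0. Qed.

Lemma nnegM p q : nneg p -> nneg q -> nneg (p * q).
Proof. by move=> hp hq i; rewrite coefM sumr_ge0 // => j _; rewrite mulr_ge0. Qed.

Lemma nnegZ c p : 0 <= c -> nneg p -> nneg (c *: p).
Proof. by move=> hc hp i; rewrite coefZ mulr_ge0. Qed.

Lemma nneg1 : nneg 1.
Proof. by move=> i; rewrite coef1 ler0n. Qed.

Lemma nnegXn k : nneg 'X^k.
Proof. by move=> i; rewrite coefXn ler0n. Qed.

Lemma nnegX k p : nneg p -> nneg (p ^+ k).
Proof. by move=> hp; elim: k => [|k IH]; rewrite ?exprS; [exact: nneg1|exact: nnegM]. Qed.

Lemma nneg_sum (J : Type) (s : seq J) (F : J -> {poly R}) :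
  (forall j, nneg (F j)) -> nneg (\sum_(j <- s) F j).
Proof. by move=> h i; rewrite coef_sum sumr_ge0 // => j _; apply: h. Qed.

Lemma nneg_prod (J : Type) (s : seq J) (F : J -> {poly R}) :
  (forall j, nneg (F j)) -> nneg (\prod_(j <- s) F j).
Proof. by move=> h; elim/big_rec: _ => [|j p _ hp]; [exact: nneg1|exact: nnegM]. Qed.

Lemma nneg_mono j : nneg (maj_coef j *: 'X^j).
Proof. exact/nnegZ/nnegXn/maj_coef_ge0. Qed.

Lemma nneg_exp_mono n j : nneg (exp_mono n j).
Proof.
apply: nneg_sum => k; apply: nnegZ; first by rewrite invr_ge0.
exact/nnegX/nneg_mono.
Qed.

Lemma nneg_exp_prod n m : nneg (exp_prod n m).
Proof. by apply: nneg_prod => j; apply: nneg_exp_mono. Qed.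

(** For the full exponential this difference is zero; truncation leaves the
    last term. *)
Lemma exp_mono_deriv n j : (0 < j)%N ->
  nneg (j%:R *: (maj_coef j *: 'X^j) * exp_mono n j - 'X * (exp_mono n j)^`()).
Proof.
move=> j0; set m := maj_coef j *: 'X^j.
have mE : 'X * m^`() = j%:R *: m.
  rewrite derivZ derivXn -scaler_nat -!scalerAr -exprS prednK //.
  by rewrite /m !scalerA mulrC.
have dE k : 'X * (m ^+ k.+1)^`() = (k.+1%:R * j%:R) *: m ^+ k.+1.
  by rewrite deriv_exp /= -[_ *+ k.+1]scaler_nat -scalerAr mulrA mE -scalerAl -exprS scalerA.
have -> : j%:R *: m * exp_mono n j - 'X * (exp_mono n j)^`() =
    (j%:R * n`!%:R^-1) *: m ^+ n.+1.
  rewrite /exp_mono raddf_sum /= !mulr_sumr.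
  under [X in _ - X]eq_bigr do rewrite derivZ -scalerAr.
  rewrite [X in _ - X]big_ord_recl expr0 derivC mulr0 scaler0 add0r.
  rewrite big_ord_recr /= addrAC -sumrB big1 ?add0r; last first.
    move=> k _; rewrite /bump /= add1n dE -scalerAl -scalerAr -exprS !scalerA.
    rewrite -scalerBl; set c := _ - _; suff -> : c = 0 by rewrite scale0r.
    have k1 : k.+1%:R != 0 :> R by rewrite pnatr_eq0.
    have kf : k`!%:R != 0 :> R by rewrite pnatr_eq0 -lt0n fact_gt0.
    rewrite /c factS natrM; move: (k.+1%:R) (k`!%:R) k1 kf => a b a0 b0.
    by field; rewrite a0 b0.
  by rewrite -scalerAl -scalerAr -exprS scalerA.
apply: nnegZ; first by rewrite mulr_ge0 ?invr_ge0.
exact/nnegX/nneg_mono.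
Qed.

(** The logarithmic derivative of a product is the sum of those of its
    factors. *)
Lemma exp_prod_deriv n m : nneg ((\sum_(1 <= j < m.+1) j%:R *: (maj_coef j *: 'X^j)) * exp_prod n m
    - 'X * (exp_prod n m)^`()).
Proof.
elim: m => [|m IH].
  by rewrite /exp_prod !big_geq // derivC mulr0 mul0r subr0 => i; rewrite coef0.
rewrite /exp_prod !(big_nat_recr m.+1) //= -/(exp_prod n m) derivM.
set S := \sum_(_ <= _ < _) _ in IH *; set e := exp_mono n m.+1; set t := _ *: (_ *: _).
have -> : (S + t) * (exp_prod n m * e) - 'X * ((exp_prod n m)^`() * e + exp_prod n m * e^`()) =
  (S * exp_prod n m - 'X * (exp_prod n m)^`()) * e + exp_prod n m * (t * e - 'X * e^`()) by ring.
apply: nnegD; apply: nnegM; [exact: IH|exact: nneg_exp_mono|exact: nneg_exp_prod|].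
exact: exp_mono_deriv.
Qed.

Lemma exp_prod_coef0 n m : (exp_prod n m)`_0 = 1.
Proof.
rewrite -horner_coef0 horner_prod big_nat big1 // => j /andP[j1 _].
rewrite horner_sum big_ord_recl expr0 fact0 invr1 scale1r hornerC big1 ?addr0 //.
move=> k _; rewrite !hornerE expr0n; case: j j1 => // j _.
by rewrite mulr0 expr0n mulr0.
Qed.

(** Compare coefficients of degree [i + 1] in [exp_prod_deriv], and bound the
    factor [j + 1] of [f_(j+1)] by [i + 1]. *)
Lemma exp_prod_rec n m i : (exp_prod n m)`_i.+1 <= \sum_(j < i.+1) maj_coef j.+1 * (exp_prod n m)`_(i - j).
Proof.
have := exp_prod_deriv n m i.+1; rewrite coefB coefXM coef_deriv /= coefM.
rewrite big_ord_recl subr_ge0.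
have cS k : (\sum_(1 <= j < m.+1) j%:R *: (maj_coef j *: 'X^j))`_k =
    if (0 < k <= m)%N then k%:R * maj_coef k else 0.
  rewrite coef_sum; case: ifP => [hk|hk].
    rewrite (bigD1_seq k) ?mem_index_iota ?iota_uniq //= !coefZ coefXn eqxx mulr1.
    by rewrite big1 ?addr0 // => j jk; rewrite !coefZ coefXn eq_sym (negbTE jk) !mulr0.
  rewrite big_nat big1 // => j hj; rewrite !coefZ coefXn.
  have -> : (k == j) = false by lia.
  by rewrite !mulr0.
rewrite cS mul0r add0r -mulr_natl => h.
rewrite -(@ler_pM2l _ i.+1%:R) ?ltr0n //; apply: le_trans h _.
rewrite mulr_sumr; apply: ler_sum => j _.
rewrite cS /bump /= ?add1n subSS mulrA ler_wpM2r ?nneg_exp_prod //.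
case: ifP => _; last by rewrite mulr_ge0 ?maj_coef_ge0.
by rewrite ler_wpM2r ?maj_coef_ge0 // ler_nat.
Qed.

(** The right-hand side satisfies with equality the recursion that holds for
    the left-hand side as an inequality. *)
Lemma exp_prod_le_inv_coef n m i : (exp_prod n m)`_i <= inv_coef i.
Proof.
elim/ltn_ind: i => -[|i] IH; first by rewrite exp_prod_coef0.
rewrite inv_coef_rec; apply: le_trans (exp_prod_rec n m i) _.
apply: ler_sum => j _; rewrite ler_wpM2l ?maj_coef_ge0 // IH //; lia.
Qed.

(** The series [e^x - 1 - x], truncated. *)
Definition exp_tail n : {poly R} := \sum_(2 <= j < n.+1) j`!%:R^-1 *: 'X^j.

Lemma exp_tail_coef N i : (exp_tail N)`_i = if (2 <= i <= N)%N then i`!%:R^-1 else 0.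
Proof.
rewrite coef_sum; case: ifP => hi.
  rewrite (bigD1_seq i) ?mem_index_iota ?iota_uniq //= !coefZ coefXn eqxx mulr1.
  by rewrite big1 ?addr0 // => j jk; rewrite !coefZ coefXn eq_sym (negbTE jk) mulr0.
rewrite big_nat big1 // => j hj; rewrite !coefZ coefXn.
have -> : (i == j) = false by lia.
by rewrite mulr0.
Qed.

(** This closes the induction of the main estimate.  By [exp_prod_le_inv_coef]
    the left side is at most the sum of the [r_(k-j)/j!] for [j >= 2].  On the
    right, [k f_k = r_(k-1) - r_(k-2)/2], and expanding [r_(k-1)] by [r = 1 +
    f r] turns this into [r_(k-2)/2] plus the sum of the [f_j r_(k-1-j)] for
    [j >= 2]; then [1/(j+1)! <= f_j]. *)
Lemma exp_tail_prod_le n m k : (2 <= k)%N ->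
  (exp_tail n * exp_prod n m)`_k <= k%:R * maj_coef k.
Proof.
case: k => [|[|k]] // _.
rewrite maj_coef_inv_coef.
have c2 i : (exp_tail n)`_i <= if (2 <= i)%N then i`!%:R^-1 else 0.
  rewrite exp_tail_coef; case: ifP => [/andP[-> _] //|_].
  by case: ifP; rewrite ?invr_ge0.
rewrite coefM 2!big_ord_recl /=.
have := c2 0%N; have := c2 1%N => /= h1 h0.
apply: (@le_trans _ _ (\sum_(j < k.+1) j.+2`!%:R^-1 * inv_coef (k - j))).
  rewrite addrA -[leRHS]add0r lerD //.
    rewrite -[leRHS]addr0 lerD //; rewrite mulr_le0_ge0 ?nneg_exp_prod //.
  apply: ler_sum => j _; rewrite /bump /= ?add1n !subSS.
  by rewrite ler_pM ?exp_prod_le_inv_coef ?nneg_exp_prod ?(c2 j.+2) // nneg_sum // => i; apply/nnegZ/nnegXn; rewrite invr_ge0.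
rewrite inv_coef_rec big_ord_recl [in leRHS]big_ord_recl subn0 maj_coef1 mul1r.
suff : \sum_(i < k) (bump 0 i).+2`!%:R^-1 * inv_coef (k - bump 0 i) <=
   \sum_(i < k) maj_coef (bump 0 i).+1 * inv_coef (k - bump 0 i).
  rewrite /= (_ : 2`! = 2)%N //; lra.
apply: ler_sum => j _; rewrite ler_wpM2r ?inv_coef_ge0 //.
exact: fact_inv_le_maj_coef.
Qed.

End Majorant.

(** * Convolution Lie algebras and their degree derivation *)

Record lie_bracket (K : numFieldType) (g : lmodType K) (br : g -> g -> g) : Prop := {
  lie_linearl : forall a x y z, br (a *: x + y) z = a *: br x z + br y z;
  lie_linearr : forall a x y z, br x (a *: y + z) = a *: br x y + br x z;
  lie_alt : forall x, br x x = 0;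
  lie_jacobi : forall x y z, br x (br y z) + br y (br z x) + br z (br x y) = 0 }.

Section LieBracket.
Variables (K : numFieldType) (g : lmodType K) (br : g -> g -> g).
Hypothesis hbr : lie_bracket br.

Lemma lieDl x y z : br (x + y) z = br x z + br y z.
Proof. by have := lie_linearl hbr 1 x y z; rewrite !scale1r. Qed.

Lemma lieDr x y z : br x (y + z) = br x y + br x z.
Proof. by have := lie_linearr hbr 1 x y z; rewrite !scale1r. Qed.

Lemma lie0l x : br 0 x = 0.
Proof. by apply: (addrI (br 0 x)); rewrite -lieDl !addr0. Qed.

Lemma lie0r x : br x 0 = 0.
Proof. by apply: (addrI (br x 0)); rewrite -lieDr !addr0. Qed.

Lemma lieZl a x y : br (a *: x) y = a *: br x y.
Proof. by have := lie_linearl hbr a x 0 y; rewrite lie0l !addr0. Qed.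

Lemma lieZr a x y : br x (a *: y) = a *: br x y.
Proof. by have := lie_linearr hbr a x y 0; rewrite lie0r !addr0. Qed.

Lemma lieNr x y : br x (- y) = - br x y.
Proof. by rewrite -scaleN1r lieZr scaleN1r. Qed.

Lemma lie_suml (T : Type) (s : seq T) P (F : T -> g) y :
  br (\sum_(i <- s | P i) F i) y = \sum_(i <- s | P i) br (F i) y.
Proof. exact: (big_morph (br^~ y) (fun a b => lieDl a b y) (lie0l y)). Qed.

Lemma lie_sumr (T : Type) (s : seq T) P (F : T -> g) x :
  br x (\sum_(i <- s | P i) F i) = \sum_(i <- s | P i) br x (F i).
Proof. exact: (big_morph (br x) (lieDr x) (lie0r x)). Qed.

Lemma lie_anti x y : br x y = - br y x.
Proof.
apply/eqP; rewrite -subr_eq0 opprK; apply/eqP.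
by have := lie_alt hbr (x + y); rewrite lieDl !lieDr !(lie_alt hbr) add0r addr0.
Qed.

(** The Jacobi identity in the form used for right actions. *)
Lemma lie_deriv x a b : br (br x a) b - br (br x b) a = br x (br a b).
Proof.
have := lie_jacobi hbr x a b => /eqP; rewrite -addrA addr_eq0 => /eqP ->.
rewrite opprD addrC (lie_anti (br x a)) (lie_anti (br x b)) opprK.
by rewrite (lie_anti b x) (lieNr a) opprK.
Qed.

(** Passing to the opposite bracket exchanges the two factorizations. *)
Lemma lie_swap : lie_bracket (fun x y => br y x).
Proof.
split=> [a x y z|a x y z|x|x y z]; rewrite ?(lie_linearl hbr) ?(lie_linearr hbr) ?(lie_alt hbr) //.
have E a b c : br (br a b) c = br c (br b a).
  by rewrite lie_anti (lie_anti a b) lieNr opprK.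
by rewrite (E z y x) (E x z y) (E y x z) (lie_jacobi hbr).
Qed.

End LieBracket.

(** Antisymmetry gives [br x x = 0] because 2 is invertible. *)
Lemma lie_bracket_of (K : numFieldType) (g : lmodType K) (br : g -> g -> g) :
  (forall a x y z, br (a *: x + y) z = a *: br x z + br y z) ->
  (forall x y, br x y = - br y x) ->
  (forall x a b, br (br x a) b - br (br x b) a = br x (br a b)) ->
  lie_bracket br.
Proof.
move=> hl anti jac.
have lr a x y z : br x (a *: y + z) = a *: br x y + br x z.
  by rewrite anti hl opprD -scalerN -!(anti x).
split=> // [x|x y z].
  have := anti x x => /eqP; rewrite -addr_eq0 -mulr2n -scaler_nat scaler_eq0.
  by rewrite pnatr_eq0 /= => /eqP.
have NN u w : br u (- w) = - br u w.
  have z0 : br u 0 = 0.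
    by apply: (addrI (br u 0)); rewrite -[X in X + _]scale1r -lr scale1r !addr0.
  by have := lr (- 1) u w 0; rewrite z0 !addr0 !scaleN1r.
rewrite -[br x (br y z)]jac (anti z x) NN (anti (br x y)) (anti (br x z)).
by rewrite opprK addrK addNr.
Qed.

(** A finite partial commutative semigroup with an additive degree.  The
    functions from it to a Lie algebra form a truncated version of the tensor
    product of the Lie algebra with a commutative graded algebra. *)
Record graded_index (X : finType) (jn : X -> X -> option X) (deg : X -> nat) : Prop := {
  jnC : forall a b, jn a b = jn b a;
  jnA : forall a b c, obind (fun d => jn d c) (jn a b) = obind (jn a) (jn b c);
  jn_deg : forall a b c, jn a b = Some c -> deg c = (deg a + deg b)%N }.

Section Convolution.
Variables (K : numFieldType) (g : lmodType K) (br : g -> g -> g).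
Hypothesis hbr : lie_bracket br.
Variables (X : finType) (jn : X -> X -> option X) (deg : X -> nat).
Hypothesis hX : graded_index jn deg.

Definition conv_br (F G : {ffun X -> g}) : {ffun X -> g} :=
  [ffun s => \sum_a \sum_b (jn a b == Some s)%:R *: br (F a) (G b)].

Lemma conv_br_assocl (F G H : {ffun X -> g}) s :
  conv_br (conv_br F G) H s = \sum_a \sum_b \sum_c
    (obind (fun d => jn d c) (jn a b) == Some s)%:R *: br (br (F a) (G b)) (H c).
Proof.
rewrite ffunE.
transitivity (\sum_a \sum_b \sum_c \sum_d
   ((jn a b == Some d)%:R * (jn d c == Some s)%:R) *: br (br (F a) (G b)) (H c)).
  transitivity (\sum_d \sum_c \sum_a \sum_b
   ((jn a b == Some d)%:R * (jn d c == Some s)%:R) *: br (br (F a) (G b)) (H c)).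
    apply: eq_bigr => d _; apply: eq_bigr => c _.
    rewrite ffunE (lie_suml hbr) scaler_sumr; apply: eq_bigr => a _.
    rewrite (lie_suml hbr) scaler_sumr; apply: eq_bigr => b _.
    by rewrite (lieZl hbr) scalerA mulrC.
  rewrite exchange_big /=; under eq_bigr do rewrite exchange_big /=.
  rewrite exchange_big /=; apply: eq_bigr => a _.
  under eq_bigr do rewrite exchange_big /=.
  rewrite exchange_big /=; apply: eq_bigr => b _.
  exact: eq_bigr.
apply: eq_bigr => a _; apply: eq_bigr => b _; apply: eq_bigr => c _.
rewrite -scaler_suml; congr (_ *: _).
case: (jn a b) => [d|] /=; last by rewrite big1 // => d _; rewrite mul0r.
rewrite (bigD1 d) //= eqxx mul1r big1 ?addr0 // => e ed.
rewrite (_ : (Some d == Some e) = (d == e)) // eq_sym (negbTE ed) mul0r //.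
Qed.

Lemma conv_br_assocr (F G H : {ffun X -> g}) s :
  conv_br F (conv_br G H) s = \sum_a \sum_b \sum_c
    (obind (jn a) (jn b c) == Some s)%:R *: br (F a) (br (G b) (H c)).
Proof.
rewrite ffunE; apply: eq_bigr => a _.
transitivity (\sum_b \sum_c \sum_d
   ((jn b c == Some d)%:R * (jn a d == Some s)%:R) *: br (F a) (br (G b) (H c))).
  transitivity (\sum_d \sum_b \sum_c
   ((jn b c == Some d)%:R * (jn a d == Some s)%:R) *: br (F a) (br (G b) (H c))).
    apply: eq_bigr => d _.
    rewrite ffunE (lie_sumr hbr) scaler_sumr; apply: eq_bigr => b _.
    rewrite (lie_sumr hbr) scaler_sumr; apply: eq_bigr => c _.
    by rewrite (lieZr hbr) scalerA mulrC.
  rewrite exchange_big /=; apply: eq_bigr => b _.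
  by rewrite exchange_big.
apply: eq_bigr => b _; apply: eq_bigr => c _.
rewrite -scaler_suml; congr (_ *: _).
case: (jn b c) => [d|] /=; last by rewrite big1 // => d _; rewrite mul0r.
rewrite (bigD1 d) //= eqxx mul1r big1 ?addr0 // => e ed.
rewrite (_ : (Some d == Some e) = (d == e)) // eq_sym (negbTE ed) mul0r //.
Qed.

Lemma lie_conv : lie_bracket conv_br.
Proof.
apply: lie_bracket_of => [a F G H|F G|F A B].
- apply/ffunP => s; rewrite !ffunE scaler_sumr -big_split; apply: eq_bigr => i _.
  rewrite scaler_sumr -big_split; apply: eq_bigr => j _ /=.
  by rewrite !ffunE (lie_linearl hbr) scalerDr !scalerA mulrC.
- apply/ffunP => s; rewrite !ffunE exchange_big -sumrN; apply: eq_bigr => i _.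
  rewrite -sumrN; apply: eq_bigr => j _ /=.
  by rewrite (jnC hX) (lie_anti hbr) scalerN.
- apply/ffunP => s.
  have subE (u w : {ffun X -> g}) : (u - w) s = u s - w s by rewrite !ffunE.
  rewrite subE conv_br_assocr !conv_br_assocl.
  rewrite -sumrB; apply: eq_bigr => a _.
  rewrite [X in _ - X]exchange_big -sumrB; apply: eq_bigr => b _ /=.
  rewrite -sumrB; apply: eq_bigr => c _.
  rewrite -(jnA hX) -(lie_deriv hbr) scalerBr; congr (_ *: _ - _ *: _).
  congr (_ == _)%:R; rewrite !(jnA hX) (jnC hX b c) //.
Qed.

Definition deg_der (F : {ffun X -> g}) : {ffun X -> g} :=
  [ffun s => (deg s)%:R *: F s].

Lemma deg_der_conv F G :
  deg_der (conv_br F G) = conv_br (deg_der F) G + conv_br F (deg_der G).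
Proof.
apply/ffunP => s; rewrite !ffunE scaler_sumr -big_split; apply: eq_bigr => a _.
rewrite scaler_sumr -big_split; apply: eq_bigr => b _ /=; rewrite !ffunE.
rewrite (lieZl hbr) (lieZr hbr) !scalerA -scalerDl; congr (_ *: _).
have [/(jn_deg hX)->|_] := eqVneq (jn a b) (Some s); last by rewrite !mul0r mulr0 addr0.
by rewrite natrD mulr1 !mul1r.
Qed.

(** The element [(a, F)] stands for [a delta + F], where [delta] is the degree
    derivation. *)
Definition deg_ext : lmodType K := (K^o * {ffun X -> g})%type.

(** The bracket of [m] with [G], for the convention in which [delta] sends [G]
    to [deg_der G]. *)
Definition ad_right (m : deg_ext) (G : {ffun X -> g}) : deg_ext :=
  (0, m.1 *: deg_der G + conv_br m.2 G).

Lemma deg_der_lin a F G : deg_der (a *: F + G) = a *: deg_der F + deg_der G.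
Proof.
by apply/ffunP => s; rewrite !ffunE scalerDr !scalerA mulrC.
Qed.

Lemma adr_linl a m m' G : ad_right (a *: m + m') G = a *: ad_right m G + ad_right m' G.
Proof.
rewrite /ad_right; congr pair; rewrite /= ?scaler0 ?addr0 //.
rewrite (lie_linearl lie_conv) scalerDl scalerDr scalerA.
by rewrite [(a *: m.1 : K^o)]/(a * m.1) addrACA.
Qed.

Lemma adr_linr a m F G : ad_right m (a *: F + G) = a *: ad_right m F + ad_right m G.
Proof.
rewrite /ad_right; congr pair; rewrite /= ?scaler0 ?addr0 //.
by rewrite (lie_linearr lie_conv) deg_der_lin !scalerDr !scalerA mulrC addrACA.
Qed.

(** The bracket from the right is a Lie action on [deg_ext] because [deg_der]
    is a derivation. *)
Lemma adr_jacobi m A B : ad_right (ad_right m A) B - ad_right (ad_right m B) A = ad_right m (conv_br A B).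
Proof.
rewrite /ad_right; congr pair; rewrite /= ?subrr // !scale0r !add0r.
rewrite deg_der_conv !(lieDl lie_conv) !(lieZl lie_conv) opprD addrACA.
rewrite (lie_deriv lie_conv) -scalerBr; congr (_ *: _ + _).
by rewrite (lie_anti lie_conv (deg_der B)) opprK.
Qed.

End Convolution.

(** * The action of noncommutative polynomials *)

Section Action.
Variables (K : numFieldType) (g : lmodType K) (br : g -> g -> g).
Hypothesis hbr : lie_bracket br.
Variables (X : finType) (jn : X -> X -> option X) (deg : X -> nat).
Hypothesis hX : graded_index jn deg.
Variables (n : nat) (x : 'I_n -> {ffun X -> g}) (d : bool).

Local Notation V := (deg_ext g X).
Local Notation adr := (ad_right br jn deg).
Local Notation cbr := (conv_br br jn).

(** The first letter of a word acts first.  With the flag [d] the word is read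
    backwards; the brackets of [lie_ev] are then exchanged accordingly. *)
Definition wact (w : seq 'I_n) (m : V) : V :=
  foldl (fun m i => adr m (x i)) m (if d then rev w else w).

Definition nc_act (p : ncpoly n) (m : V) : V :=
  \sum_(w <- msupp p) (ratr (mcoeff w p) : K) *: wact (fmonom_val w) m.

Local Notation act := nc_act.

Lemma adrDr m F G : adr m (F + G) = adr m F + adr m G.
Proof. by have := adr_linr hbr hX 1 m F G; rewrite !scale1r. Qed.

Lemma adr0r m : adr m 0 = 0.
Proof. by apply: (addrI (adr m 0)); rewrite -adrDr !addr0. Qed.

Lemma adrZr a m G : adr m (a *: G) = a *: adr m G.
Proof. by have := adr_linr hbr hX a m G 0; rewrite adr0r !addr0. Qed.

Lemma foldl_adr_lin s a m m' :
  foldl (fun m i => adr m (x i)) (a *: m + m') s =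
  a *: foldl (fun m i => adr m (x i)) m s + foldl (fun m i => adr m (x i)) m' s.
Proof. by elim: s m m' => //= i s IH m m'; rewrite (adr_linl hbr hX) IH. Qed.

Lemma wact_lin w a m m' : wact w (a *: m + m') = a *: wact w m + wact w m'.
Proof. exact: foldl_adr_lin. Qed.

Lemma actEw (D : {fset fmonom 'I_n}) p m : fsubset (msupp p) D ->
  act p m = \sum_(w <- D) (ratr (mcoeff w p) : K) *: wact (fmonom_val w) m.
Proof.
move=> le; rewrite /nc_act (big_fset_incl _ le) //= => w _ /mcoeff_outdom ->.
by rewrite rmorph0 scale0r.
Qed.

Lemma actU c w m : act (mkmalgU w c) m = (ratr c : K) *: wact (fmonom_val w) m.
Proof. by rewrite (actEw _ msuppU_le) big_seq_fset1 mcoeffUU. Qed.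

Lemma actDl p q m : act (p + q) m = act p m + act q m.
Proof.
pose D := fsetU (msupp p) (msupp q).
rewrite (@actEw D) ?msuppD_le // (@actEw D p) ?fsubsetUl // (@actEw D q) ?fsubsetUr //.
rewrite -big_split; apply: eq_bigr => w _ /=.
by rewrite mcoeffD rmorphD scalerDl.
Qed.

Lemma actZl c p m : act (c *: p) m = (ratr c : K) *: act p m.
Proof.
rewrite (actEw _ (msuppZ_le c p)) scaler_sumr; apply: eq_bigr => w _.
by rewrite mcoeffZ rmorphM scalerA.
Qed.

Lemma act0l m : act 0 m = 0.
Proof. by rewrite /nc_act msupp0 big_seq_fset0. Qed.

Lemma actNl p m : act (- p) m = - act p m.
Proof. by rewrite -[- p]scaleN1r actZl rmorphN1 scaleN1r. Qed.

Lemma actBl p q m : act (p - q) m = act p m - act q m.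
Proof. by rewrite actDl actNl. Qed.

Lemma act_suml (T : Type) (s : seq T) P (F : T -> ncpoly n) m :
  act (\sum_(i <- s | P i) F i) m = \sum_(i <- s | P i) act (F i) m.
Proof. exact: (big_morph (act^~ m) (fun p q => actDl p q m) (act0l m)). Qed.

Lemma wact_cat u w m :
  wact (u ++ w) m = if d then wact u (wact w m) else wact w (wact u m).
Proof. by rewrite /wact; case: d; rewrite ?rev_cat foldl_cat. Qed.

Lemma act1 m : act 1 m = m.
Proof. by rewrite actU rmorph1 scale1r fm1 /wact; case: d. Qed.

Lemma act_var i m : act (ncvar i) m = adr m (x i).
Proof. by rewrite actU rmorph1 scale1r fmU /wact; case: d. Qed.

Lemma wact_sumr w (D : seq (fmonom 'I_n)) (c : fmonom 'I_n -> K) (F : fmonom 'I_n -> V) :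
  wact w (\sum_(i <- D) c i *: F i) = \sum_(i <- D) c i *: wact w (F i).
Proof.
have w0 : wact w 0 = 0.
  by apply: (addrI (wact w 0)); have := wact_lin w 1 0 0; rewrite !scale1r !addr0 => <-.
by elim: D => [|i D IH]; rewrite ?big_nil // !big_cons wact_lin IH.
Qed.

Lemma actM p q m : act (p * q) m = if d then act p (act q m) else act q (act p m).
Proof.
rewrite malgME act_suml; under eq_bigr do rewrite act_suml.
under eq_bigr do under eq_bigr do rewrite actU rmorphM fmM wact_cat.
rewrite /nc_act; case: d => /=; last rewrite exchange_big /=;
  apply: eq_bigr => u _; rewrite wact_sumr scaler_sumr; apply: eq_bigr => w _;
  by rewrite scalerA // mulrC.
Qed.

Definition lie_ev (e : lie_expr n) : {ffun X -> g} :=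
  lie_eval (fun q F => (ratr q : K) *: F) (if d then fun F G => cbr G F else cbr) x e.

Local Notation ev := lie_ev.

(** A commutator of two operators [ad_right] is the operator of the bracket,
    so a Lie expression acts through its value alone. *)
Lemma act_lie e m : act (ncpoly_of_lie e) m = adr m (ev e).
Proof.
elim: e m => [i||e1 IH1 e2 IH2|q e IH|e1 IH1 e2 IH2] m.
- exact: act_var.
- by rewrite act0l adr0r.
- by rewrite actDl IH1 IH2 adrDr.
- by rewrite actZl IH adrZr.
- have -> : ncpoly_of_lie (LieBr e1 e2) =
    ncpoly_of_lie e1 * ncpoly_of_lie e2 - ncpoly_of_lie e2 * ncpoly_of_lie e1 by [].
  have -> : ev (LieBr e1 e2) =
      if d then cbr (ev e2) (ev e1) else cbr (ev e1) (ev e2) by rewrite /lie_ev; case: (d).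
  move: (ncpoly_of_lie e1) (ncpoly_of_lie e2) IH1 IH2 => p1 p2 IH1 IH2.
  rewrite actBl.
  apply: etrans (congr2 (fun u w => u - w) (actM p1 p2 m) (actM p2 p1 m)) _.
  rewrite !IH1 !IH2.
  by have [dT|dF] := boolP d; rewrite (adr_jacobi hbr hX).
Qed.

Lemma act_exp k e m :
  act (ncpoly_of_lie e ^+ k) m = iter k (fun m => adr m (ev e)) m.
Proof.
elim: k m => [|k IH] m; first by rewrite expr0 act1.
rewrite /= -IH; have [dT|dF] := boolP d.
  by rewrite exprS actM dT act_lie.
by rewrite exprSr actM (negbTE dF) act_lie.
Qed.

(** The exponential of the inner derivation, truncated. *)
Definition exp_ad N (G : {ffun X -> g}) (m : V) : V :=
  \sum_(k < N.+1) k`!%:R^-1 *: iter k (fun m => adr m G) m.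

Local Notation expad := exp_ad.

(** Setting the formal variable to 1 loses nothing, because the degree in it
    can be recovered from the grading of the result ([act_graded]). *)
Lemma act_texp N k e m : act (texp N k (ncpoly_of_lie e)).[1] m = expad N (ev e) m.
Proof.
rewrite /texp horner_sum act_suml; apply: eq_bigr => i _.
rewrite hornerM_comm; last by rewrite /comm_poly mulr1 mul1r.
rewrite hornerXn expr1n mulr1 hornerC actZl act_exp.
by rewrite rmorphV /= ?unitfE ?pnatr_eq0 -?lt0n ?fact_gt0 // ratr_nat.
Qed.

Lemma horner1M (p q : {poly ncpoly n}) : (p * q).[1] = p.[1] * q.[1].
Proof. by apply: hornerM_comm; rewrite /comm_poly mulr1 mul1r. Qed.

Lemma act_prod (T : Type) (s : seq T) (F : T -> {poly ncpoly n}) m :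
  act (\prod_(i <- s) F i).[1] m =
  foldl (fun m i => act (F i).[1] m) m (if d then rev s else s).
Proof.
elim: s m => [|i s IH] m.
  by rewrite big_nil -[1]/(1%:P) hornerC act1; case: d.
rewrite big_cons horner1M actM; have [dT|dF] := boolP d.
  by move: IH; rewrite dT => ->; rewrite rev_cons -cats1 foldl_cat.
by move: IH; rewrite (negbTE dF) => ->.
Qed.

End Action.

(** * Gradings and truncation *)

Section Homogeneous.
Variable n : nat.
Implicit Types (p q : ncpoly n).

Lemma nc_homogeneous_sum (T : Type) (s : seq T) (P : pred T) (F : T -> ncpoly n) k :
  (forall i, P i -> nc_homogeneous k (F i)) -> nc_homogeneous k (\sum_(i <- s | P i) F i).
Proof.
move=> h w; elim/big_rec: _ => [|i p Pi IH]; first by rewrite mcoeff0 eqxx.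
have [p0|pN0] := eqVneq (mcoeff w p) 0; last by move=> _; apply: IH.
by rewrite mcoeffD p0 addr0; apply: h.
Qed.

Lemma nc_homogeneous0 k : nc_homogeneous k (0 : ncpoly n).
Proof. by move=> w; rewrite mcoeff0 eqxx. Qed.

Lemma nc_homogeneous1 : nc_homogeneous 0 (1 : ncpoly n).
Proof. by move=> w; rewrite mcoeff1; have [->|_] := eqVneq w (@mone _); rewrite ?fm1 ?eqxx. Qed.

Lemma nc_homogeneousZ c k p : nc_homogeneous k p -> nc_homogeneous k (c *: p).
Proof.
move=> h w; rewrite mcoeffZ => H; apply: h; apply: contraNneq H => ->.
by rewrite mulr0.
Qed.

Lemma nc_homogeneousM k l p q :
  nc_homogeneous k p -> nc_homogeneous l q -> nc_homogeneous (k + l)%N (p * q).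
Proof.
move=> hp hq w; rewrite mcoeff_neq0 => /msuppM_le [u [v [up vq ->]]].
by rewrite fmM size_cat (hp u) ?(hq v) // mcoeff_neq0.
Qed.

Lemma nc_homogeneousX k l p : nc_homogeneous k p -> nc_homogeneous (k * l)%N (p ^+ l).
Proof.
move=> hp; elim: l => [|l IH]; first by rewrite muln0 expr0; exact: nc_homogeneous1.
by rewrite exprS mulnS; apply: nc_homogeneousM.
Qed.

Lemma nc_homogeneous_var (i : 'I_n) : nc_homogeneous 1 (ncvar i).
Proof. by move=> w; rewrite mcoeffU; have [<-|_] := eqVneq (fmu i) w; rewrite ?fmU ?eqxx. Qed.

Definition graded (p : {poly ncpoly n}) := forall i, nc_homogeneous i p`_i.

Lemma gradedM (p q : {poly ncpoly n}) : graded p -> graded q -> graded (p * q).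
Proof.
move=> hp hq i; rewrite coefM; apply: nc_homogeneous_sum => j _.
have := nc_homogeneousM (hp j) (hq (i - j)%N).
by rewrite subnKC // -ltnS.
Qed.

Lemma graded1 : graded (1 : {poly ncpoly n}).
Proof.
move=> i; rewrite coef1; case: i => [|i] /=; first exact: nc_homogeneous1.
exact: nc_homogeneous0.
Qed.

Lemma graded_prod (T : eqType) (s : seq T) (F : T -> {poly ncpoly n}) :
  (forall i, i \in s -> graded (F i)) -> graded (\prod_(i <- s) F i).
Proof.
move=> h; rewrite big_seq; elim/big_rec: _ => [|i p si IH]; first exact: graded1.
exact: gradedM (h i si) IH.
Qed.

Lemma texp_coef N m p i : (texp N m p)`_i =
  \sum_(k < N.+1) (if i == (m * k)%N then k`!%:R^-1 *: p ^+ k else 0).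
Proof.
rewrite coef_sum; apply: eq_bigr => k _; rewrite coefCM coefXn.
by case: eqP => _; rewrite ?mulr1 ?mulr0.
Qed.

Lemma graded_texp N m p : nc_homogeneous m p -> graded (texp N m p).
Proof.
move=> hp i; rewrite texp_coef; apply: nc_homogeneous_sum => k _.
case: eqP => [->|_]; last exact: nc_homogeneous0.
exact/nc_homogeneousZ/nc_homogeneousX.
Qed.

Definition eq_upto N (p q : {poly ncpoly n}) := forall i, (i <= N)%N -> p`_i = q`_i.

Lemma eq_uptoM N (p p' q q' : {poly ncpoly n}) : eq_upto N p p' -> eq_upto N q q' -> eq_upto N (p * q) (p' * q').
Proof.
move=> hp hq i iN; rewrite !coefM; apply: eq_bigr => j _.
by rewrite hp ?hq //; have := ltn_ord j; lia.
Qed.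

Lemma eq_upto_prod N (T : eqType) (s : seq T) (F G : T -> {poly ncpoly n}) :
  (forall i, i \in s -> eq_upto N (F i) (G i)) ->
  eq_upto N (\prod_(i <- s) F i) (\prod_(i <- s) G i).
Proof.
elim: s => [|i s IH] h; first by rewrite !big_nil.
rewrite !big_cons; apply: eq_uptoM; first by apply: h; rewrite mem_head.
by apply: IH => j js; apply: h; rewrite inE js orbT.
Qed.

Lemma texp_upto N M m p : (0 < m)%N -> (N <= M)%N -> eq_upto N (texp N m p) (texp M m p).
Proof.
move=> m0 NM i iN; rewrite !texp_coef.
rewrite -!(big_mkord xpredT (fun k => if i == (m * k)%N then k`!%:R^-1 *: p ^+ k else 0)).
rewrite [RHS](@big_cat_nat _ _ _ N.+1) //= [X in _ + X]big_nat [X in _ + X]big1 ?addr0 //.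
by move=> k hk; case: eqP => // ik; nia.
Qed.

Lemma texp_upto1 N M m p : (N < m)%N -> eq_upto N (texp M m p) 1.
Proof.
move=> m0 i iN; rewrite texp_coef big_ord_recl muln0 expr0 fact0 invr1 scale1r coef1.
rewrite big1 ?addr0; first by case: eqP.
move=> k _; case: eqP => // ik; have : (m <= m * bump 0 k)%N by rewrite leq_pmulr.
by rewrite -ik leqNgt (leq_ltn_trans iN m0).
Qed.

Definition factor_seq (d : bool) N := if d then index_iota 1 N.+1 else rev (index_iota 1 N.+1).

(** The truncation order in the factorization depends on the coefficient
    considered.  Larger orders, and factors of larger index, do not change a
    coefficient, so one common order can be used. *)
Lemma factorization_upto d M (L : nat -> ncpoly n) :
  (forall N, (\prod_(i < n) texp N 1 (ncvar i))`_N =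
    (\prod_(m <- factor_seq d N) texp N m (L m))`_N) ->
  eq_upto M (\prod_(i < n) texp M 1 (ncvar i)) (\prod_(m <- factor_seq d M) texp M m (L m)).
Proof.
move=> H N NM.
have -> : (\prod_(i < n) texp M 1 (ncvar i))`_N = (\prod_(i < n) texp N 1 (ncvar i))`_N.
  by symmetry; apply: (eq_upto_prod (N := N)) => // i _; exact: texp_upto.
rewrite H; set P := \prod_(m <- factor_seq d N) texp M m (L m).
have E1 : eq_upto N (\prod_(m <- factor_seq d N) texp N m (L m)) P.
  apply: eq_upto_prod => m; rewrite /factor_seq.
  case: d {P H}; rewrite ?mem_rev mem_index_iota => hm; apply: texp_upto => //; lia.
pose Q := \prod_(m <- if d then index_iota N.+1 M.+1 else rev (index_iota N.+1 M.+1))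
    texp M m (L m).
have E2 : eq_upto N Q 1.
  suff : eq_upto N Q (\prod_(m <- if d then index_iota N.+1 M.+1
       else rev (index_iota N.+1 M.+1)) 1) by rewrite big1_eq.
  apply: eq_upto_prod => m; case: (d); rewrite ?mem_rev mem_index_iota => hm;
  apply: texp_upto1; lia.
have cat : index_iota 1 M.+1 = index_iota 1 N.+1 ++ index_iota N.+1 M.+1.
  rewrite /index_iota; have -> : (M.+1 - 1 = (N.+1 - 1) + (M.+1 - N.+1))%N by lia.
  by rewrite iotaD; congr (_ ++ iota _ _); lia.
rewrite E1 // /P /factor_seq cat; move: E2; rewrite /Q; case: (d) => E2.
  rewrite big_cat /=; set A := \prod_(i <- index_iota 1 _) _.
  have hA : eq_upto N A A by [].
  by have := eq_uptoM hA E2 (leqnn N); rewrite mulr1 => ->.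
rewrite rev_cat big_cat /=; set A := \prod_(i <- rev (index_iota 1 _)) _.
have hA : eq_upto N A A by [].
by have := eq_uptoM E2 hA (leqnn N); rewrite mul1r => ->.
Qed.

End Homogeneous.

Section GradedAction.
Variables (K : numFieldType) (g : lmodType K) (br : g -> g -> g).
Hypothesis hbr : lie_bracket br.
Variables (X : finType) (jn : X -> X -> option X) (deg : X -> nat).
Hypothesis hX : graded_index jn deg.
Variables (n : nat) (x : 'I_n -> {ffun X -> g}) (d : bool).
Hypothesis hx : forall i s, deg s != 1%N -> x i s = 0.

Local Notation V := (deg_ext g X).
Local Notation adr := (ad_right br jn deg).
Local Notation cbr := (conv_br br jn).
Local Notation act := (nc_act br jn deg x d).
Local Notation ev := (lie_ev br jn x d).
Local Notation expad := (exp_ad br jn deg).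

Definition concentrated N (F : {ffun X -> g}) := forall s, deg s != N -> F s = 0.

(** An element homogeneous of degree [N], where [delta] has degree 0. *)
Definition conc N (m : V) := (N != 0%N -> m.1 = 0) /\ concentrated N m.2.

Lemma conv_br_conc N k F G :
  concentrated N F -> concentrated k G -> concentrated (N + k)%N (cbr F G).
Proof.
move=> hF hG s hs; rewrite ffunE big1 // => a _; rewrite big1 // => b _.
have [/(jn_deg hX) E|_] := eqVneq (jn a b) (Some s); last by rewrite scale0r.
have [da|da] := eqVneq (deg a) N; last by rewrite hF // (lie0l hbr) scaler0.
rewrite (hG b) ?(lie0r hbr) ?scaler0 //.
by apply: contraNneq hs => db; rewrite E da db.
Qed.

Lemma adr_conc N k m G : conc N m -> concentrated k G -> conc (N + k)%N (adr m G).
Proof.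
move=> [m1 m2] hG; split=> // s hs.
have addE (u w : {ffun X -> g}) : (u + w) s = u s + w s by rewrite ffunE.
rewrite /= addE (conv_br_conc m2 hG) // !ffunE addr0.
have [N0|N0] := eqVneq N 0%N; last by rewrite m1 // scale0r.
by rewrite hG ?scaler0 //; move: hs; rewrite N0.
Qed.

Definition degree_elt : V := (1, 0).

Lemma conc_degree_elt : conc 0 degree_elt.
Proof. by split=> // s _; rewrite ffunE. Qed.

Lemma wact_conc w N m : conc N m -> conc (N + size w)%N (wact br jn deg x d w m).
Proof.
rewrite /wact; set s := (if d then _ else _).
have <- : size s = size w by rewrite /s; case: (d); rewrite ?size_rev.
elim: s N m => [|i s IH] N m hm; first by rewrite addn0.
by rewrite /= -addSnnS; apply: IH; rewrite -addn1; apply: adr_conc => //; exact: hx.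
Qed.

Lemma conc0 N : conc N 0.
Proof. by split=> // s _; rewrite ffunE. Qed.

Lemma concD N m m' : conc N m -> conc N m' -> conc N (m + m').
Proof.
move=> [h1 h2] [h1' h2']; split=> [N0|s hs] /=; first by rewrite h1 // h1' // addr0.
by rewrite ffunE h2 // h2' // addr0.
Qed.

Lemma concZ N a m : conc N m -> conc N (a *: m).
Proof.
move=> [h1 h2]; split=> [N0|s hs] /=; first by rewrite h1 // scaler0.
by rewrite ffunE h2 // scaler0.
Qed.

Lemma act_conc N k p m : nc_homogeneous k p -> conc N m -> conc (N + k)%N (act p m).
Proof.
move=> hp hm; rewrite /nc_act big_seq.
elim/big_rec: _ => [|w u wp IH]; first exact: conc0.
apply: concD IH; apply: concZ.
rewrite -(hp w) ?mcoeff_neq0 //; exact: wact_conc.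
Qed.

(** Evaluating at 1 adds up all the coefficients; at the index [s] only the
    one of degree [deg s] contributes. *)
Lemma act_graded p s : graded p -> (act p.[1] degree_elt).2 s = (act p`_(deg s) degree_elt).2 s.
Proof.
move=> hp; rewrite (@horner_coef_wide _ (maxn (size p) (deg s).+1)) ?leq_maxl //.
rewrite (act_suml _ _ _ _ _ _) /=.
have h2 (T : finType) (F : T -> V) : (\sum_i F i).2 s = \sum_i (F i).2 s.
  elim/big_rec2: _ => [|i u w _ IH]; first by rewrite ffunE.
  by rewrite -IH /= ffunE.
have hs : (deg s < maxn (size p) (deg s).+1)%N by rewrite leq_max leqnn orbT.
rewrite h2 (bigD1 (Ordinal hs)) //= expr1n mulr1 big1 ?addr0 // => i hi.
rewrite expr1n mulr1; have [_] := act_conc (hp i) conc_degree_elt; apply.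
by rewrite add0n; apply: contraNneq hi => E; apply/eqP/val_inj.
Qed.

Lemma act_graded1 p : graded p -> (act p.[1] degree_elt).1 = (act p`_0 degree_elt).1.
Proof.
move=> hp; rewrite (@horner_coef_wide _ (maxn (size p) 1)) ?leq_maxl //.
rewrite (act_suml _ _ _ _ _ _) /=.
have h2 (T : finType) (F : T -> V) : (\sum_i F i).1 = \sum_i (F i).1.
  by elim/big_rec2: _ => [|i u w _ IH] //; rewrite -IH.
have hs : (0 < maxn (size p) 1)%N by rewrite leq_max orbT.
rewrite h2 (bigD1 (Ordinal hs)) //= expr1n mulr1 big1 ?addr0 // => i hi.
rewrite expr1n mulr1; have [+ _] := act_conc (hp i) conc_degree_elt; apply.
by rewrite add0n; apply: contraNneq hi => E; apply/eqP/val_inj.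
Qed.

(** Apply both sides of the factorization to [delta].  Both products are
    graded and degrees in the index set stay below [M], so the truncated
    products agree at [delta]. *)
Lemma factorization_expad M (L : nat -> ncpoly n) (e : nat -> lie_expr n) :
  (forall s, deg s <= M)%N ->
  (forall m, (0 < m)%N -> L m = ncpoly_of_lie (e m)) ->
  (forall m, (0 < m)%N -> nc_homogeneous m (L m)) ->
  (forall N, (\prod_(i < n) texp N 1 (ncvar i))`_N =
    (\prod_(m <- factor_seq d N) texp N m (L m))`_N) ->
  foldl (fun m i => expad M (x i) m) degree_elt
     (if d then rev (index_enum 'I_n) else index_enum 'I_n) =
  foldl (fun m k => expad M (ev (e k)) m) degree_elt (rev (index_iota 1 M.+1)).
Proof.
move=> hM hL hom hf.
have mem_fs m : m \in factor_seq d M -> (0 < m)%N.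
  by rewrite /factor_seq; case: (d); rewrite ?mem_rev mem_index_iota => /andP[].
have foldE (T : eqType) (s : seq T) (F G : V -> T -> V) m :
    (forall u i, i \in s -> F u i = G u i) -> foldl F m s = foldl G m s.
  elim: s m => //= i s IH m FG; rewrite FG ?mem_head // IH // => u j js.
  by rewrite FG // inE js orbT.
have gL : graded (\prod_(i < n) texp M 1 (ncvar i)).
  apply: graded_prod => i _; apply: graded_texp; exact: nc_homogeneous_var.
have gR : graded (\prod_(m <- factor_seq d M) texp M m (L m)).
  by apply: graded_prod => i /mem_fs i0; apply: graded_texp; apply: hom.
have E : act (\prod_(i < n) texp M 1 (ncvar i)).[1] degree_elt =
    act (\prod_(m <- factor_seq d M) texp M m (L m)).[1] degree_elt.
  have U := factorization_upto (M := M) hf.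
  rewrite [LHS]surjective_pairing [RHS]surjective_pairing; congr pair.
    by rewrite !act_graded1 // U.
  by apply/ffunP => s; rewrite !act_graded // U.
move: E; rewrite !(act_prod hbr hX) => E.
transitivity (foldl (fun m i => act (texp M 1 (ncvar i)).[1] m) degree_elt
     (if d then rev (index_enum 'I_n) else index_enum 'I_n)).
  apply: foldE => u i _.
  by rewrite -[ncvar i]/(ncpoly_of_lie (LieVar i)) (act_texp hbr hX).
rewrite E; transitivity (foldl (fun m k => act (texp M k (L k)).[1] m) degree_elt
    (rev (index_iota 1 M.+1))).
  by rewrite /factor_seq; case: (d).
apply: foldE => u m; rewrite mem_rev mem_index_iota => /andP[m0 _].
by rewrite hL // (act_texp hbr hX).
Qed.

End GradedAction.

(** * Values of Lie polynomials *)

(** The additive semigroup of degrees, truncated above [D]. *)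
Definition ord_join D (a b : 'I_D.+1) : option 'I_D.+1 := insub (a + b)%N.

Lemma ord_joinE D (a b c : 'I_D.+1) : (ord_join a b == Some c) = ((a + b)%N == c).
Proof.
rewrite /ord_join; case: insubP => [u _ E|h].
  by rewrite -E (_ : (Some u == Some c) = (u == c)).
by apply/esym/negbTE; apply: contraNneq h => ->; exact: ltn_ord.
Qed.

Lemma ord_graded D : graded_index (@ord_join D) (fun a => val a).
Proof.
split=> [a b|a b c|a b c /eqP]; first by rewrite /ord_join addnC.
  have E (o : option 'I_D.+1) s : (obind (fun d => ord_join d c) o == Some s) =
      if o is Some d then (d + c)%N == s else false.
    by case: o => //= d; rewrite ord_joinE.
  have eqS (o o' : option 'I_D.+1) : (forall s, (o == Some s) = (o' == Some s)) -> o = o'.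
    case: o o' => [u|] [v|] h //; first by apply/esym/eqP; rewrite -h.
      by have := h u; rewrite eqxx.
    by have := h v; rewrite eqxx.
  apply: eqS => s; rewrite E.
  have -> : (obind (ord_join a) (ord_join b c) == Some s) =
      if ord_join b c is Some d then (a + d)%N == s else false.
    by case: (ord_join b c) => //= d; rewrite ord_joinE.
  rewrite /ord_join; case: insubP => [u _ Eu|hu]; case: insubP => [v _ Ev|hv].
  - by rewrite Eu Ev addnA.
  - apply/negbTE; apply: contraNneq hv => Es; have := ltn_ord s.
    by rewrite -Es Eu; lia.
  - apply/esym/negbTE; apply: contraNneq hu => Es; have := ltn_ord s.
    by rewrite -Es Ev; lia.
  - by [].
by rewrite ord_joinE => /eqP /esym.
Qed.

(** Disjoint union: the monomials in parameters of square zero. *)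
Definition set_join (T : finType) (A B : {set T}) : option {set T} :=
  if A :&: B == set0 then Some (A :|: B) else None.

Lemma set_graded (T : finType) : graded_index (@set_join T) (fun A => #|A|).
Proof.
split=> [A B|A B C|A B C]; rewrite /set_join.
- by rewrite setIC setUC.
- have [AB|AB] /= := boolP (A :&: B == set0); have [BC|BC] /= := boolP (B :&: C == set0).
  + by rewrite /set_join setIUl setIUr !setU_eq0 AB BC andbT setUA.
  + by rewrite /set_join setIUl setU_eq0 (negbTE BC) andbF.
  + by rewrite /set_join setIUr setU_eq0 (negbTE AB).
  + by [].
- by case: eqP => // AB [<-]; rewrite cardsU AB cards0 subn0.
Qed.

Section SingleSupport.
Variables (K : numFieldType) (g : lmodType K) (br : g -> g -> g).
Hypothesis hbr : lie_bracket br.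
Variables (X : finType) (jn : X -> X -> option X) (deg : X -> nat).
Hypothesis hX : graded_index jn deg.

Definition single (a : X) (y : g) : {ffun X -> g} := [ffun s => if s == a then y else 0].

Lemma conv_br_single a b y z : conv_br br jn (single a y) (single b z) =
  if jn a b is Some c then single c (br y z) else 0.
Proof.
apply/ffunP => s; rewrite ffunE (bigD1 a) //= [X in _ + X]big1 => [|a' aa']; last first.
  by rewrite big1 // => b' _; rewrite ffunE (negbTE aa') (lie0l hbr) scaler0.
rewrite addr0 (bigD1 b) //= [X in _ + X]big1 => [|b' bb']; last first.
  by rewrite !ffunE (negbTE bb') (lie0r hbr) scaler0.
rewrite addr0 !ffunE !eqxx; case: (jn a b) => [c|]; last by rewrite scale0r ffunE.
rewrite ffunE (_ : (Some c == Some s) = (s == c)); last by rewrite eq_sym.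
by case: eqP => _; rewrite ?scale1r ?scale0r.
Qed.

Variables (n : nat) (x : 'I_n -> g) (pt : 'I_n -> X) (d : bool).
Hypothesis hpt : forall i, deg (pt i) = 1%N.
Let xX i := single (pt i) (x i).

Definition nested (w : seq 'I_n) : g :=
  if w is i :: t then foldl (fun y j => br y (x j)) (x i) t else 0.

Definition join_word (w : seq 'I_n) : option X :=
  if w is i :: t then foldl (fun o j => obind (fun a => jn a (pt j)) o) (Some (pt i)) t
  else None.

(** On [delta], the first letter gives its own value, since it has degree 1;
    the following letters add a bracket each. *)
Lemma wact_degree_elt w : (wact br jn deg xX d w (degree_elt g X)).2 =
  let w' := if d then rev w else w in
  if join_word w' is Some c then single c (nested w') else 0.
Proof.
rewrite /wact /=; case: (if d then rev w else w) => [|i t] //=.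
have -> : ad_right br jn deg (degree_elt g X) (xX i) = (0, single (pt i) (x i)).
  rewrite /ad_right /= (lie0l (lie_conv hbr hX)) addr0 scale1r; congr pair.
  by apply/ffunP => s; rewrite !ffunE; case: eqP => [->|]; rewrite ?hpt ?scale1r ?scaler0.
suff H (o : option X) y : (foldl (fun m i => ad_right br jn deg m (xX i))
    (0 : K^o, if o is Some c then single c y else 0) t).2 =
   if foldl (fun o j => obind (fun a => jn a (pt j)) o) o t is Some c
   then single c (foldl (fun y j => br y (x j)) y t) else 0.
  exact: (H (Some (pt i))).
elim: t o y => [|j t IH] o y //=.
have -> : ad_right br jn deg (0 : K^o, if o is Some c then single c y else 0) (xX j) =
   (0 : K^o, if obind (fun a => jn a (pt j)) o is Some c then single c (br y (x j)) else 0).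
  rewrite /ad_right /= scale0r add0r; congr pair.
  by case: o => [a|] /=; [exact: conv_br_single|exact: (lie0l (lie_conv hbr hX))].
exact: IH.
Qed.

(** Apply [act_lie] to [delta], on which the bracket with an element is its
    degree derivative. *)
Lemma deg_ev (e : lie_expr n) s :
  (deg s)%:R *: lie_ev br jn xX d e s =
  (nc_act br jn deg xX d (ncpoly_of_lie e) (degree_elt g X)).2 s.
Proof.
rewrite (act_lie hbr hX) /ad_right /= (lie0l (lie_conv hbr hX)) addr0 scale1r.
by rewrite ffunE.
Qed.

End SingleSupport.

Lemma multilinear_part_words n (z : lie_expr n) (p : ncpoly n) :
  ncpoly_of_lie z = multilinear_part p ->
  nc_homogeneous n (ncpoly_of_lie z) /\
  forall w, mcoeff w (ncpoly_of_lie z) != 0 -> perm_eq (fmonom_val w) (enum 'I_n).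
Proof.
move=> hz.
have P w : mcoeff w (ncpoly_of_lie z) != 0 -> perm_eq (fmonom_val w) (enum 'I_n).
  rewrite hz /multilinear_part raddf_sum /=; apply: contraR => nw.
  rewrite big1 // => u hu; rewrite mcoeffU; case: eqP => // E.
  by move: nw; rewrite -E hu.
by split=> // w /P/perm_size; rewrite size_enum_ord.
Qed.

Section Link.
Variables (K : numFieldType) (g : lmodType K) (br0 : g -> g -> g).
Hypothesis hbr0 : lie_bracket br0.
Variables (n : nat) (d : bool).

Definition dir_br : g -> g -> g := if d then fun a b => br0 b a else br0.

Lemma lie_dir_br : lie_bracket dir_br.
Proof. by rewrite /dir_br; case: d => //; exact: lie_swap. Qed.

Section Ev.
Variables (X : finType) (jn : X -> X -> option X) (deg : X -> nat).
Hypothesis hX : graded_index jn deg.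
Variable xX : 'I_n -> {ffun X -> g}.
Hypothesis hx : forall i s, deg s != 1%N -> xX i s = 0.
Local Notation ev := (lie_ev dir_br jn xX d).

(** The exchange of the bracket in [dir_br] and the one in [lie_ev] cancel, so
    that [br0] is the bracket in the values for both directions. *)
Lemma ev_brE e1 e2 s : ev (LieBr e1 e2) s =
  \sum_a \sum_b (jn a b == Some s)%:R *: br0 (ev e1 a) (ev e2 b).
Proof.
rewrite /lie_ev /= /dir_br; case: (d); rewrite ffunE //.
rewrite exchange_big /=; apply: eq_bigr => a _; apply: eq_bigr => b _.
by rewrite (jnC hX).
Qed.

Lemma ev_deg0 e s : deg s = 0%N -> ev e s = 0.
Proof.
elim: e s => [i||e1 IH1 e2 IH2|q e IH|e1 IH1 e2 IH2] s ds.
- by apply: hx; rewrite ds.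
- by rewrite ffunE.
- by rewrite ffunE; have := IH1 s ds; have := IH2 s ds; rewrite /lie_ev => -> ->; rewrite addr0.
- by rewrite ffunE; have := IH s ds; rewrite /lie_ev => ->; rewrite scaler0.
- rewrite ev_brE big1 // => a _; rewrite big1 // => b _.
  have [/(jn_deg hX) E|_] := eqVneq (jn a b) (Some s); last by rewrite scale0r.
  by rewrite (IH1 a) ?(lie0l hbr0) ?scaler0 //; move: E; rewrite ds; lia.
Qed.

End Ev.

(** A bound for the degree of the Lie polynomial. *)
Fixpoint leaves (e : lie_expr n) : nat :=
  match e with
  | LieVar _ => 1 | LieZero => 0
  | LieAdd e1 e2 => maxn (leaves e1) (leaves e2)
  | LieScale _ e1 => leaves e1
  | LieBr e1 e2 => leaves e1 + leaves e2
  end.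

Section Nat.
Variables (D : nat) (hD : (0 < D)%N) (x : 'I_n -> g).
Let pt (i : 'I_n) : 'I_D.+1 := inord 1.
Let xX i := single (pt i) (x i).
Local Notation ev := (lie_ev dir_br (@ord_join D) xX d).

Let val_pt i : val (pt i) = 1%N.
Proof. by rewrite /= inordK. Qed.

Let hx i (s : 'I_D.+1) : val s != 1%N -> xX i s = 0.
Proof. by move=> hs; rewrite ffunE; have [E|//] := eqVneq s (pt i); rewrite E val_pt in hs. Qed.

Lemma ev_leaves e (s : 'I_D.+1) : (leaves e < s)%N -> ev e s = 0.
Proof.
elim: e s => [i||e1 IH1 e2 IH2|q e IH|e1 IH1 e2 IH2] s /= hs.
- by apply: hx; rewrite /= neq_ltn hs orbT.
- by rewrite ffunE.
- rewrite ffunE; have := IH1 s _; have := IH2 s _; rewrite /lie_ev => -> ; last by lia.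
  by move=> ->; rewrite ?addr0 //; lia.
- by rewrite ffunE; have := IH s hs; rewrite /lie_ev => ->; rewrite scaler0.
- rewrite (ev_brE (ord_graded D)) big1 // => a _; rewrite big1 // => b _.
  rewrite ord_joinE; case: eqP => E; last by rewrite scale0r.
  have [ha|ha] := ltnP (leaves e1) a; first by rewrite IH1 // (lie0l hbr0) scaler0.
  by rewrite IH2 ?(lie0r hbr0) ?scaler0 //; lia.
Qed.

(** Putting the parameters equal to 1 recovers the value in [g], provided that
    the truncation at [D] has lost nothing. *)
Lemma ev_sum e : (leaves e <= D)%N ->
  \sum_s ev e s = lie_eval (fun q v => (ratr q : K) *: v) br0 x e.
Proof.
elim: e => [i||e1 IH1 e2 IH2|q e IH|e1 IH1 e2 IH2] /= hD'.
- rewrite /lie_ev /= (bigD1 (pt i)) //= big1 ?addr0; first by rewrite ffunE eqxx.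
  by move=> s si; rewrite ffunE (negbTE si).
- by rewrite big1 // => s _; rewrite ffunE.
- rewrite -IH1; last by lia.
  rewrite -IH2; last by lia.
  by rewrite -big_split; apply: eq_bigr => s _; rewrite ffunE.
- by rewrite -IH // scaler_sumr; apply: eq_bigr => s _; rewrite ffunE.
- rewrite -IH1; last by lia.
  rewrite -IH2; last by lia.
  under eq_bigr do rewrite (ev_brE (ord_graded D)).
  rewrite exchange_big (lie_suml hbr0) /=; apply: eq_bigr => a _.
  rewrite exchange_big (lie_sumr hbr0) /=; apply: eq_bigr => b _.
  rewrite -scaler_suml.
  have [hab|hab] := leqP (a + b)%N D.
    rewrite (bigD1 (Ordinal (hab : (a + b < D.+1)%N))) //= ord_joinE eqxx big1 ?addr0 ?scale1r //.
    by move=> s hs; rewrite ord_joinE; rewrite -val_eqE /= eq_sym in hs; rewrite (negbTE hs).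
  have [ha|ha] := ltnP (leaves e1) a; first by rewrite ev_leaves // (lie0l hbr0) scaler0.
  by rewrite (@ev_leaves e2 b) ?(lie0r hbr0) ?scaler0 //; lia.
Qed.

Lemma join_word_nat w (s : 'I_D.+1) :
  (join_word (@ord_join D) pt w == Some s) = (w != [::]) && (size w == s).
Proof.
case: w => // i t /=.
suff H (o : option 'I_D.+1) k : (forall s, (o == Some s) = (k == val s)) ->
  forall s, (foldl (fun o j => obind (fun a => ord_join a (pt j)) o) o t == Some s) =
     ((k + size t)%N == val s).
  apply: (H _ 1%N) => s'; rewrite (_ : (Some _ == Some s') = (pt i == s')) //.
  by rewrite -val_eqE val_pt.
elim: t o k => [|j t IH] o k ho s' /=; first by rewrite addn0.
rewrite -addSnnS; apply: IH => u.
case: o ho => [a|] ho /=.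
  by rewrite ord_joinE val_pt addn1; have := ho a; rewrite eqxx => /esym/eqP ->.
apply/esym/negbTE; apply/negP => /eqP ku.
have hk : (k < D.+1)%N by have := ltn_ord u; rewrite -ku => /ltnW.
by have := ho (Ordinal hk); rewrite /= eqxx.
Qed.

End Nat.

Local Notation dirw w := (if d then rev w else w).

(** The Dynkin-Specht-Wever identity.  With every variable in degree 1,
    [deg_ev] expresses the degree times the value by words, and only words of
    length [k] occur. *)
Lemma lie_value_words k (x : 'I_n -> g) (z : lie_expr n) : (0 < k)%N ->
  nc_homogeneous k (ncpoly_of_lie z) ->
  k%:R *: lie_eval (fun q v => (ratr q : K) *: v) br0 x z =
  \sum_(w <- msupp (ncpoly_of_lie z))
    (ratr (mcoeff w (ncpoly_of_lie z)) : K) *: nested dir_br x (dirw (fmonom_val w)).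
Proof.
move=> k0 hom; set D := maxn (leaves z) k.
have D0 : (0 < D)%N by rewrite leq_max k0 orbT.
have kD : (k < D.+1)%N by rewrite ltnS leq_maxr.
rewrite -(ev_sum D0) ?leq_maxl //.
set pt := (fun i : 'I_n => inord 1 : 'I_D.+1).
have hpt i : val (pt i) = 1%N by rewrite /= inordK.
have E s := deg_ev lie_dir_br (ord_graded D) x pt d z s.
have hx i (s : 'I_D.+1) : val s != 1%N -> single (pt i) (x i) s = 0.
  by move=> hs; rewrite ffunE; have [Es|//] := eqVneq s (pt i); rewrite Es hpt in hs.
have val_w w s : mcoeff w (ncpoly_of_lie z) != 0 ->
    (wact dir_br (@ord_join D) (fun a => val a) (fun i => single (pt i) (x i)) d
       (fmonom_val w) (degree_elt g 'I_D.+1)).2 s =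
    if val s == k then nested dir_br x (dirw (fmonom_val w)) else 0.
  move=> /hom hw; rewrite (wact_degree_elt lie_dir_br (ord_graded D) x d hpt) /=.
  have szw : size (dirw (fmonom_val w)) = k by case: (d); rewrite ?size_rev.
  have := join_word_nat D0 (dirw (fmonom_val w)); rewrite szw -/pt.
  have -> : (dirw (fmonom_val w)) != [::] by rewrite -size_eq0 szw -lt0n.
  case: (join_word _ _ _) => [c|] J /=.
    have := J c; rewrite eqxx => /esym/eqP ck; rewrite ffunE -val_eqE /= -ck.
    by [].
  by have := J (Ordinal kD); rewrite /= eqxx.
have sumE (s : 'I_D.+1) : (val s)%:R *: lie_ev dir_br (@ord_join D) (fun i => single (pt i) (x i)) d z s =
   if val s == k then \sum_(w <- msupp (ncpoly_of_lie z))
    (ratr (mcoeff w (ncpoly_of_lie z)) : K) *: nested dir_br x (dirw (fmonom_val w)) else 0.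
  rewrite E /nc_act.
  have h2 (r : seq (fmonom 'I_n)) (F : fmonom 'I_n -> deg_ext g 'I_D.+1) :
     (\sum_(w <- r) F w).2 s = \sum_(w <- r) (F w).2 s.
    elim/big_rec2: _ => [|i u w _ IH]; first by rewrite ffunE.
    by rewrite -IH /= ffunE.
  rewrite h2; case: ifP => hs.
    rewrite big_seq [RHS]big_seq; apply: eq_bigr => w; rewrite -mcoeff_neq0 => wp.
    by rewrite /= ffunE val_w // hs.
  rewrite big_seq big1 // => w; rewrite -mcoeff_neq0 => wp.
  by rewrite /= ffunE val_w // hs scaler0.
rewrite (bigD1 (Ordinal kD)) //= big1 ?addr0.
  by have := sumE (Ordinal kD); rewrite /= eqxx.
move=> s sk; have [s0|s0] := eqVneq (val s) 0%N.
  exact: (ev_deg0 (ord_graded D) hx).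
have := sumE s; rewrite -[val s == k]/(val s == val (Ordinal kD)) val_eqE (negbTE sk).
by move/eqP; rewrite scaler_eq0 pnatr_eq0 (negbTE s0) /= => /eqP.
Qed.

Section Sets.
Variable x : 'I_n -> g.
Let pt (i : 'I_n) : {set 'I_n} := [set i].

Lemma join_word_set w S : (join_word (@set_join 'I_n) pt w == Some S) =
  [&& w != [::], uniq w & [set i in w] == S].
Proof.
have [->//|w0] := eqVneq w [::]; rewrite /=.
elim/last_ind: w S w0 => // w j IH S _.
have [->|w0] := eqVneq w [::].
  rewrite /= (_ : (Some _ == Some S) = (pt j == S)) //; congr (_ == _).
  by apply/setP => i; rewrite !inE.
have -> : join_word (@set_join 'I_n) pt (rcons w j) =
    obind (fun A => set_join A (pt j)) (join_word (@set_join 'I_n) pt w).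
  by case: w w0 {IH} => //= i t _; rewrite -cats1 foldl_cat.
rewrite rcons_uniq.
case E : (join_word _ _ w) => [A|] /=.
  have := IH A w0; rewrite E eqxx => /esym/andP[uw /eqP wA].
  rewrite /set_join -wA; have -> : ([set i in w] :&: pt j == set0) = (j \notin w).
    apply/eqP/idP => [/setP/(_ j)|jw]; first by rewrite !inE eqxx andbT => ->.
    apply/setP => i; rewrite !inE; case: eqP => [->|]; rewrite ?andbF //.
    by rewrite (negbTE jw).
  case: ifP => jw; rewrite uw ?andbF //= ?andbT.
  transitivity ([set i in w] :|: pt j == S); first by [].
  by congr (_ == _); apply/setP => i; rewrite !inE mem_rcons inE orbC.
have := IH [set i in w] w0; rewrite E eqxx andbT => /esym/negbT/negbTE ->.
by rewrite andbF.
Qed.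

(** Both sides, multiplied by [n], are the same combination of nested
    brackets.  On the left by [lie_value_words]; on the right by [deg_ev],
    since with parameters of square zero only the words that are permutations
    of the variables reach the full set. *)
Lemma lie_value_ev (z e : lie_expr n) : (0 < n)%N ->
  ncpoly_of_lie z = multilinear_part (ncpoly_of_lie e) ->
  lie_eval (fun q v => (ratr q : K) *: v) br0 x z =
  lie_ev dir_br (@set_join 'I_n) (fun i => single [set i] (x i)) d e [set: 'I_n].
Proof.
move=> n0 hz; apply: (scalerI (a := n%:R)); first by rewrite pnatr_eq0 -lt0n.
have [hom hperm] := multilinear_part_words hz.
rewrite (lie_value_words x n0 hom).
have hpt i : #|pt i| = 1%N by rewrite cards1.
have := deg_ev lie_dir_br (set_graded 'I_n) x pt d e [set: 'I_n].
rewrite cardsT card_ord => ->.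
have h2 (r : seq (fmonom 'I_n)) P (F : fmonom 'I_n -> deg_ext g {set 'I_n}) s :
     (\sum_(w <- r | P w) F w).2 s = \sum_(w <- r | P w) (F w).2 s.
  elim/big_rec2: _ => [|i u w _ IH]; first by rewrite ffunE.
  by rewrite -IH /= ffunE.
have val_w w : (wact dir_br (@set_join 'I_n) (fun A => #|A|) (fun i => single (pt i) (x i)) d
       (fmonom_val w) (degree_elt g {set 'I_n})).2 [set: 'I_n] =
    if perm_eq (fmonom_val w) (enum 'I_n) then nested dir_br x (dirw (fmonom_val w)) else 0.
  rewrite (wact_degree_elt lie_dir_br (set_graded 'I_n) x d hpt) /=.
  have J := join_word_set (dirw (fmonom_val w)).
  have permE : perm_eq (fmonom_val w) (enum 'I_n) =
     (join_word (@set_join 'I_n) pt (dirw (fmonom_val w)) == Some [set: 'I_n]).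
    rewrite J.
    have -> : uniq (dirw (fmonom_val w)) = uniq w by case: (d); rewrite ?rev_uniq.
    have -> : [set i in dirw (fmonom_val w)] = [set i in fmonom_val w].
      by apply/setP => i; rewrite !inE; case: (d); rewrite ?mem_rev.
    have -> : (dirw (fmonom_val w) != [::]) = (fmonom_val w != [::]).
      by rewrite -!size_eq0; case: (d); rewrite ?size_rev.
    apply/idP/and3P => [pw|[w0 uw /eqP/setP wT]].
      split; first by rewrite -size_eq0 (perm_size pw) size_enum_ord -lt0n.
        by rewrite (perm_uniq pw) enum_uniq.
      by apply/eqP/setP => i; rewrite !inE (perm_mem pw) mem_enum.
    apply: uniq_perm => //; first exact: enum_uniq.
    by move=> i; have := wT i; rewrite !inE mem_enum.
  rewrite permE; case: (join_word _ _ _) J => [c|] J /=; last by rewrite ffunE.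
  rewrite (_ : (Some c == Some _) = (c == setT)) // ffunE eq_sym.
  by case: eqP.
transitivity ((nc_act dir_br (@set_join 'I_n) (fun A => #|A|) (fun i => single (pt i) (x i)) d
   (ncpoly_of_lie z) (degree_elt g {set 'I_n})).2 [set: 'I_n]).
  rewrite /nc_act h2 big_seq [RHS]big_seq; apply: eq_bigr => w; rewrite -mcoeff_neq0 => wp.
  by rewrite /= ffunE val_w hperm.
rewrite hz /multilinear_part (act_suml _ _ _ _ _) h2 {2}/nc_act h2.
rewrite big_mkcond; apply: eq_bigr => w _.
by case: ifP => hw; rewrite ?actU /= ffunE val_w hw // scaler0.
Qed.

End Sets.
End Link.

(** * The majorant recursion *)

Section ExpInverse.
Variables (K : numFieldType) (M : lmodType K) (a : M -> M).
Hypothesis a_lin : forall c u w, a (c *: u + w) = c *: a u + a w.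

Lemma iter_lin i c u w : iter i a (c *: u + w) = c *: iter i a u + iter i a w.
Proof. by elim: i => //= i ->; rewrite a_lin. Qed.

Lemma iter_sum i (J : Type) (r : seq J) (c : J -> K) (F : J -> M) :
  iter i a (\sum_(j <- r) c j *: F j) = \sum_(j <- r) c j *: iter i a (F j).
Proof.
have i0 : iter i a 0 = 0.
  by apply: (addrI (iter i a 0)); have := iter_lin i 1 0 0; rewrite !scale1r !addr0 => <-.
by elim: r => [|j r IH]; rewrite ?big_nil // !big_cons iter_lin IH.
Qed.

(** If [a] is nilpotent on [F], truncated polynomials in [a] multiply as
    polynomials do, and [exp(-X) exp(X) = 1] is the binomial formula for [(1 -
    1)^k]. *)
Lemma exp_opp_exp N F : (forall k, (N < k)%N -> iter k a F = 0) ->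
  \sum_(i < N.+1) ((-1) ^+ i / i`!%:R) *: iter i a (\sum_(j < N.+1) j`!%:R^-1 *: iter j a F) = F.
Proof.
move=> nil.
(* Polynomials in [a] applied to [F]. *)
pose Phi (p : {poly K}) := \sum_(k < N.+1) p`_k *: iter k a F.
have PhiD p q : Phi (p + q) = Phi p + Phi q.
  by rewrite /Phi -big_split; apply: eq_bigr => k _; rewrite coefD scalerDl.
have Phi0 : Phi 0 = 0 by rewrite /Phi big1 // => k _; rewrite coef0 scale0r.
have PhiZ c p : Phi (c *: p) = c *: Phi p.
  by rewrite /Phi scaler_sumr; apply: eq_bigr => k _; rewrite coefZ scalerA.
have PhiX i : Phi 'X^i = iter i a F.
  have [hi|hi] := ltnP i N.+1; last first.
    rewrite nil // /Phi big1 // => k _; rewrite coefXn; case: eqP => E; last by rewrite scale0r.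
    by have := ltn_ord k; lia.
  rewrite /Phi (bigD1 (Ordinal hi)) //= coefXn eqxx scale1r big1 ?addr0 // => k ki.
  rewrite coefXn; case: eqP => E; last by rewrite scale0r.
  by move/eqP: ki; case; apply: val_inj.
have PhiS (J : Type) (r : seq J) (G : J -> {poly K}) :
    Phi (\sum_(j <- r) G j) = \sum_(j <- r) Phi (G j) by exact: (big_morph Phi).
pose P : {poly K} := \sum_(i < N.+1) ((-1) ^+ i / i`!%:R) *: 'X^i.
pose Q : {poly K} := \sum_(i < N.+1) i`!%:R^-1 *: 'X^i.
transitivity (Phi (P * Q)).
  rewrite /P mulr_suml PhiS; apply: eq_bigr => i _.
  rewrite -scalerAl PhiZ; congr (_ *: _).
  rewrite iter_sum /Q mulr_sumr PhiS; apply: eq_bigr => j _.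
  by rewrite -scalerAr PhiZ -exprD PhiX iterD.
have cP i : (i <= N)%N -> P`_i = (-1) ^+ i / i`!%:R.
  move=> hi; rewrite /P coef_sum (bigD1 (Ordinal (hi : (i < N.+1)%N))) //= coefZ coefXn eqxx mulr1.
  rewrite big1 ?addr0 // => j ji; rewrite coefZ coefXn; case: eqP => E; last by rewrite mulr0.
  by move/eqP: ji; case; apply: val_inj.
have cQ i : (i <= N)%N -> Q`_i = i`!%:R^-1.
  move=> hi; rewrite /Q coef_sum (bigD1 (Ordinal (hi : (i < N.+1)%N))) //= coefZ coefXn eqxx mulr1.
  rewrite big1 ?addr0 // => j ji; rewrite coefZ coefXn; case: eqP => E; last by rewrite mulr0.
  by move/eqP: ji; case; apply: val_inj.
have cPQ k : (k <= N)%N -> (P * Q)`_k = (k == 0%N)%:R.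
  move=> hk; rewrite coefM.
  have f0 m : m`!%:R != 0 :> K by rewrite pnatr_eq0 -lt0n fact_gt0.
  transitivity (k`!%:R^-1 * (1 - 1) ^+ k : K); last first.
    by rewrite subrr expr0n; case: k {hk} => [|k] /=; rewrite ?mulr0 // fact0 invr1 mulr1.
  rewrite exprDn mulr_sumr; apply: eq_bigr => i _.
  have hi : (i <= k)%N by rewrite -ltnS.
  rewrite cP ?cQ; [|by lia|by lia].
  rewrite expr1n mul1r -[_ *+ _]mulr_natl -(bin_fact hi) !natrM !invfM.
  have c0 : 'C(k, i)%:R != 0 :> K by rewrite pnatr_eq0 -lt0n bin_gt0.
  move: (f0 i) (f0 (k - i)%N) c0; set u := i`!%:R; set w := (k - i)`!%:R; set c := 'C(_, _)%:R.
  by move=> u0 w0 c0; field; rewrite u0 w0 c0.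
rewrite /Phi big_ord_recl cPQ // scale1r big1 ?addr0 // => i _.
by rewrite cPQ ?scale0r // ltn_ord.
Qed.

End ExpInverse.

Section MajorantRecursion.
Variables (R : realFieldType) (K : numFieldType) (g : lmodType K).
Variables (br : g -> g -> g) (nrm : g -> R).
Hypothesis hbr : lie_bracket br.
Hypothesis nrm_ge0 : forall u, 0 <= nrm u.
Hypothesis nrm0 : nrm 0 = 0.
Hypothesis nrmD : forall u w, nrm (u + w) <= nrm u + nrm w.
Hypothesis nrmZ : forall (c : rat) u, nrm ((ratr c : K) *: u) = `|ratr c| * nrm u.
Hypothesis nrm_br : forall u w, nrm (br u w) <= nrm u * nrm w.
Variables (n : nat) (x : 'I_n -> g).

Local Notation SI := {set 'I_n}.
Local Notation M := {ffun SI -> g}.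
Local Notation cbr := (conv_br br (@set_join 'I_n)).
Let hX := set_graded 'I_n.
Let hcbr : lie_bracket cbr := lie_conv hbr hX.

Lemma nrm_sum (J : Type) (r : seq J) (P : pred J) (F : J -> g) :
  nrm (\sum_(j <- r | P j) F j) <= \sum_(j <- r | P j) nrm (F j).
Proof.
elim/big_rec2: _ => [|j u w _ IH]; first by rewrite nrm0.
by apply: le_trans (nrmD _ _) _; rewrite lerD2l.
Qed.

Lemma nrmN u : nrm (- u) = nrm u.
Proof. by have := nrmZ (-1) u; rewrite rmorphN1 scaleN1r => ->; rewrite rmorphN1 normrN1 mul1r. Qed.

Lemma nrm_nat (k : nat) u : nrm (k%:R *: u) = k%:R * nrm u.
Proof. by have := nrmZ k%:R u; rewrite !ratr_nat normr_nat. Qed.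

Lemma nrm_natV (k : nat) u : nrm (k%:R^-1 *: u) = k%:R^-1 * nrm u.
Proof.
have [->|k0] := eqVneq k 0%N; first by rewrite !mulr0n !invr0 scale0r mul0r nrm0.
have := nrmZ k%:R^-1 u; rewrite !fmorphV /= !ratr_nat => ->.
by rewrite ger0_norm // invr_ge0 ler0n.
Qed.

Definition wt (S : SI) : R := \prod_(i in S) nrm (x i).

Lemma wt_ge0 S : 0 <= wt S. Proof. by apply: prodr_ge0. Qed.

(** The function [F] is majorized by the polynomial [p] evaluated at the sum
    of the [norm x_i] times their parameters: since the parameters have square
    zero, the [k]-th power of this sum is [k!] times its elementary symmetric
    function. *)
Definition maj (F : M) (p : {poly R}) :=
  forall S, nrm (F S) <= (#|S|)`!%:R * p`_#|S| * wt S.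

(** In the algebra of parameters of square zero a product runs over the ways
    to split a set. *)
Lemma conv_br_sub (F G : M) (S : SI) : cbr F G S = \sum_(A : SI | A \subset S) br (F A) (G (S :\: A)).
Proof.
rewrite ffunE [RHS]big_mkcond /=; apply: eq_bigr => A _.
rewrite /set_join; case: ifPn => [AS|AS].
  rewrite (bigD1 (S :\: A)) //= big1 ?addr0 => [|B BS].
    have -> : A :&: (S :\: A) = set0 by apply/setP => i; rewrite !inE; case: (i \in A).
    have -> : A :|: (S :\: A) = S by rewrite -{1}(setIidPr AS) setID.
    by rewrite !eqxx scale1r.
  case: ifPn => // [/eqP AB|_]; last by rewrite scale0r.
  case: eqP => [[E]|_]; last by rewrite scale0r.
  case/eqP: BS; rewrite -E setDUl setDv set0U; apply/esym/setDidPl.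
  by rewrite -setI_eq0 setIC AB.
rewrite big1 // => B _; case: ifP => _; last by rewrite scale0r.
case: eqP => [[E]|_]; last by rewrite scale0r.
by case/negP: AS; rewrite -E subsetUl.
Qed.

Lemma sum_subsets_card (S : SI) (c : nat -> R) :
  \sum_(A : SI | A \subset S) c #|A| = \sum_(i < #|S|.+1) 'C(#|S|, i)%:R * c i.
Proof.
rewrite (partition_big (fun A : SI => inord #|A| : 'I_#|S|.+1) xpredT) //=.
apply: eq_bigr => i _; rewrite -cards_draws -sum1_card natr_sum mulr_suml.
apply: eq_big => [A|A /andP[AS /eqP <-]].
  rewrite inE; case AS : (A \subset S) => //=.
  by rewrite -val_eqE /= inordK // ltnS subset_leq_card.
by rewrite mul1r inordK // ltnS subset_leq_card.
Qed.

(** A set of size [m] has [binomial m i] subsets of size [i], which is what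
    the factorials in [maj] are normalized for. *)
Lemma maj_conv F G p q : maj F p -> maj G q -> maj (cbr F G) (p * q).
Proof.
move=> hF hG S; rewrite conv_br_sub; apply: le_trans (nrm_sum _ _ _) _.
pose c i := (i`!%:R * p`_i) * ((#|S| - i)`!%:R * q`_(#|S| - i)) : R.
apply: (@le_trans _ _ (\sum_(A : SI | A \subset S) c #|A| * wt S)).
  apply: ler_sum => A AS; apply: le_trans (nrm_br _ _) _.
  have -> : wt S = wt A * wt (S :\: A).
    by rewrite /wt [LHS](big_setID A) /=; congr (_ * _); apply: eq_bigl => i; rewrite (setIidPr AS).
  have cSA : #|S :\: A| = (#|S| - #|A|)%N by rewrite cardsD (setIidPr AS).
  apply: le_trans (ler_pM (nrm_ge0 _) (nrm_ge0 _) (hF A) (hG (S :\: A))) _.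
  by rewrite cSA /c; set a := (_ * _)%R; set b := (#|S| - #|A|)`!%:R * _; rewrite mulrACA.
rewrite -mulr_suml ler_wpM2r ?wt_ge0 // sum_subsets_card coefM mulr_sumr.
apply: ler_sum => i _; have hi : (i <= #|S|)%N by rewrite -ltnS.
by rewrite /c -(bin_fact hi) !natrM le_eqVlt; apply/orP; left; apply/eqP; ring.
Qed.

Lemma majD F G p q : maj F p -> maj G q -> maj (F + G) (p + q).
Proof.
move=> hF hG S; rewrite ffunE coefD mulrDr mulrDl.
by apply: le_trans (nrmD _ _) _; apply: lerD.
Qed.

Lemma majN F p : maj F p -> maj (- F) p.
Proof. by move=> hF S; rewrite ffunE nrmN. Qed.

Lemma maj_natV (k : nat) F p : maj F p -> maj (k%:R^-1 *: F) (k%:R^-1 *: p).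
Proof.
move=> hF S; rewrite ffunE nrm_natV coefZ mulrCA -!mulrA ler_wpM2l ?invr_ge0 ?ler0n //.
by rewrite mulrA.
Qed.

Lemma maj0 : maj 0 0.
Proof. by move=> S; rewrite ffunE nrm0 coef0 mulr0 mul0r. Qed.

(** The action of [exp_ad] on the elements free of [delta]. *)
Definition exp_br N (G F : M) : M :=
  \sum_(k < N.+1) k`!%:R^-1 *: iter k (fun F => cbr F G) F.

Lemma maj_exp_br N G F p q : maj F p -> maj G q ->
  maj (exp_br N G F) (p * \sum_(k < N.+1) k`!%:R^-1 *: q ^+ k).
Proof.
move=> hF hG; rewrite mulr_sumr.
have it k : maj (iter k (fun F => cbr F G) F) (p * q ^+ k).
  elim: k => [|k IH]; first by rewrite expr0 mulr1.
  by rewrite /= exprSr mulrA; apply: maj_conv.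
rewrite /exp_br; elim/big_rec2: _ => [|k p' F' _ IH]; first exact: maj0.
by rewrite -scalerAr; apply: majD IH; apply: maj_natV.
Qed.

Definition supp_ge (a : nat) (F : M) := forall S : SI, (#|S| < a)%N -> F S = 0.

Lemma supp_conv a k F G : supp_ge a F -> concentrated (fun A : SI => #|A|) k G ->
  supp_ge (a + k)%N (cbr F G).
Proof.
move=> hF hG S hS; rewrite conv_br_sub big1 // => A AS.
have [ha|ha] := ltnP #|A| a; first by rewrite hF // (lie0l hbr).
rewrite hG ?(lie0r hbr) // cardsD (setIidPr AS).
by have := subset_leq_card AS; lia.
Qed.

Lemma supp_iter a k j F G : supp_ge a F -> concentrated (fun A : SI => #|A|) k G ->
  supp_ge (a + j * k)%N (iter j (fun F => cbr F G) F).
Proof.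
move=> hF hG; elim: j => [|j IH]; first by rewrite addn0.
by rewrite /= mulSn (addnC k) addnA; apply: supp_conv.
Qed.

Lemma supp_iter0 k j F G : (0 < k)%N -> concentrated (fun A : SI => #|A|) k G ->
  (n < j)%N -> iter j (fun F => cbr F G) F = 0.
Proof.
move=> k0 hG nj; apply/ffunP => S; rewrite [RHS]ffunE.
apply: (@supp_iter 0 k j F G) => //.
have : (#|S| <= n)%N by rewrite -[X in (_ <= X)%N](card_ord n) max_card.
by rewrite add0n; nia.
Qed.

Lemma supp_exp_br a k N F G : supp_ge a F -> concentrated (fun A : SI => #|A|) k G ->
  supp_ge a (exp_br N G F).
Proof.
move=> hF hG S hS; rewrite /exp_br sum_ffunE big1 // => j _.
by rewrite ffunE (supp_iter (j := j) hF hG) ?scaler0 //; lia.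
Qed.

Lemma exp_br_inv k F G : (0 < k)%N -> concentrated (fun A : SI => #|A|) k G ->
  exp_br n (- G) (exp_br n G F) = F.
Proof.
move=> k0 hG.
have lin c u w : cbr (c *: u + w) G = c *: cbr u G + cbr w G by exact: lie_linearl.
rewrite -[RHS](@exp_opp_exp _ _ (fun F => cbr F G) lin n F); last first.
  by move=> j hj; apply: supp_iter0 hG hj.
rewrite {1}/exp_br; apply: eq_bigr => i _.
rewrite mulrC -scalerA; congr (_ *: _).
rewrite -/(exp_br n G F); move: (exp_br n G F) => H.
elim: (nat_of_ord i) => [|j IH]; first by rewrite expr0 scale1r.
by rewrite /= IH (lieNr hcbr) (lieZl hcbr) exprS mulN1r scaleNr.
Qed.

Local Notation V := (deg_ext g SI).
Local Notation expad := (exp_ad br (@set_join 'I_n) (fun A : SI => #|A|)).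

(** The first bracket of [delta] with [G] is [k G]; further brackets with [G]
    annihilate it. *)
Lemma expad_degree_elt N k G F : (0 < N)%N -> concentrated (fun A : SI => #|A|) k G ->
  expad N G (1 : K^o, F) = (1 : K^o, k%:R *: G + exp_br N G F).
Proof.
move=> N0 hG.
have DG : deg_der (fun A : SI => #|A|) G = k%:R *: G.
  apply/ffunP => S; rewrite !ffunE.
  by have [->//|h] := eqVneq #|S| k; rewrite hG // !scaler0.
have it j : iter j.+1 (fun m : V => ad_right br (@set_join 'I_n) (fun A : SI => #|A|) m G) (1 : K^o, F)
   = (0 : K^o, (if j == 0%N then k%:R *: G else 0) + iter j.+1 (fun F => cbr F G) F).
  elim: j => [|j IH]; first by rewrite /ad_right /= scale1r DG.
  rewrite iterS IH /ad_right /= scale0r add0r add0r; congr pair.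
  rewrite (lieDl hcbr); case: ifP => _; rewrite ?(lie0l hcbr) ?add0r //.
  by rewrite (lieZl hcbr) (lie_alt hcbr) scaler0 add0r.
rewrite /exp_ad big_ord_recl fact0 invr1 scale1r /exp_br big_ord_recl fact0 invr1 scale1r.
case: N N0 => // N _; rewrite big_ord_recl [in RHS]big_ord_recl /=.
have e1 : (bump 0 0)`! = 1%N by [].
have := it 0%N; rewrite /= => ->; rewrite e1 invr1 !scale1r.
have -> : \sum_(i < N) (bump 0 (bump 0 i))`!%:R^-1 *:
    ad_right br (@set_join 'I_n) (fun A : SI => #|A|)
      (iter (bump 0 i) (fun m : V => ad_right br (@set_join 'I_n) (fun A : SI => #|A|) m G) (1 : K^o, F)) G
  = (0 : K^o, \sum_(i < N) (bump 0 (bump 0 i))`!%:R^-1 *: iter (bump 0 (bump 0 i)) (fun F => cbr F G) F) :> V.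
  elim/big_rec2: _ => [//|i u w _ ->].
  have := it i.+1; rewrite /= add0r /bump /= !add1n => -> /=.
  by congr pair; rewrite /= ?scaler0 ?add0r.
by congr pair; rewrite /= ?addr0 // addrA addrCA !addrA.
Qed.

Lemma conv_single_r F i y (S : SI) :
  cbr F (single [set i] y) S = if i \in S then br (F (S :\ i)) y else 0.
Proof.
rewrite conv_br_sub; case: ifP => iS.
  rewrite (bigD1 (S :\ i)) ?subD1set //= big1 ?addr0 => [|A /andP[AS hA]].
    rewrite setDDr setDv set0U (setIidPr _) ?sub1set // ffunE eqxx //.
  rewrite ffunE; case: eqP => [E|_]; last by rewrite (lie0r hbr).
  by case/eqP: hA; rewrite -E setDDr setDv set0U; apply/esym/setIidPr.
rewrite big1 // => A AS; rewrite ffunE; case: eqP => [/setP/(_ i)|_]; last by rewrite (lie0r hbr).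
by rewrite !inE iS andbF eqxx.
Qed.

Local Notation xX := (fun i => single [set i] (x i) : M).
Local Notation step G m := (expad n G m).

Lemma conc_xX i : concentrated (fun A : SI => #|A|) 1 (xX i).
Proof. by move=> S hS; rewrite ffunE; have [E|//] := eqVneq S [set i]; rewrite E cards1 in hS. Qed.

Hypothesis n0 : (0 < n)%N.

Lemma wt1 i : wt [set i] = nrm (x i).
Proof. by rewrite /wt big_set1. Qed.

Lemma wtD1 i (S : SI) : i \in S -> wt S = wt (S :\ i) * nrm (x i).
Proof. by move=> iS; rewrite /wt (big_setD1 i) //= mulrC. Qed.

(** A parameter of square zero can be used only once. *)
Lemma exp_br_xX N i F (S : SI) : (0 < N)%N ->
  exp_br N (xX i) F S = F S + (if i \in S then br (F (S :\ i)) (x i) else 0).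
Proof.
move=> N0; rewrite /exp_br sum_ffunE.
have E k : iter k.+2 (fun F => cbr F (xX i)) F = 0.
  rewrite -addn2 iterD; have -> : iter 2 (fun F => cbr F (xX i)) F = 0.
    apply/ffunP => T; rewrite [RHS]ffunE /= conv_single_r; case: ifP => // iT.
    by rewrite conv_single_r !inE eqxx /= (lie0l hbr).
  by elim: k => //= k ->; rewrite (lie0l hcbr).
case: N N0 => // N _; rewrite 2!big_ord_recl big1 ?addr0.
  have sE c (u : M) : (c *: u) S = c *: u S by rewrite ffunE.
  by rewrite !sE fact0 !invr1 !scale1r /= conv_single_r.
move=> k _; rewrite ffunE (_ : iter _ _ F = 0); first by rewrite ffunE scaler0.
exact: (E k).
Qed.

(** The coefficient of [S] is one nested bracket of the variables of [S],
    taken in the order of [us]. *)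
Lemma ordered_exp_bound (us : seq 'I_n) : uniq us ->
  let W := foldl (fun m i => step (xX i) m) (degree_elt g SI) us in
  W.1 = 1 /\ forall S : SI, (~~ (S \subset us) || (S == set0) -> W.2 S = 0) /\ nrm (W.2 S) <= wt S.
Proof.
elim/last_ind: us => [_|us i IH].
  by split=> // S; rewrite ffunE; split=> //; rewrite nrm0 wt_ge0.
rewrite rcons_uniq foldl_rcons => /andP[ius /IH] /=.
case: (foldl _ _ us) => w F /= [-> hF]; rewrite (expad_degree_elt _ n0 (@conc_xX i)) /=; split=> // S.
rewrite ffunE exp_br_xX // scale1r ffunE.
have [iS|iS] := boolP (i \in S); last first.
  have -> : (S == [set i]) = false by apply/eqP => E; rewrite E inE eqxx in iS.
  rewrite add0r addr0; split; last by case: (hF S).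
  move=> hS; apply: (hF S).1; case/orP: hS => [|->]; rewrite ?orbT // => hS.
  apply/orP; left; apply: contra hS => /subsetP hS; apply/subsetP => j jS.
  by rewrite mem_rcons inE hS ?orbT.
have FS : F S = 0.
  by apply: (hF S).1; apply/orP; left; apply/subsetPn; exists i.
rewrite FS add0r; split.
  case/orP => [hS|/eqP S0]; last by rewrite S0 inE in iS.
  have -> : (S == [set i]) = false.
    apply/eqP => E; case/negP: hS; rewrite E; apply/subsetP => j.
    by rewrite inE => /eqP ->; rewrite mem_rcons mem_head.
  rewrite add0r (hF (S :\ i)).1 ?(lie0l hbr) //; apply/orP; left.
  apply: contra hS => /subsetP hS; apply/subsetP => j jS; rewrite mem_rcons inE.
  by have [//|ji] := eqVneq j i; apply: hS; rewrite !inE ji.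
have [E|hS] := eqVneq S [set i].
  by rewrite E setDv (hF set0).1 ?eqxx ?orbT // (lie0l hbr) addr0 wt1.
rewrite add0r (wtD1 iS); apply: le_trans (nrm_br _ _) _.
by rewrite ler_wpM2r //; case: (hF (S :\ i)).
Qed.

Variable ell : nat -> M.
Hypothesis ell_conc : forall k, (0 < k)%N -> concentrated (fun A : SI => #|A|) k (ell k).

(** This is [delta . exp L_n .. exp L_k], with [ell k] the value of [L_k]. *)
Definition tail_state k : V := foldl (fun m k => step (ell k) m) (degree_elt g SI) (rev (index_iota k n.+1)).

Definition tail_part k : M := (tail_state k).2.

Lemma tail_state_last : tail_state n.+1 = degree_elt g SI.
Proof. by rewrite /tail_state /index_iota subnn. Qed.

Lemma tail_state_step k : (k <= n)%N -> tail_state k = step (ell k) (tail_state k.+1).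
Proof.
move=> kn; rewrite /tail_state /index_iota subSn //= subSS rev_cons foldl_rcons //.
Qed.

Lemma tail_state1 k : (0 < k <= n.+1)%N -> tail_state k = (1 : K^o, tail_part k).
Proof.
move=> hk; rewrite /tail_part; suff : (tail_state k).1 = 1 by case: (tail_state k) => w F /= ->.
have [j Ej] : exists j, k = (n.+1 - j)%N by exists (n.+1 - k)%N; lia.
elim: j k hk Ej => [|j IH] k hk Ej; first by rewrite Ej subn0 tail_state_last.
have k0 : (0 < k)%N by lia.
rewrite tail_state_step; last by lia.
have := IH k.+1 _ _; case: (tail_state k.+1) => w F /= ->; [|by lia|by lia].
by rewrite (expad_degree_elt _ n0 (ell_conc k0)).
Qed.

Lemma tail_part_step k : (0 < k <= n)%N ->
  tail_part k = k%:R *: ell k + exp_br n (ell k) (tail_part k.+1).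
Proof.
move=> /andP[k0 kn]; rewrite /tail_part tail_state_step // tail_state1 ?(expad_degree_elt _ n0 (ell_conc k0)) //.
Qed.

Lemma tail_part_supp k : (0 < k <= n.+1)%N -> supp_ge k (tail_part k).
Proof.
move=> hk; have [j Ej] : exists j, k = (n.+1 - j)%N by exists (n.+1 - k)%N; lia.
elim: j k hk Ej => [|j IH] k hk Ej.
  by rewrite /tail_part Ej subn0 tail_state_last => S _; rewrite ffunE.
rewrite tail_part_step; last by lia.
have k0 : (0 < k)%N by lia.
move=> S hS; rewrite ffunE [X in X + _]ffunE (ell_conc k0) ?scaler0 ?add0r; last by rewrite neq_ltn hS.
have H : supp_ge k.+1 (exp_br n (ell k) (tail_part k.+1)).
  by apply: supp_exp_br (ell_conc k0); apply: IH; lia.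
by apply: H; rewrite ltnS ltnW.
Qed.

(** In degree [k] the exponential in [tail_part_step] contributes nothing,
    since [tail_part k.+1] starts in degree [k + 1]. *)
Lemma tail_part_head k (S : SI) : (0 < k <= n)%N -> #|S| = k -> tail_part k S = k%:R *: ell k S.
Proof.
move=> hk hS; rewrite tail_part_step // ffunE [X in X + _]ffunE.
have k0 : (0 < k)%N by lia.
have H : supp_ge k.+1 (exp_br n (ell k) (tail_part k.+1)).
  by apply: supp_exp_br (ell_conc k0); apply: tail_part_supp; lia.
by rewrite H ?addr0 // hS.
Qed.

Lemma tail_part_succ k : (0 < k <= n)%N ->
  tail_part k.+1 = exp_br n (- ell k) (tail_part k - k%:R *: ell k).
Proof.
move=> hk; have k0 : (0 < k)%N by lia.
by rewrite (tail_part_step hk) addrAC subrr add0r (exp_br_inv _ k0 (ell_conc k0)).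
Qed.

(** Subtracting [k l_k] only removes the part of degree [k]. *)
Lemma maj_rest k p : (0 < k <= n)%N -> maj (tail_part k) p -> (forall i, 0 <= p`_i) ->
  maj (tail_part k - k%:R *: ell k) p.
Proof.
move=> hk hF hp S; have k0 : (0 < k)%N by lia.
have [hS|hS] := eqVneq #|S| k.
  rewrite !ffunE (tail_part_head hk hS) subrr nrm0.
  by rewrite mulr_ge0 ?wt_ge0 // mulr_ge0 ?ler0n.
by rewrite !ffunE (ell_conc k0) // scaler0 subr0.
Qed.

Lemma maj_ell k c : (0 < k)%N ->
  (forall S : SI, #|S| = k -> nrm (ell k S) <= k`!%:R * c * wt S) ->
  0 <= c -> maj (ell k) (c *: 'X^k).
Proof.
move=> k0 h c0 S; rewrite coefZ coefXn.
have [hS|hS] := eqVneq #|S| k; first by rewrite mulr1 hS; apply: h.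
by rewrite (ell_conc k0) // nrm0 !mulr0 mul0r.
Qed.

(** A simultaneous induction: the bound on [tail_part k.+1] gives the bound on
    [ell k.+1], its lowest part, by [exp_tail_prod_le]; and passing to the
    next tail multiplies the majorant by one more factor [exp_mono]. *)
Lemma factor_bound (us : seq 'I_n) : uniq us ->
  foldl (fun m i => step (xX i) m) (degree_elt g SI) us = tail_state 1 ->
  forall k, (0 < k <= n)%N ->
  maj (ell k) (maj_coef R k *: 'X^k) /\ maj (tail_part k.+1) (exp_tail R n * exp_prod R n k).
Proof.
move=> uus hU; have [_ hF] := ordered_exp_bound uus; rewrite hU -/(tail_part 1) in hF.
have nne2 : nneg (exp_tail R n).
  by move=> i; rewrite exp_tail_coef; case: ifP => // _; rewrite invr_ge0.
have succ k p : (0 < k <= n)%N -> maj (ell k) (maj_coef R k *: 'X^k) ->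
    maj (tail_part k - k%:R *: ell k) p -> maj (tail_part k.+1) (p * exp_mono R n k).
  by move=> hk hl hp; rewrite tail_part_succ //; apply: maj_exp_br => //; apply: majN.
elim=> [//|k IH] hk; have [k0|k0] := posnP k; first subst k.
  (* The first tail has the majorant [e^x - 1]; removing its part of degree 1
     leaves [e^x - 1 - x]. *)
  have hl : maj (ell 1) (maj_coef R 1 *: 'X^1).
    apply: maj_ell => [//|S hS|]; last exact: maj_coef_ge0.
    have := tail_part_head hk hS; rewrite scale1r => <-.
    by rewrite maj_coef1 !mul1r; case: (hF S).
  split=> //; rewrite /exp_prod big_nat1; apply: succ => //.
  rewrite scale1r => S; rewrite exp_tail_coef; case: ifP => hS.
    rewrite !ffunE (ell_conc (ltnSn 0)) ?subr0; last by apply/eqP; lia.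
    by rewrite divff ?mul1r ?pnatr_eq0 -?lt0n ?fact_gt0 //; case: (hF S).
  have cS : (#|S| <= n)%N by rewrite -[X in (_ <= X)%N](card_ord n) max_card.
  have [S1|S1] := eqVneq #|S| 1%N.
    have E := tail_part_head hk S1.
    by rewrite !ffunE E scale1r subrr nrm0 mulr0 mul0r.
  have S0 : S = set0 by apply/eqP; rewrite -cards_eq0; lia.
  rewrite !ffunE (ell_conc (ltnSn 0)) // subr0 (hF S).1 ?S0 ?eqxx ?orbT //.
  by rewrite nrm0 mulr0 mul0r.
have hk' : (0 < k <= n)%N by lia.
have [_ hFk] := IH hk'.
have pos : nneg (exp_tail R n * exp_prod R n k) := nnegM nne2 (nneg_exp_prod _ _ _).
have hl : maj (ell k.+1) (maj_coef R k.+1 *: 'X^(k.+1)).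
  apply: maj_ell => [//|S hS|]; last exact: maj_coef_ge0.
  have k1 : 0 < k.+1%:R :> R by rewrite ltr0n.
  rewrite -(ler_pM2l k1) -nrm_nat -(tail_part_head hk hS).
  apply: le_trans (hFk S) _; rewrite hS.
  have -> : k.+1%:R * (k.+1`!%:R * maj_coef R k.+1 * wt S) =
     k.+1`!%:R * (k.+1%:R * maj_coef R k.+1) * wt S by ring.
  rewrite ler_wpM2r ?wt_ge0 // ler_wpM2l ?ler0n //.
  by apply: exp_tail_prod_le; lia.
split=> //; rewrite /exp_prod big_nat_recr //= -/(exp_prod R n k) mulrA.
by apply: succ => //; apply: maj_rest.
Qed.

End MajorantRecursion.

Section Value.
Variables (R : realFieldType) (K : numFieldType) (g : lmodType K).
Variables (br0 : g -> g -> g) (nrm : g -> R).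
Hypothesis hbr0 : lie_bracket br0.
Hypothesis nrm_ge0 : forall u, 0 <= nrm u.
Hypothesis nrm0 : nrm 0 = 0.
Hypothesis nrmD : forall u w, nrm (u + w) <= nrm u + nrm w.
Hypothesis nrmZ : forall (c : rat) u, nrm ((ratr c : K) *: u) = `|ratr c| * nrm u.
Hypothesis nrm_br : forall u w, nrm (br0 u w) <= nrm u * nrm w.
Variables (n : nat) (d : bool).
Hypothesis n0 : (0 < n)%N.

(** The value is the coefficient of the full set in the [n]-th factor, to
    which [factor_bound] applies. *)
Lemma factorization_value_bound (L : nat -> ncpoly n) (z : lie_expr n) (x : 'I_n -> g) :
  homogeneous_lie L ->
  (forall N, (\prod_(i < n) texp N 1 (ncvar i))`_N =
    (\prod_(m <- factor_seq d N) texp N m (L m))`_N) ->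
  ncpoly_of_lie z = multilinear_part (L n) ->
  nrm (lie_eval (fun q v => (ratr q : K) *: v) br0 x z) <=
    n`!%:R * maj_coef R n * \prod_i nrm (x i).
Proof.
move=> hL hf hz.
have [e he] : exists e : nat -> lie_expr n, forall m, (0 < m)%N -> L m = ncpoly_of_lie (e m).
  have : forall m, exists em : lie_expr n, (0 < m)%N -> L m = ncpoly_of_lie em.
    move=> m; have [->|m0] := posnP m; first by exists (LieZero n).
    by have [[em hem] _] := hL m m0; exists em.
  by move/choice => [e he]; exists e.
pose br := dir_br br0 d.
have hbr : lie_bracket br := lie_dir_br hbr0 d.
pose xX := fun i : 'I_n => single [set i] (x i).
have hx i (S : {set 'I_n}) : #|S| != 1%N -> xX i S = 0 by exact: conc_xX.
have hX := set_graded 'I_n.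
pose ell k := lie_ev br (@set_join 'I_n) xX d (e k).
have ell_conc k : (0 < k)%N -> concentrated (fun A : {set 'I_n} => #|A|) k (ell k).
  move=> k0 S hS; have [S0|S0] := posnP #|S|; first exact: (ev_deg0 hbr0 d hX hx (e k) S0).
  apply: (scalerI (a := #|S|%:R)); first by rewrite pnatr_eq0 -lt0n.
  rewrite scaler0 (deg_ev hbr hX) -he //.
  have [_] := act_conc hbr hX d hx ((hL k k0).2) (conc_degree_elt _ _); apply.
  by rewrite add0n.
have nrm_br' u w : nrm (br u w) <= nrm u * nrm w.
  by rewrite /br /dir_br; case: (d) => //; rewrite mulrC.
have cardn (S : {set 'I_n}) : (#|S| <= n)%N by rewrite -[X in (_ <= X)%N](card_ord n) max_card.
have E := factorization_expad hbr hX hx cardn he (fun m m0 => (hL m m0).2) hf.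
have us : uniq (if d then rev (index_enum 'I_n) else index_enum 'I_n).
  by case: (d); rewrite ?rev_uniq index_enum_uniq.
have hn : (0 < n <= n)%N by rewrite n0 leqnn.
have [hmaj _] := factor_bound hbr nrm_ge0 nrm0 nrmD nrmZ nrm_br' n0 ell_conc us E hn.
have hze : ncpoly_of_lie z = multilinear_part (ncpoly_of_lie (e n)).
  by apply: etrans hz _; congr multilinear_part; exact: he.
have -> := lie_value_ev hbr0 d x n0 hze.
have := hmaj [set: 'I_n]; rewrite cardsT card_ord coefZ coefXn eqxx mulr1 /wt.
by under eq_bigl do rewrite inE.
Qed.

End Value.

(** * Sums over increasing functions *)

Section Sums.
Variables (R : realFieldType).

Definition increasing n p (k : {ffun 'I_n -> 'I_p}) : bool :=
  [forall a : 'I_n, forall b : 'I_n, (a < b)%N ==> (k a < k b)%N].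

Lemma increasingP n p (k : {ffun 'I_n -> 'I_p}) :
  reflect (forall a b : 'I_n, (a < b)%N -> (k a < k b)%N) (increasing k).
Proof.
apply: (iffP forallP) => [h a b ab|h a]; first by have /forallP/(_ b)/implyP/(_ ab) := h a.
by apply/forallP => b; apply/implyP; exact: h.
Qed.

Lemma sum_ffun_prod n (A : finType) (w : A -> R) :
  \sum_(k : {ffun 'I_n -> A}) \prod_c w (k c) = (\sum_a w a) ^+ n.
Proof. by rewrite -(bigA_distr_bigA (fun _ a => w a)) prodr_const card_ord. Qed.

Lemma increasing_sorted n p (k : {ffun 'I_n -> 'I_p}) :
  increasing k -> sorted ltn [seq val (k c) | c <- enum 'I_n].
Proof.
move=> /increasingP hk; rewrite sorted_pairwise; last exact: ltn_trans.
rewrite pairwise_map; apply: (@sub_pairwise _ (relpre val ltn)) => [a b /hk //|].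
by rewrite -pairwise_map val_enum_ord -sorted_pairwise ?iota_ltn_sorted //; exact: ltn_trans.
Qed.

(** Two increasing rearrangements list the same values in increasing order. *)
Lemma increasing_perm_inj n p (k : {ffun 'I_n -> 'I_p}) (s t : 'S_n) :
  increasing [ffun c => k (s c)] -> increasing [ffun c => k (t c)] -> s = t.
Proof.
move=> hs ht; have kinj : injective k.
  have /increasingP h := hs; suff H (a b : 'I_n) : (a < b)%N -> k (s a) != k (s b).
    move=> a b kab; apply: (perm_inj (s := s^-1)%g); apply: val_inj.
    case: (ltngtP (val ((s^-1)%g a)) (val ((s^-1)%g b))) => // /H.
      by rewrite !permKV kab eqxx.
    by rewrite !permKV kab eqxx.
  by move=> /h; rewrite !ffunE => h'; apply/eqP => E; rewrite E ltnn in h'.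
have E : [seq val ([ffun c => k (s c)] c) | c <- enum 'I_n] =
         [seq val ([ffun c => k (t c)] c) | c <- enum 'I_n].
  apply: (irr_sorted_eq ltn_trans ltnn); try exact: increasing_sorted.
  move=> y; apply/mapP/mapP => -[c _ ->].
    by exists ((t^-1)%g (s c)); rewrite ?mem_enum // !ffunE permKV.
  by exists ((s^-1)%g (t c)); rewrite ?mem_enum // !ffunE permKV.
apply/permP => c; apply: kinj; apply: val_inj.
by have /eq_in_map/(_ c (mem_enum _ _)) := E; rewrite !ffunE.
Qed.

(** The [n!] rearrangements of increasing functions are distinct functions,
    and all functions together give the power of the sum. *)
Lemma increasing_sum_le n p (w : 'I_p -> R) : (forall a, 0 <= w a) ->
  n`!%:R * \sum_(k : {ffun 'I_n -> 'I_p} | increasing k) \prod_c w (k c) <=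
  (\sum_a w a) ^+ n.
Proof.
move=> w0; rewrite -(sum_ffun_prod n).
have -> : n`!%:R * \sum_(k : {ffun 'I_n -> 'I_p} | increasing k) \prod_c w (k c) =
    \sum_(s : 'S_n) \sum_(k : {ffun 'I_n -> 'I_p} | increasing [ffun c => k (s c)])
      \prod_c w (k c).
  rewrite -(card_Sn n) mulr_natl -sumr_const; apply: eq_big => [s|s _] //.
  pose sh (k : {ffun 'I_n -> 'I_p}) : {ffun 'I_n -> 'I_p} := [ffun c => k ((s^-1)%g c)].
  have sh_inj : injective sh.
    by move=> k k' /ffunP E; apply/ffunP => c; have := E (s c); rewrite !ffunE permK.
  rewrite [RHS](reindex_inj sh_inj) /=; apply: eq_big => [k|k _].
    congr increasing; apply/ffunP => c; by rewrite !ffunE permK.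
  rewrite (reindex_inj (@perm_inj _ s^-1)%g) /=.
  by apply: eq_bigr => c _; rewrite ffunE.
under eq_bigr do rewrite big_mkcond.
rewrite exchange_big /=; apply: ler_sum => k _.
have pk : 0 <= \prod_c w (k c) by apply: prodr_ge0.
apply: (@le_trans _ _ (\sum_(s : 'S_n | increasing [ffun c => k (s c)]) \prod_c w (k c))).
  by rewrite [leRHS]big_mkcond.
case: (pickP (fun s : 'S_n => increasing [ffun c => k (s c)])) => [s hs|none].
  rewrite (bigD1 s) //= [X in _ + X]big1 ?addr0 // => t /andP[ht]; case/eqP.
  exact: increasing_perm_inj ht hs.
by rewrite [leLHS]big1 // => s; rewrite none.
Qed.

(** Once the variables [c] and [c'] must fall into the same class of [h], the
    choice for [c'] contributes at most [D] instead of the whole sum. *)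
Lemma coincidence_sum_le n (A B : finType) (w : A -> R) (h : A -> B) (D : R) (c c' : 'I_n) :
  (forall a, 0 <= w a) -> c != c' -> (forall b, \sum_(a | h a == b) w a <= D) ->
  \sum_(k : {ffun 'I_n -> A} | h (k c) == h (k c')) \prod_d w (k d) <=
    D * (\sum_a w a) ^+ n.-1.
Proof.
move=> w0 cc' hD.
pose W := \sum_a w a; pose u b := \sum_(a | h a == b) w a.
have W0 : 0 <= W by apply: sumr_ge0.
have u0 b : 0 <= u b by apply: sumr_ge0.
(* For each class [b], require both variables to fall into [b]; the sum over
   functions then factors. *)
pose f b (d : 'I_n) a : R := if (d == c) || (d == c') then (if h a == b then w a else 0) else w a.
have -> : \sum_(k : {ffun 'I_n -> A} | h (k c) == h (k c')) \prod_d w (k d) =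
    \sum_b \sum_(k : {ffun 'I_n -> A}) \prod_d f b d (k d).
  rewrite exchange_big big_mkcond /=; apply: eq_bigr => k _.
  have fE b : \prod_d f b d (k d) =
     if (h (k c) == b) && (h (k c') == b) then \prod_d w (k d) else 0.
    case: ifP => [/andP[h1 h2]|].
      apply: eq_bigr => d _; rewrite /f; case: eqP => [->|_] /=; first by rewrite h1.
      by case: eqP => [->|_] //; rewrite h2.
    move/negbT; rewrite negb_and => /orP[h1|h1].
      by rewrite (bigD1 c) //= /f eqxx /= (negbTE h1) mul0r.
    by rewrite (bigD1 c') //= /f eqxx orbT (negbTE h1) mul0r.
  case: ifP => hk.
    rewrite (bigD1 (h (k c))) //= fE eqxx eq_sym hk /= [X in _ + X]big1 ?addr0 // => b hb.
    by rewrite fE eq_sym (negbTE hb).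
  rewrite [RHS]big1 // => b _; rewrite fE; case: ifP => // /andP[/eqP h1 /eqP h2].
  by rewrite h1 h2 eqxx in hk.
have -> : \sum_b \sum_(k : {ffun 'I_n -> A}) \prod_d f b d (k d) =
    \sum_b (u b * u b) * W ^+ n.-2.
  apply: eq_bigr => b _; rewrite -(bigA_distr_bigA (f b)).
  have sf : \sum_a (if h a == b then w a else 0) = u b by rewrite -big_mkcond.
  rewrite (bigD1 c) //= (bigD1 c') //=; last by rewrite eq_sym.
  rewrite mulrA; congr (_ * _).
    by congr (_ * _); rewrite -sf; apply: eq_bigr => a _; rewrite /f eqxx ?orbT.
  rewrite (eq_bigr (fun=> W)) => [|d /andP[dc dc']]; last first.
    by apply: eq_bigr => a _; rewrite /f (negbTE dc) (negbTE dc').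
  rewrite prodr_const; congr (_ ^+ _).
  have E : #|[predC pred2 c c']| = n.-2.
    by have := cardC (pred2 c c'); rewrite card2 cc' card_ord /=; move: #|_| => k; lia.
  by rewrite -E; apply: eq_card => d; rewrite !inE negb_or.
rewrite -mulr_suml.
have n2 : (n.-1 = n.-2.+1)%N.
  by case: n c c' cc' {f} => [[]//|[|n]] // c c'; rewrite !ord1 eqxx.
rewrite n2 exprS mulrA ler_wpM2r ?exprn_ge0 //.
rewrite [\sum_a w a](partition_big h xpredT) //= mulr_sumr; apply: ler_sum => b _.
exact: ler_wpM2r (u0 b) _ _ (hD b).
Qed.

End Sums.

Section Multiadditive.
Variables (g : zmodType) (n : nat) (P : ('I_n -> g) -> g).

Definition update (x : 'I_n -> g) (a : 'I_n) (u : g) : 'I_n -> g :=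
  fun c => if c == a then u else x c.

Definition multiadditive := forall x a u w,
  P (update x a (u + w)) = P (update x a u) + P (update x a w).

Hypothesis hP : multiadditive.

Lemma update0 x a : P (update x a 0) = 0.
Proof. by apply: (addrI (P (update x a 0))); rewrite -hP !addr0. Qed.

Lemma update_sum (J : Type) (r : seq J) (Q : pred J) (F : J -> g) x a :
  P (update x a (\sum_(j <- r | Q j) F j)) = \sum_(j <- r | Q j) P (update x a (F j)).
Proof. exact: (big_morph (fun u => P (update x a u)) (hP x a) (update0 x a)). Qed.

Lemma update_id x a : update x a (x a) = x.
Proof. by apply/funext => c; rewrite /update; case: eqP => [->|]. Qed.

Lemma zero_coord x a : x a = 0 -> P x = 0.
Proof. by move=> xa; rewrite -(update_id x a) xa update0. Qed.

(** Expand the coordinates one at a time. *)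
Lemma multiadditive_expand (A : finType) (X : A -> g) (T : 'I_n -> pred A) : (0 < n)%N ->
  P (fun c => \sum_(j | T c j) X j) =
  \sum_(k : {ffun 'I_n -> A} | [forall c, T c (k c)]) P (fun c => X (k c)).
Proof.
move=> n0; case: (pickP (fun _ : A => true)) => [a0 _|none]; last first.
  rewrite (@zero_coord _ (Ordinal n0)); last by rewrite big1 // => j; have := none j.
  by rewrite big1 // => k _; have := none (k (Ordinal n0)).
(* The set [D] collects the coordinates already expanded; the constant value
   [a0] on the others matches the index functions with the terms. *)
have claim (D : {set 'I_n}) (x : 'I_n -> g) :
  P (fun c => if c \in D then \sum_(j | T c j) X j else x c) =
  \sum_(k : {ffun 'I_n -> A} | [forall c, if c \in D then T c (k c) else k c == a0])
     P (fun c => if c \in D then X (k c) else x c).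
  move: {2}#|D| (erefl #|D|) => m; elim: m D x => [|m IH] D x cD.
    have -> : D = set0 by apply/eqP; rewrite -cards_eq0 cD.
    rewrite (bigD1 [ffun=> a0]) /=; last by apply/forallP => c; rewrite inE ffunE.
    rewrite big1 ?addr0; first by congr P; apply/funext => c; rewrite inE.
    move=> k /andP[/forallP hk]; case/eqP; apply/ffunP => c.
    by have := hk c; rewrite inE ffunE => /eqP.
  have [a aD] : exists a, a \in D by apply/set0Pn; rewrite -cards_eq0 cD.
  pose D' := D :\ a.
  have cD' : #|D'| = m by move: cD; rewrite (cardsD1 a) aD => -[].
  have inD' c : (c \in D) = (c == a) || (c \in D').
    by rewrite !inE; have [->|] := eqVneq c a.
  have aD' : a \in D' = false by rewrite !inE eqxx.
  have updE j : update (fun c => if c \in D' then \sum_(j | T c j) X j else x c) a (X j) =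
      fun c => if c \in D' then \sum_(j | T c j) X j else update x a (X j) c.
    by apply/funext => c; rewrite /update; have [->|] := eqVneq c a; rewrite ?aD'.
  transitivity (\sum_(j | T a j) \sum_(k : {ffun 'I_n -> A} |
      [forall c, if c \in D' then T c (k c) else k c == a0])
      P (fun c => if c \in D' then X (k c) else update x a (X j) c)).
    rewrite -(eq_bigr _ (fun j _ => IH D' (update x a (X j)) cD')).
    rewrite -(eq_bigr _ (fun j _ => congr1 P (updE j))) -update_sum; congr P.
    by apply/funext => c; rewrite /update inD'; have [->|] := eqVneq c a.
  rewrite [RHS](partition_big (fun k : {ffun 'I_n -> A} => k a) (T a)) /=; last first.
    by move=> k /forallP/(_ a); rewrite aD.
  apply: eq_bigr => j Tj.
  rewrite [RHS](reindex_onto (fun k : {ffun 'I_n -> A} => [ffun c => if c == a then j else k c])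
     (fun k : {ffun 'I_n -> A} => [ffun c => if c == a then a0 else k c])) /=; last first.
    move=> k /andP[_ /eqP ka]; apply/ffunP => c; rewrite !ffunE.
    by have [->|] := eqVneq c a.
  apply: eq_big => [k|k _]; last first.
    congr P; apply/funext => c; rewrite ffunE /update inD'.
    by have [->|] := eqVneq c a; rewrite ?aD'.
  rewrite ffunE !eqxx andbT; apply/forallP/andP => [hk|[/forallP hk /eqP E] c].
    split; first apply/forallP => c.
      rewrite ffunE inD'; have := hk c; have [->|//] := eqVneq c a.
      by rewrite aD'.
    apply/eqP/ffunP => c; rewrite !ffunE; have [->|//] := eqVneq c a.
    by have := hk a; rewrite aD' => /eqP.
  have := hk c; rewrite ffunE inD'; have [->|//] := eqVneq c a.
  by rewrite aD' => _; rewrite -E !ffunE eqxx.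
have := claim setT (fun=> 0).
rewrite (_ : (fun c => if c \in [set: 'I_n] then _ else _) = fun c => \sum_(j | T c j) X j); last first.
  by apply/funext => c; rewrite inE.
move=> ->; apply: eq_big => [k|k _]; last by congr P; apply/funext => c; rewrite inE.
by apply: eq_forallb => c; rewrite inE.
Qed.

End Multiadditive.

Section NestedBrackets.
Variables (K : numFieldType) (g : lmodType K) (br : g -> g -> g).
Hypothesis hbr : lie_bracket br.
Variable n : nat.
Implicit Types (x : 'I_n -> g) (a : 'I_n) (u w : g).

Local Notation fold x := (foldl (fun y j => br y (x j))).

Lemma fold_brD x y y' t : fold x (y + y') t = fold x y t + fold x y' t.
Proof. by elim: t y y' => //= j t IH y y'; rewrite (lieDl hbr) IH. Qed.

Lemma fold_br_update x a u y t : a \notin t -> fold (update x a u) y t = fold x y t.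
Proof.
elim: t y => //= j t IH y; rewrite inE negb_or => /andP[aj at_].
by rewrite IH // /update eq_sym (negbTE aj).
Qed.

Lemma nested_multiadditive (s : seq 'I_n) : perm_eq s (enum 'I_n) -> (0 < n)%N ->
  multiadditive (fun x => nested br x s).
Proof.
move=> ps n0 x a u w.
have us : uniq s by rewrite (perm_uniq ps) enum_uniq.
have : a \in s by rewrite (perm_mem ps) mem_enum.
case: s us {ps} => // i t /= /andP[it ut]; rewrite inE.
have [ai _|ai /= at_] := eqVneq a i.
  have upd_i v : update x i v i = v by rewrite /update eqxx.
  by subst a; rewrite !fold_br_update // !upd_i fold_brD.
have upd_i v : update x a v i = x i by rewrite /update eq_sym (negbTE ai).
case/splitPr: at_ ut it => t1 t2; rewrite cat_uniq /= negb_or => /and3P[_ /andP[at1 _] /andP[at2 _]] _.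
rewrite !foldl_cat /= !upd_i !fold_br_update //.
by rewrite /update eqxx (lieDr hbr) fold_brD.
Qed.

End NestedBrackets.

(** By [lie_value_words] the value is a combination of nested brackets in
    which every variable occurs exactly once. *)
Lemma lie_value_multiadditive (K : numFieldType) (g : lmodType K) (br : g -> g -> g)
    (hbr : lie_bracket br) n (z : lie_expr n) (p : ncpoly n) : (0 < n)%N ->
  ncpoly_of_lie z = multilinear_part p ->
  multiadditive (fun x => lie_eval (fun q v => (ratr q : K) *: v) br x z).
Proof.
move=> n0 hz x a u w.
have [hom hperm] := multilinear_part_words hz.
apply: (scalerI (a := n%:R : K)); first by rewrite pnatr_eq0 -lt0n.
rewrite scalerDr !(lie_value_words hbr false _ n0 hom) -big_split /=.
rewrite big_seq [RHS]big_seq; apply: eq_bigr => v; rewrite -mcoeff_neq0 => pv.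
by rewrite -scalerDr -(nested_multiadditive hbr (hperm _ pv) n0).
Qed.

From mathcomp Require Import complex.
From mathcomp Require Import all_classical all_reals all_analysis.
Import numFieldNormedType.Exports.
Local Open Scope classical_set_scope.
Local Open Scope ring_scope.

(** * Taylor coefficients of the majorant *)

Section Taylor.
Variable R : realType.

(** The function [u n] is the [n]-th derivative of [u 0] on [D]. *)
Definition derive_tower (D : set R) (u : nat -> R -> R) :=
  forall n x, D x -> is_derive x 1 (u n) (u n.+1 x).

Lemma derive_tower_eq (D : set R) (u : nat -> R -> R) (f : R -> R) :
  open D -> derive_tower D u -> (forall x, D x -> f x = u 0%N x) ->
  forall n x, D x -> derive1n n f x = u n x.
Proof.
move=> oD hu hf; elim=> [|n IH] x Dx; first exact: hf.
have nearD : \near x, u n x = derive1n n f x.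
  by near=> y; rewrite IH //; near: y; exact: open_nbhs_nbhs.
rewrite derive1nS derive1E -(near_eq_derive _ nearD).
by have ? := hu n x Dx; rewrite derive_val.
Unshelve. all: by end_near. Qed.

(** The Leibniz formula for the derivatives of the square of [u 0]. *)
Definition cauchy_square (u : nat -> R -> R) n x : R :=
  n`!%:R * \sum_(i < n.+1) (i`!%:R^-1 * u i x) * ((n - i)`!%:R^-1 * u (n - i)%N x).

Lemma fact_neq0 n : n`!%:R != 0 :> R.
Proof. by rewrite pnatr_eq0 -lt0n fact_gt0. Qed.

Lemma derive_tower_square (D : set R) u :
  derive_tower D u -> derive_tower D (cauchy_square u).
Proof.
move=> hu n x Dx.
pose c i : R := i`!%:R^-1 * u i x.
have cS i : i`!%:R^-1 * u i.+1 x = i.+1%:R * c i.+1.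
  by rewrite /c factS natrM invfM !mulrA divff ?mul1r // pnatr_eq0.
pose F (i : 'I_n.+1) : R -> R :=
  (i`!%:R^-1 \*: u i) * ((n - i)`!%:R^-1 \*: u (n - i)%N).
have -> : cauchy_square u n = n`!%:R \*: \sum_i F i.
  by apply/funext => y; rewrite /cauchy_square /= fct_sumE.
have dF i : is_derive x 1 (F i)
    ((n - i).+1%:R * (c i * c (n - i).+1) + i.+1%:R * (c i.+1 * c (n - i)%N)).
  have h1 := is_deriveZ i`!%:R^-1 (hu i x Dx).
  have h2 := is_deriveZ (n - i)`!%:R^-1 (hu (n - i)%N x Dx).
  apply: is_derive_eq (is_deriveM h1 h2) _.
  transitivity (c i * ((n - i)`!%:R^-1 * u (n - i).+1 x)
    + c (n - i)%N * (i`!%:R^-1 * u i.+1 x)); first by [].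
  by rewrite !cS; ring.
apply: is_derive_eq (is_deriveZ n`!%:R (is_derive_sum dF)) _.
rewrite [_ *: _]/(_ * _) /cauchy_square factS natrM mulrAC mulrC; congr (_ * _).
rewrite big_split /=.
have -> : \sum_(i < n.+1) (n - i).+1%:R * (c i * c (n - i).+1) =
    \sum_(i < n.+2) (n.+1 - i)%:R * (c i * c (n.+1 - i)%N).
  rewrite [RHS]big_ord_recr /= subnn mul0r addr0; apply: eq_bigr => i _.
  by rewrite subSn // -ltnS.
have -> : \sum_(i < n.+1) i.+1%:R * (c i.+1 * c (n - i)%N) =
    \sum_(i < n.+2) (i : nat)%:R * (c i * c (n.+1 - i)%N).
  by rewrite [RHS]big_ord_recl mul0r add0r; apply: eq_bigr => i _.
rewrite -big_split mulr_sumr; apply: eq_bigr => i _ /=.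
by rewrite -mulrDl -natrD subnK // -ltnS.
Qed.

Lemma derive_tower_horner (p : {poly R}) :
  derive_tower setT (fun n x => (p^`(n)).[x]).
Proof.
by move=> n x _; rewrite derivnS; apply: is_derive_eq (is_derive_poly _ _) _.
Qed.

Variable v : R.

Definition quad : {poly R} := 2^-1 *: (2%:P - v *: 'X) ^+ 2 - 1%:P.

Lemma quadE x : quad.[x] = 2^-1 * (2 - x * v) ^+ 2 - 1.
Proof.
by rewrite hornerD hornerN hornerC hornerZ horner_exp hornerD hornerN hornerZ
  hornerX hornerC (mulrC v).
Qed.

Definition qpos : set R := [set x | 0 < quad.[x]].

Fixpoint sqrt_num n : {poly R} :=
  if n is k.+1 then
    (sqrt_num k)^`() * quad + (2^-1 - k%:R) *: (sqrt_num k * quad^`())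
  else 1.

(** The [n]-th derivative of the square root of a polynomial [q] is a
    polynomial times [sqrt q / q^n]. *)
Definition sqrt_tower n x : R := (sqrt_num n).[x] * Num.sqrt quad.[x] / quad.[x] ^+ n.

Lemma derive_tower_sqrt : derive_tower qpos sqrt_tower.
Proof.
move=> n x Dx.
have q0 : quad.[x] != 0 by rewrite gt_eqF.
have s0 : Num.sqrt quad.[x] != 0 by rewrite gt_eqF // sqrtr_gt0.
have dq : is_derive x 1 (horner quad) quad^`().[x] := is_derive_poly _ _.
have ds : is_derive x 1 (Num.sqrt \o horner quad)
   ((2 * Num.sqrt quad.[x])^-1 * quad^`().[x]).
  by apply: is_derive1_comp; exact: is_derive1_sqrt.
have dp : is_derive x 1 (horner (sqrt_num n)) (sqrt_num n)^`().[x] := is_derive_poly _ _.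
have qn0 : (horner quad ^+ n) x != 0 by rewrite fctE expf_neq0.
have dX := is_deriveX n dq.
have dV := is_deriveV qn0 dX.
have := is_deriveM (is_deriveM dp ds) dV.
rewrite !fctE => H.
apply: is_derive_eq H _.
have sV : (2 * Num.sqrt quad.[x])^-1 = Num.sqrt quad.[x] / (2 * quad.[x]).
  have := @sqr_sqrtr _ quad.[x] (ltW Dx).
  by move: s0; set t := Num.sqrt _ => t0 <-; field.
have numS : (sqrt_num n.+1).[x] = (sqrt_num n)^`().[x] * quad.[x]
    + (2^-1 - n%:R) * ((sqrt_num n).[x] * quad^`().[x]).
  by rewrite hornerD hornerZ 2!hornerM.
rewrite sV /sqrt_tower numS.
move: q0; set q := quad.[x]; set q' := quad^`().[x]; set t := Num.sqrt _.
set p := (sqrt_num n).[x]; set p' := (_^`()).[x] => q0.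
transitivity ((p * t) * (- q ^+ n ^- 2 * (n%:R * q ^+ n.-1 * q'))
   + q ^- n * (p * (t / (2 * q) * q') + t * p')); first by [].
move: p p' => p p'; case En : n => [|k] /=.
  by rewrite !expr0 expr1; field.
have qn : q ^+ k != 0 by rewrite expf_neq0.
rewrite !exprS; move: (q ^+ k) qn => r r0; field.
by rewrite q0 r0.
Qed.

Lemma open_qpos : open qpos.
Proof.
rewrite (_ : qpos = horner quad @^-1` [set y | 0 < y]) //.
by apply: open_comp => [x _|]; [exact: (@continuous_horner R quad x)|exact: open_gt].
Qed.

Lemma qpos0 : qpos 0.
Proof. by rewrite /qpos /= quadE; lra. Qed.

Lemma quad0 : quad.[0] = 1.
Proof. by rewrite quadE; lra. Qed.

Lemma quad_coef n : quad`_n =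
  (n == 0%N)%:R - 2 * v * (n == 1%N)%:R + 2^-1 * v ^+ 2 * (n == 2%N)%:R.
Proof.
have -> : quad = 1%:P - (2 * v) *: 'X + (2^-1 * v ^+ 2) *: 'X^2.
  rewrite /quad sqrrB -polyC_exp -!mul_polyC exprMn !polyCM -!polyC_exp.
  have h2 : (2^-1)%:P * 2%:P = 1 :> {poly R} by rewrite -polyCM mulVf ?polyC1.
  transitivity ((2^-1)%:P * 2%:P * 2%:P - (2^-1)%:P * 2%:P * 2%:P * (v%:P * 'X)
    + (2^-1)%:P * (v ^+ 2)%:P * 'X^2 - 1%:P : {poly R}); first by ring.
  by rewrite h2 polyC_natr polyC1 polyC_exp; ring.
by rewrite !(coefD, coefN, coefZ, coefC, coefX, coefXn); case: n => [|[|[|n]]] /=; ring.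
Qed.

(** The square of the Taylor series of [sqrt q] is [q].  This determines its
    coefficients, and is the quadratic recursion of [maj_coef] up to sign and
    the powers of [v]. *)
Lemma taylor_coef_majorant n : (0 < n)%N ->
  taylor_coef (wilcox_majorant v) n = maj_coef R n * v ^+ n.
Proof.
pose u := sqrt_tower; pose a i := i`!%:R^-1 * u i 0.
have hu : derive_tower qpos u := derive_tower_sqrt.
have a0 : a 0%N = 1.
  by rewrite /a /u /sqrt_tower /= hornerC quad0 sqrtr1 expr0 fact0 !invr1 !mulr1.
have squares m : \sum_(i < m.+1) a i * a (m - i)%N = quad`_m.
  apply: (mulfI (fact_neq0 m)); rewrite -/(cauchy_square u m 0).
  have hc := derive_tower_square hu.
  have hq : derive_tower qpos (fun n x => (quad^`(n)).[x]).
    by move=> k x _; apply: derive_tower_horner.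
  rewrite -(derive_tower_eq open_qpos hc (f := horner quad)) //; last exact: qpos0.
    rewrite (derive_tower_eq open_qpos hq) //; last exact: qpos0.
    by rewrite horner_coef0 coef_derivn addn0 ffactnn mulr_natl.
  move=> x qx; rewrite /cauchy_square big_ord1 /u /sqrt_tower /= hornerC.
  by rewrite fact0 ?expr0 !invr1 !mul1r !mulr1 -expr2 sqr_sqrtr // ltW.
have coefE m : (0 < m)%N -> - a m = maj_coef R m * v ^+ m.
  elim/ltn_ind: m => m IH m0.
  have := squares m; case: m m0 IH => // m _ IH.
  rewrite big_ord_recl big_ord_recr /= subn0 subnn a0 mul1r mulr1 => h.
  rewrite maj_coef_rec big_ord_recl big_ord_recr /= subnn maj_coef0 mul0r mulr0 add0r addr0.
  have -> : \sum_(i < m) maj_coef R (bump 0 i) * maj_coef R (m.+1 - bump 0 i) =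
      \sum_(i < m) maj_coef R i.+1 * maj_coef R (m - i) by [].
  have : \sum_(i < m) a (bump 0 i) * a (m.+1 - bump 0 i)%N =
      (\sum_(i < m) maj_coef R i.+1 * maj_coef R (m - i)) * v ^+ m.+1.
    rewrite mulr_suml; apply: eq_bigr => i _; rewrite /bump /= add1n subSS.
    have hi := ltn_ord i.
    rewrite -[LHS]mulrNN !IH ?subn_gt0 //; try lia.
    have -> : m.+1 = (i.+1 + (m - i))%N by lia.
    by rewrite exprD; ring.
  move: h; set S := \sum_(_ < _) _ => h SE; move: h; rewrite SE quad_coef.
  move: (\sum_(_ < _) _) => T; clear; case: m => [|[|m]] /=.
  - rewrite /bump /=; move: (a _) => c; lra.
  - rewrite /bump /=; move: (a _) => c; lra.
  - rewrite /bump /=; move: (a _) (v ^+ _) => c w; lra.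
case: n => // n _; rewrite -coefE //.
have hf : derive_tower qpos (fun k x => (k == 0%N)%:R - u k x).
  move=> k x qx.
  have hc : is_derive x 1 (cst ((k == 0%N)%:R : R)) 0 by apply: is_derive_cst.
  exact: is_derive_eq (is_deriveB hc (hu k x qx)) _.
rewrite /taylor_coef (derive_tower_eq open_qpos hf) //; last exact: qpos0.
  by rewrite sub0r /a mulrC mulrN.
move=> x qx; rewrite /u /sqrt_tower /= hornerC ?expr0 invr1 mul1r mulr1.
by rewrite /wilcox_majorant quadE.
Qed.

End Taylor.

(** * The real-valued norm *)

Section Rnorm.
Variables (R : realType) (s : scalars) (g : completeNormedModType (scalar_field R s)).

Definition emb : R -> scalar_field R s :=
  match s with RealScalars => id | ComplexScalars => fun x => (x%:C)%C end.

Lemma emb_le a b : (emb a <= emb b) = (a <= b).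
Proof. by rewrite /emb; case: s => //; exact: lecR. Qed.

Lemma emb_lt a b : (emb a < emb b) = (a < b).
Proof. by rewrite /emb; case: s => //; exact: ltcR. Qed.

Lemma embD a b : emb (a + b) = emb a + emb b.
Proof. by rewrite /emb; case: s => //; exact: rmorphD. Qed.

Lemma embM a b : emb (a * b) = emb a * emb b.
Proof. by rewrite /emb; case: s => //; exact: rmorphM. Qed.

Lemma emb_ratr q : emb (ratr q) = ratr q.
Proof. by rewrite /emb; case: s => //; exact: fmorph_rat. Qed.

Lemma emb0 : emb 0 = 0.
Proof. by rewrite /emb; case: s. Qed.

Lemma emb_inj : injective emb.
Proof. by move=> a b E; apply/le_anti; rewrite -!emb_le E lexx. Qed.

Lemma emb_norm a : emb `|a| = `|emb a|.
Proof. rewrite /emb; case: s => //; by rewrite [RHS]normc_def /= expr0n /= addr0 sqrtr_sqr. Qed.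

Lemma emb_pos (e : scalar_field R s) : 0 < e -> exists2 r, 0 < r & e = emb r.
Proof.
rewrite /emb; case: s e => [e e0|e e0]; first by exists e.
move: (e0); rewrite ltcE /= => /andP[/eqP Ime Ree]; exists (complex.Re e) => //.
by case: e e0 Ime Ree => a b /= _ ->.
Qed.

Lemma norm_rnorm (x : g) : `|x| = emb (rnorm x).
Proof.
rewrite /rnorm /emb; move: g x; case: s => // g' x.
have := normr_ge0 x; rewrite lecE /= => /andP[/eqP Im0 _].
by rewrite /scalar_re; case: `|x| Im0 => a b /= ->.
Qed.

Lemma rnorm_ge0 (x : g) : 0 <= rnorm x.
Proof. by rewrite -emb_le emb0 -norm_rnorm. Qed.

Lemma rnorm0 : rnorm (0 : g) = 0.
Proof. by apply: emb_inj; rewrite -norm_rnorm normr0 emb0. Qed.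

Lemma rnormD (x y : g) : rnorm (x + y) <= rnorm x + rnorm y.
Proof. by rewrite -emb_le embD -!norm_rnorm ler_normD. Qed.

Lemma rnormN (x : g) : rnorm (- x) = rnorm x.
Proof. by apply: emb_inj; rewrite -!norm_rnorm normrN. Qed.

Lemma rnormZ (c : rat) (x : g) :
  rnorm ((ratr c : scalar_field R s) *: x) = `|ratr c| * rnorm x.
Proof. by apply: emb_inj; rewrite embM -!norm_rnorm normrZ emb_norm emb_ratr. Qed.

Lemma rnorm_br (br : g -> g -> g) (hbr : banach_lie br) x y :
  rnorm (br x y) <= rnorm x * rnorm y.
Proof. by rewrite -emb_le embM -!norm_rnorm (br_norm hbr). Qed.

Lemma banach_lie_bracket (br : g -> g -> g) (hbr : banach_lie br) : lie_bracket br.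
Proof. by case: hbr. Qed.

Lemma rnorm_sum (J : Type) (r : seq J) (P : pred J) (F : J -> g) :
  rnorm (\sum_(j <- r | P j) F j) <= \sum_(j <- r | P j) rnorm (F j).
Proof.
elim/big_rec2: _ => [|j u w _ IH]; first by rewrite rnorm0.
by apply: le_trans (rnormD _ _) _; rewrite lerD2l.
Qed.

Lemma cvg_rnorm_lim (F : set_system g) {FF : ProperFilter F} (l : g) (c : R) :
  F --> l -> (\forall y \near F, rnorm y <= c) -> rnorm l <= c.
Proof.
move=> Fl Fc; apply/ler_addgt0Pr => e e0.
have e0' : 0 < emb e by rewrite -emb0 emb_lt.
have Fb : F (ball l (emb e)) by apply: Fl; apply: nbhsx_ballx.
have [y [ly yc]] := filter_ex (filterI Fb Fc).
rewrite addrC -(subrK y l); apply: le_trans (rnormD _ _) _.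
apply: lerD => //; rewrite -emb_le -norm_rnorm; apply: ltW.
by move: ly; rewrite -ball_normE.
Qed.

Lemma cvg_to0_rnorm (u : nat -> g) (e : R) : 0 < e ->
  u @ \oo --> (0 : g) -> exists m, rnorm (u m) < e.
Proof.
move=> e0 u0.
have e0' : 0 < emb e by rewrite -emb0 emb_lt.
have := u0 _ (nbhsx_ballx _ _ e0').
case=> m _ /(_ m (leqnn m)) hm; exists m; move: hm => /=; rewrite -ball_normE /= sub0r normrN norm_rnorm.
by rewrite emb_lt.
Qed.

Lemma rnorm_cauchy_cvg (F : set_system g) {FF : ProperFilter F} :
  (forall e : R, 0 < e -> exists y, \forall z \near F, rnorm (y - z) < e) -> cvg F.
Proof.
move=> H; apply: cauchy_cvg; apply: cauchy_exP => e e0.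
have [r r0 ->] := emb_pos e0; have [y hy] := H r r0.
exists y; apply: filterS hy => z.
by rewrite -ball_normE /= norm_rnorm emb_lt.
Qed.

End Rnorm.

(** * Ordered partitions and fine partitions *)

Section Partitions.
Variable R : realType.
Implicit Types (I i j : interval R) (J : seq (interval R)).

(** Empty pieces precede and follow everything. *)
Definition before i j : bool := `[< forall x y : R, x \in i -> y \in j -> x < y >].

Definition pieces_union J : set R := [set x | exists2 j, j \in J & x \in j].

Lemma beforeP i j x y : before i j -> x \in i -> y \in j -> x < y.
Proof. by move=> /asboolP h; apply: h. Qed.

Lemma ordered_partitionE I J :
  ordered_partition I J <-> [set` I] = pieces_union J /\ pairwise before J.
Proof.
split=> -[IJ h]; split=> //.
  apply/(pairwiseP I) => a b; rewrite !inE => ha hb ab; apply/asboolP => x y.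
  have := h (Ordinal ha) (Ordinal hb) ab x y.
  by rewrite !(tnth_nth I).
move=> a b ab x y; rewrite !(tnth_nth I).
move=> xa yb; apply: (beforeP _ xa yb).
by have /(pairwiseP I) := h; apply; rewrite ?inE.
Qed.

Lemma partition_sub I J j : ordered_partition I J -> j \in J -> [set` j] `<=` [set` I].
Proof. by move=> [-> _] jJ x xj; exists j. Qed.

Lemma partition_self I : ordered_partition I [:: I].
Proof.
apply/ordered_partitionE; split=> //; apply/seteqP; split=> x /=.
  by move=> xI; exists I; rewrite ?inE.
by move=> [j]; rewrite inE => /eqP ->.
Qed.

Lemma pieces_union_cat J J' : pieces_union (J ++ J') = pieces_union J `|` pieces_union J'.
Proof.
apply/seteqP; split=> x /=.
  by move=> [j]; rewrite mem_cat => /orP[jJ|jJ] xj; [left|right]; exists j.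
by move=> [|] [j jJ xj]; exists j => //; rewrite mem_cat jJ ?orbT.
Qed.

Lemma pieces_union_flatten (T : eqType) (r : seq T) (S : T -> set R) (f : T -> seq (interval R)) :
  (forall t, t \in r -> pieces_union (f t) = S t) ->
  pieces_union (flatten [seq f t | t <- r]) = [set x | exists2 t, t \in r & S t x].
Proof.
move=> h; apply/seteqP; split=> x /=.
  move=> [k /flatten_mapP[t tr kt] xk]; exists t => //.
  by rewrite -h //; exists k.
move=> [t tr]; rewrite -h // => -[k kt xk]; exists k => //.
by apply/flatten_mapP; exists t.
Qed.

Lemma pairwise_flatten J (f : interval R -> seq (interval R)) :
  pairwise before J -> (forall j, j \in J -> ordered_partition j (f j)) ->
  pairwise before (flatten [seq f j | j <- J]).
Proof.
elim: J => //= j J IH /andP[/allP jJ pJ] h; rewrite pairwise_cat.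
have hj := h j (mem_head _ _).
rewrite IH //; last by move=> k kJ; apply: h; rewrite inE kJ orbT.
have [_ ->] := (ordered_partitionE j (f j)).1 hj; rewrite !andbT.
apply/allrelP => k k' kj /flatten_mapP[j' jJ' kj']; apply/asboolP => x y xk yk.
apply: (beforeP (jJ j' jJ')); first exact: (partition_sub hj kj).
by apply: (partition_sub (h j' _) kj') => //; rewrite inE jJ' orbT.
Qed.

Lemma partition_flatten I J (f : interval R -> seq (interval R)) :
  ordered_partition I J -> (forall j, j \in J -> ordered_partition j (f j)) ->
  ordered_partition I (flatten [seq f j | j <- J]).
Proof.
move=> /ordered_partitionE[IJ pJ] h; apply/ordered_partitionE; split; last exact: pairwise_flatten.
rewrite (@pieces_union_flatten _ J (fun j => [set` j])) //.
by move=> j jJ; have [-> _] := h j jJ.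
Qed.

Lemma partition_meet I J i : ordered_partition I J -> [set` i] `<=` [set` I] ->
  ordered_partition i [seq (i `&` j)%O | j <- J].
Proof.
move=> /ordered_partitionE[IJ pJ] iI; apply/ordered_partitionE; split.
  apply/seteqP; split=> x /=.
    move=> xi; have : [set` I] x by apply: iI.
    rewrite IJ => -[j jJ xj]; exists (i `&` j)%O; first by apply/mapP; exists j.
    by rewrite in_itvI xi.
  by move=> [k /mapP[j jJ ->]]; rewrite in_itvI => /andP[].
rewrite pairwise_map; apply: sub_pairwise pJ => a b ab; apply/asboolP => x y.
by rewrite !in_itvI => /andP[_ xa] /andP[_ yb]; apply: (beforeP ab).
Qed.

Lemma partition_replace I J1 J2 j Q :
  ordered_partition I (J1 ++ j :: J2) -> ordered_partition j Q ->
  ordered_partition I (J1 ++ Q ++ J2).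
Proof.
move=> /ordered_partitionE[IJ pJ] hQ.
have /ordered_partitionE[jQ pQ] := hQ; apply/ordered_partitionE; split.
  rewrite IJ (_ : J1 ++ j :: J2 = J1 ++ [:: j] ++ J2) // !pieces_union_cat -jQ.
  by congr (_ `|` (_ `|` _)); have /ordered_partitionE[] := partition_self j.
move: pJ; rewrite !pairwise_cat /= allrel_consr => /and3P[/andP[/allP aj a2] p1 /andP[/allP j2 p2]].
rewrite allrel_catr a2 p1 pQ p2 !andbT /=; apply/andP; split.
  apply/allrelP => a k aJ kQ; apply/asboolP => x y xa yk.
  by apply: (beforeP (aj a aJ)) => //; exact: (partition_sub hQ kQ).
apply/allrelP => k b kQ bJ; apply/asboolP => x y xk yb.
by apply: (beforeP (j2 b bJ)) => //; exact: (partition_sub hQ kQ).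
Qed.

Definition cut_left (q : R) j : interval R := (j `&` `]-oo, q])%O.
Definition cut_right (q : R) j : interval R := (j `&` `]q, +oo[)%O.

Lemma in_cut_left x q j : (x \in cut_left q j) = (x \in j) && (x <= q).
Proof. by rewrite /cut_left in_itvI in_itv. Qed.

Lemma in_cut_right x q j : (x \in cut_right q j) = (x \in j) && (q < x).
Proof. by rewrite /cut_right in_itvI; congr (_ && _); rewrite in_itv /= andbT. Qed.

Lemma partition_cut q j Ql Qr :
  ordered_partition (cut_left q j) Ql -> ordered_partition (cut_right q j) Qr ->
  ordered_partition j (Ql ++ Qr).
Proof.
move=> hl hr.
have hj : ordered_partition j [:: cut_left q j; cut_right q j].
  apply/ordered_partitionE; split; last first.
    rewrite /= !andbT; apply/asboolP => x y; rewrite in_cut_left in_cut_right.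
    by move=> /andP[_ xq] /andP[_ qy]; exact: le_lt_trans xq qy.
  apply/seteqP; split=> x /=.
    move=> xj; have [xq|qx] := leP x q.
      by exists (cut_left q j); rewrite ?in_cut_left ?xj // !inE eqxx.
    by exists (cut_right q j); rewrite ?in_cut_right ?xj // !inE eqxx orbT.
  move=> [k]; rewrite in_cons mem_seq1 => /orP[] /eqP -> h.
    by move: h; rewrite in_cut_left => /andP[].
  by move: h; rewrite in_cut_right => /andP[].
have := partition_replace (J1 := [::]) hj hl; rewrite /= => h.
by have := partition_replace (J2 := [::]) h hr; rewrite cats0.
Qed.

End Partitions.

Section Measure.
Variables (R : realType) (s : scalars) (g : completeNormedModType (scalar_field R s)).
Variables (I : interval R) (alpha : set R -> g).
Hypothesis halpha : continuous_measure_fv I alpha.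
Implicit Types (i j : interval R) (J : seq (interval R)).

Lemma alpha0 : alpha set0 = 0.
Proof.
have := cm_sigma_additive halpha (F := fun=> set0) (fun=> measurable0) (fun=> @sub0set _ _).
have t0 : trivIset setT (fun _ : nat => set0 : set (measurableTypeR R)).
  by apply/trivIsetP => k l _ _ _; rewrite setI0.
rewrite bigcup0 // => /(_ t0) h.
have h1 : (\sum_(0 <= k < m.+1) alpha (set0 : set (measurableTypeR R))) @[m --> \oo] --> alpha set0.
  by have := h; rewrite -cvg_shiftS.
have := cvgB h1 h; rewrite subrr => h2.
have E : (fun m : nat => \sum_(0 <= k < m.+1) alpha (set0 : set (measurableTypeR R)) -
    \sum_(0 <= k < m) alpha (set0 : set (measurableTypeR R))) = (fun=> alpha set0).
  by apply/funext => m; rewrite big_nat_recr //= addrAC subrr add0r.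
have h3 : alpha set0 @[_ --> \oo] --> (0 : g) by rewrite -E; exact: h2.
exact: (cvg_unique (@norm_hausdorff _ g) (cvg_cst (alpha set0)) h3).
Qed.

Lemma alphaU (A B : set (measurableTypeR R)) : measurable A -> measurable B ->
  A `<=` [set` I] -> B `<=` [set` I] -> A `&` B = set0 ->
  alpha (A `|` B) = alpha A + alpha B.
Proof.
move=> mA mB AI BI AB.
have mF k : measurable (bigcup2 A B k) by case: k => [|[|k]] //=; exact: measurable0.
have FI k : bigcup2 A B k `<=` [set` I] by case: k => [|[|k]] //=; exact: sub0set.
have := cm_sigma_additive halpha mF FI; rewrite -trivIset_bigcup2 => /(_ AB).
rewrite bigcup2E => h.
have h2 : (\sum_(0 <= k < m.+2) alpha (bigcup2 A B k)) @[m --> \oo] --> alpha (A `|` B).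
  by have := h; rewrite -cvg_shiftS -cvg_shiftS.
have E : (fun m : nat => \sum_(0 <= k < m.+2) alpha (bigcup2 A B k)) =
    (fun=> alpha A + alpha B).
  apply/funext => m; rewrite !big_nat_recl //= big1_seq ?addr0 // => k _.
  by rewrite /bigcup2 /= alpha0.
have h3 : (alpha A + alpha B) @[_ --> \oo] --> alpha (A `|` B) by rewrite -E; exact: h2.
exact: (cvg_unique (@norm_hausdorff _ g) h3 (cvg_cst _)).
Qed.

Lemma alpha_pieces_union J : pairwise (@before R) J -> (forall j, j \in J -> [set` j] `<=` [set` I]) ->
  measurable (pieces_union J : set (measurableTypeR R)) /\ alpha (pieces_union J) = \sum_(j <- J) alpha [set` j].
Proof.
elim: J => [|j J IH] /=.
  move=> _ _; have -> : pieces_union [::] = set0 :> set R by apply/seteqP; split=> x // [].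
  by rewrite big_nil alpha0; split=> //; exact: measurable0.
move=> /andP[/allP jJ pJ] sub.
have [|mJ aJ] := IH pJ; first by move=> k kJ; apply: sub; rewrite inE kJ orbT.
have cE : pieces_union (j :: J) = [set` j] `|` pieces_union J.
  rewrite -cat1s pieces_union_cat; congr (_ `|` _).
  by have /ordered_partitionE[] := partition_self j.
have mj : measurable ([set` j] : set (measurableTypeR R)) by exact: measurable_itv.
rewrite cE; split; first exact: measurableU.
rewrite alphaU // ?aJ ?big_cons //.
- by apply: sub; rewrite mem_head.
- by move=> x [k kJ xk]; apply: (sub k) => //; rewrite inE kJ orbT.
- apply/seteqP; split=> x // [xj [k kJ xk]].
  by have := beforeP (jJ k kJ) xj xk; rewrite ltxx.
Qed.

Lemma alpha_partition i J : [set` i] `<=` [set` I] -> ordered_partition i J ->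
  alpha [set` i] = \sum_(j <- J) alpha [set` j].
Proof.
move=> iI hJ; have /ordered_partitionE[-> pJ] := hJ.
by apply: (alpha_pieces_union pJ _).2 => j /(partition_sub hJ) jI; apply: subset_trans iI.
Qed.

(** A decreasing sequence of intervals splits its first member into its
    intersection and the successive differences, and the partial sums of the
    measures of these telescope. *)
Lemma alpha_continuous (B : nat -> interval R) :
  [set` B 0%N] `<=` [set` I] -> (forall k, [set` B k.+1] `<=` [set` B k]) ->
  alpha (\bigcap_k [set` B k]) = 0 -> measurable (\bigcap_k [set` B k] : set (measurableTypeR R)) ->
  alpha [set` B k] @[k --> \oo] --> (0 : g).
Proof.
move=> B0 Bdec a0 mcap.
have mB k : measurable ([set` B k] : set (measurableTypeR R)) by exact: measurable_itv.
have BI k : [set` B k] `<=` [set` I].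
  by elim: k => // k IH; apply: subset_trans IH.
have Ble k l : (k <= l)%N -> [set` B l] `<=` [set` B k].
  move=> kl; rewrite -(subnKC kl); elim: (l - k)%N => [|m IH]; first by rewrite addn0.
  by rewrite addnS; apply: subset_trans IH.
pose F k : set (measurableTypeR R) :=
  if k is k'.+1 then [set` B k'] `\` [set` B k] else \bigcap_k [set` B k].
pose F' k : set (measurableTypeR R) :=
  if k is k'.+1 then [set` B k'] `\` [set` B k'.+1] else \bigcap_k [set` B k].
have mF k : measurable (F' k) by case: k => [|k] //=; exact: measurableD.
have FI k : F' k `<=` [set` I].
  by case: k => [|k] x /=; [move=> /(_ 0%N Logic.I); exact: B0|move=> [/BI]].
have tF : trivIset setT F'.
  apply/trivIsetP => k l _ _; wlog kl : k l / (k < l)%N.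
    move=> H; case: (ltngtP k l) => [kl _|kl _|-> /eqP//]; first by apply: H => //; rewrite ltn_eqF.
    by rewrite setIC; apply: H => //; rewrite ltn_eqF.
  move=> _; apply/seteqP; split=> x //; case: l kl => // l kl [+ [xl nxl]].
  case: k kl => [|k] kl /=; first by move=> /(_ l.+1 Logic.I).
  by move=> [_ nk]; apply: nk; apply: Ble xl.
have UF : \bigcup_k F' k = [set` B 0%N].
  apply/seteqP; split=> x.
    move=> [[|k] _] /=; first by move=> /(_ 0%N Logic.I).
    by move=> [xk _]; apply: Ble xk.
  move=> xB0; have [cap|ncap] := pselect (forall k, [set` B k] x).
    by exists 0%N => //= k _; apply: cap.
  have /existsNP[k0 nk0] := ncap.
  have exk : exists k, x \notin B k by exists k0; apply/negP.
  case: (ex_minnP exk) => -[|k] nxk kmin; first by rewrite /= in xB0; rewrite xB0 in nxk.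
  exists k.+1 => //; split; last by apply/negP.
  by apply: contrapT => /negP /kmin; rewrite ltnn.
have aB k : alpha (F' k.+1) = alpha [set` B k] - alpha [set` B k.+1].
  have E : [set` B k] = [set` B k.+1] `|` F' k.+1 by rewrite setDUK.
  have := congr1 alpha E; rewrite alphaU //; last by rewrite setDIK.
  by move=> ->; rewrite addrAC subrr add0r.
have := cm_sigma_additive halpha mF FI tF; rewrite UF -cvg_shiftS => h.
have E m : \sum_(0 <= k < m.+1) alpha (F' k) = alpha [set` B 0%N] - alpha [set` B m].
  elim: m => [|m IH]; first by rewrite big_nat1 subrr.
  by rewrite big_nat_recr //= IH aB addrA subrK.
have h2 : alpha [set` B 0%N] - \sum_(0 <= k < m.+1) alpha (F' k) @[m --> \oo] -->
    alpha [set` B 0%N] - alpha [set` B 0%N].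
  by apply: cvgB => //; exact: cvg_cst.
rewrite subrr in h2.
rewrite (_ : (fun k => alpha [set` B k]) =
   (fun m => alpha [set` B 0%N] - \sum_(0 <= k < m.+1) alpha (F' k))) //.
by apply/funext => m; rewrite E opprB addrC subrK.
Qed.

Definition small_partition e i J :=
  ordered_partition i J /\ forall j, j \in J -> rnorm (alpha [set` j]) < e.

(** Otherwise some interval has no such partition, and of its two parts at any
    cut point one has none either.  Cutting successively at all rationals
    gives a decreasing sequence of intervals of measure at least [e] in norm,
    whose intersection has at most one point and hence measure zero; this
    contradicts countable additivity. *)
Lemma exists_small_partition (e : R) i : 0 < e -> [set` i] `<=` [set` I] ->
  exists J, small_partition e i J.
Proof.
move=> e0 iI; apply: contrapT => bad.
pose good j := exists J, small_partition e j J.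
pose q k : R := if choice.unpickle k is Some r then ratr (r : rat) else 0.
pose step k j := if `[< good (cut_left (q k) j) >] then cut_right (q k) j else cut_left (q k) j.
pose B := fix B k := if k is k'.+1 then step k' (B k') else i.
have badB k : ~ good (B k).
  elim: k => [//|k IH] /=; rewrite /step; case: asboolP => [gl gr|//].
  apply: IH; have [[Jl [pl sl]] [Jr [pr sr]]] := (gl, gr).
  exists (Jl ++ Jr); split; first exact: partition_cut pl pr.
  by move=> j; rewrite mem_cat => /orP[/sl|/sr].
have Bdec k : [set` B k.+1] `<=` [set` B k].
  by rewrite /= /step; case: ifP => _ x /=; rewrite ?in_cut_left ?in_cut_right => /andP[].
have norm_ge k : e <= rnorm (alpha [set` B k]).
  rewrite leNgt; apply/negP => lt; apply: (badB k); exists [:: B k]; split.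
    exact: partition_self.
  by move=> j; rewrite inE => /eqP ->.
have single x y : (\bigcap_k [set` B k]) x -> (\bigcap_k [set` B k]) y -> ~ x < y.
  move=> hx hy xy; have [r] := rat_in_itvoo xy; rewrite in_itv /= => /andP[xr ry].
  have qE : q (choice.pickle r) = ratr r by rewrite /q choice.pickleK.
  have side k : (forall z, [set` B k.+1] z -> q k < z) \/ (forall z, [set` B k.+1] z -> z <= q k).
    rewrite /= /step; case: ifP => _; [left|right] => z /=.
      by rewrite in_cut_right => /andP[].
    by rewrite in_cut_left => /andP[].
  have := side (choice.pickle r); rewrite qE; case.
    by move=> /(_ x (hx _ Logic.I)); rewrite ltNge (ltW xr).
  by move=> /(_ y (hy _ Logic.I)); rewrite leNgt ry.
have capE : \bigcap_k [set` B k] = set0 \/ exists2 t, t \in I & \bigcap_k [set` B k] = [set t].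
  have [[t ht]|none] := pselect (exists t, (\bigcap_k [set` B k]) t).
    right; exists t; first by apply: iI; exact: (ht 0%N Logic.I).
    apply/seteqP; split=> x /=; last by move=> ->.
    move=> hx; case: (ltgtP x t) => [xt|tx|//]; first by case: (single _ _ hx ht).
    by case: (single _ _ ht hx).
  by left; apply/seteqP; split=> x // hx; case: none; exists x.
have a0 : alpha (\bigcap_k [set` B k]) = 0.
  case: capE => [->|[t tI ->]]; first exact: alpha0.
  exact: (cm_atomless halpha tI).
have mcap : measurable (\bigcap_k [set` B k] : set (measurableTypeR R)).
  by apply: bigcap_measurable => // k _; exact: measurable_itv.
have [m hm] := cvg_to0_rnorm e0 (alpha_continuous iI Bdec a0 mcap).
by have := norm_ge m; rewrite leNgt hm.
Qed.

End Measure.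

(** * Ordered integrals of bounded multiadditive maps *)

Section Integral.
Variables (R : realType) (s : scalars) (g : completeNormedModType (scalar_field R s)).
Variables (I : interval R) (alpha : set R -> g).
Hypothesis halpha : continuous_measure_fv I alpha.
Implicit Types (i j : interval R) (J : seq (interval R)).

Local Notation V := (fine (vector_variation alpha I)).

Lemma le_variation i J : ordered_partition i J ->
  ((\sum_(j <- J) rnorm (alpha [set` j]))%:E <= vector_variation alpha i)%E.
Proof. by move=> hJ; apply: ereal_sup_ubound; exists J. Qed.

Lemma variationE : vector_variation alpha I = V%:E.
Proof.
have h0 : (0%:E <= vector_variation alpha I)%E.
  apply: le_trans (le_variation (partition_self I)).
  by rewrite lee_fin big_seq1 rnorm_ge0.
rewrite fineK // ge0_fin_numE //; exact: cm_finite_variation halpha.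
Qed.

Lemma sum_le_variation J : ordered_partition I J ->
  \sum_(j <- J) rnorm (alpha [set` j]) <= V.
Proof. by move/le_variation; rewrite variationE lee_fin. Qed.

Lemma V_ge0 : 0 <= V.
Proof.
apply: le_trans (sum_le_variation (partition_self I)).
by rewrite big_seq1 rnorm_ge0.
Qed.

Definition fine_partition (e : R) J :=
  ordered_partition I J /\ forall j, j \in J -> (vector_variation alpha j < e%:E)%E.

(** Choose a partition that nearly attains the total variation, and refine it
    to one whose pieces have small measure.  A piece of large variation could
    be replaced by a partition of it whose sum exceeds the total variation. *)
Lemma exists_fine_partition (e : R) : 0 < e -> exists J, fine_partition e J.
Proof.
move=> e0; have e4 : 0 < e / 4 by rewrite divr_gt0.
have [J hJ Jbig] : exists2 J, ordered_partition I J &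
    V - e / 4 < \sum_(j <- J) rnorm (alpha [set` j]).
  have lt : ((V - e / 4)%:E < vector_variation alpha I)%E by rewrite variationE lte_fin; lra.
  by have [_ [J hJ <-]] := ereal_sup_gt lt; rewrite lte_fin => h; exists J.
have [f hf] : exists f : interval R -> seq (interval R),
    forall j, [set` j] `<=` [set` I] -> small_partition alpha (e / 4) j (f j).
  have : forall j, exists Q, [set` j] `<=` [set` I] -> small_partition alpha (e / 4) j Q.
    move=> j; have [jI|njI] := pselect ([set` j] `<=` [set` I]).
      by have [Q hQ] := exists_small_partition halpha e4 jI; exists Q.
    by exists [::].
  by move/choice => [f hf]; exists f.
pose K := flatten [seq f j | j <- J].
have hK : ordered_partition I K.
  by apply: partition_flatten => // j jJ; apply: (hf j _).1; exact: partition_sub jJ.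
have Kbig : V - e / 4 < \sum_(k <- K) rnorm (alpha [set` k]).
  apply: lt_le_trans Jbig _; rewrite /K big_flatten big_map big_seq [leRHS]big_seq.
  apply: ler_sum => j jJ; have jI := partition_sub hJ jJ.
  rewrite (alpha_partition halpha jI (hf j jI).1); exact: rnorm_sum.
exists K; split=> // k kK.
have ksmall : rnorm (alpha [set` k]) < e / 4.
  have /flatten_mapP[j jJ kj] := kK.
  exact: (hf j (partition_sub hJ jJ)).2.
apply: (@le_lt_trans _ _ (e / 2)%:E); last by rewrite lte_fin; lra.
apply: ge_ereal_sup => _ [Q hQ <-]; rewrite lee_fin.
move: Kbig hK; case/splitPr: kK => K1 K2 Kbig hK.
have := sum_le_variation (partition_replace hK hQ).
move: Kbig; rewrite !big_cat big_cons /=; lra.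
Qed.

Lemma fine_partition_le e e' J : e <= e' -> fine_partition e J -> fine_partition e' J.
Proof. by move=> ee' [hJ h]; split=> // j jJ; apply: lt_le_trans (h j jJ) _; rewrite lee_fin. Qed.

Lemma fine_partitions_proper : ProperFilter (fine_partitions alpha I).
Proof.
apply: filter_from_proper; last by move=> e /exists_fine_partition [J hJ]; exists J.
apply: filter_from_filter; first by exists 1 => /=.
move=> e e' /= e0 e0'; exists (Num.min e e') => /=; first by rewrite lt_min e0 e0'.
by move=> J hJ; split; apply: fine_partition_le hJ; rewrite ge_min lexx ?orbT.
Qed.

Variables (n : nat) (P : ('I_n -> g) -> g) (C : R).
Hypothesis n0 : (0 < n)%N.
Hypothesis Padd : multiadditive P.
Hypothesis C0 : 0 <= C.
Hypothesis Pbound : forall x, rnorm (P x) <= C * \prod_c rnorm (x c).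

(** By [increasing_sum_le], the ordered sum carries a fraction [1/n!] of the
    power. *)
Lemma ordered_sum_bound J : ordered_partition I J ->
  rnorm (ordered_sum P alpha J) <= C / n`!%:R * V ^+ n.
Proof.
move=> hJ; have f0 : 0 < n`!%:R :> R by rewrite ltr0n fact_gt0.
pose w (a : 'I_(size J)) := rnorm (alpha [set` tnth (in_tuple J) a]).
apply: (@le_trans _ _ (C * \sum_(k : {ffun 'I_n -> 'I_(size J)} | increasing k) \prod_c w (k c))).
  rewrite mulr_sumr; apply: le_trans (rnorm_sum _ _ _) _.
  by apply: ler_sum => k _; exact: Pbound.
rewrite -mulrA ler_wpM2l // mulrC ler_pdivlMr // mulrC.
apply: le_trans (increasing_sum_le _ _) _ => [a|]; first exact: rnorm_ge0.
apply: lerXn2r; first by rewrite nnegrE sumr_ge0 // => a _; exact: rnorm_ge0.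
  by rewrite nnegrE V_ge0.
by have := sum_le_variation hJ; rewrite big_tnth.
Qed.

Section Compare.
Variables (J J' : seq (interval R)) (D : R).
Hypothesis D0 : 0 <= D.
Hypothesis hJ : fine_partition D J.
Hypothesis hJ' : fine_partition D J'.

(* A pair of indices stands for a piece of the common refinement. *)
Let A : finType := ('I_(size J) * 'I_(size J'))%type.
Let pc (a : 'I_(size J)) := tnth (in_tuple J) a.
Let pc' (b : 'I_(size J')) := tnth (in_tuple J') b.
Let X (j : A) : g := alpha [set` (pc j.1 `&` pc' j.2)%O].
Let w (j : A) : R := rnorm (X j).

Let pcI a : [set` pc a] `<=` [set` I].
Proof. by apply: (partition_sub hJ.1); exact: mem_tnth. Qed.
Let pcI' b : [set` pc' b] `<=` [set` I].
Proof. by apply: (partition_sub hJ'.1); exact: mem_tnth. Qed.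

Let sum1 (T : zmodType) (F : A -> T) a : \sum_(j | j.1 == a) F j = \sum_b F (a, b).
Proof.
transitivity (\sum_(j : A | (j.1 == a) && true) F (j.1, j.2)).
  by apply: eq_big => [j|[]]; rewrite ?andbT.
by rewrite -(pair_big (fun a' => a' == a) xpredT (fun a' b => F (a', b))) /= big_pred1_eq.
Qed.

Let sum2 (T : zmodType) (F : A -> T) b : \sum_(j | j.2 == b) F j = \sum_a F (a, b).
Proof.
transitivity (\sum_(j : A | true && (j.2 == b)) F (j.1, j.2)).
  by apply: eq_big => [j|[]].
rewrite -(pair_big xpredT (fun b' => b' == b) (fun a b' => F (a, b'))) /=.
by apply: eq_bigr => a _; rewrite big_pred1_eq.
Qed.

Let part1 a : ordered_partition (pc a) [seq (pc a `&` j)%O | j <- J'].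
Proof. exact: partition_meet hJ'.1 (@pcI a). Qed.
Let part2 b : ordered_partition (pc' b) [seq (pc' b `&` j)%O | j <- J].
Proof. exact: partition_meet hJ.1 (@pcI' b). Qed.

Let alpha1 a : alpha [set` pc a] = \sum_(j | j.1 == a) X j.
Proof. by rewrite (alpha_partition halpha (@pcI a) (part1 a)) big_map big_tnth sum1. Qed.

Let alpha2 b : alpha [set` pc' b] = \sum_(j | j.2 == b) X j.
Proof.
rewrite (alpha_partition halpha (@pcI' b) (part2 b)) big_map big_tnth sum2.
by apply: eq_bigr => a _; rewrite /X meetC.
Qed.

Let w1 a : \sum_(j | j.1 == a) w j <= D.
Proof.
rewrite sum1; have := le_variation (part1 a); rewrite big_map big_tnth => h.
rewrite -lee_fin; apply: le_trans h _; apply/ltW/hJ.2; exact: mem_tnth.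
Qed.

Let w2 b : \sum_(j | j.2 == b) w j <= D.
Proof.
rewrite sum2; have := le_variation (part2 b); rewrite big_map big_tnth => h.
under eq_bigr do rewrite /w /X meetC.
rewrite -lee_fin; apply: le_trans h _; apply/ltW/hJ'.2; exact: mem_tnth.
Qed.

Let wV : \sum_j w j <= V.
Proof.
have hK : ordered_partition I (flatten [seq [seq (j `&` j')%O | j' <- J'] | j <- J]).
  apply: partition_flatten hJ.1 _ => j jJ; apply: partition_meet hJ'.1 _.
  exact: partition_sub hJ.1 jJ.
apply: le_trans (sum_le_variation hK).
rewrite big_flatten big_map big_tnth.
under [leRHS]eq_bigr do rewrite big_map big_tnth.
by rewrite pair_bigA.
Qed.

Let expand1 : ordered_sum P alpha J =
  \sum_(k : {ffun 'I_n -> A} | increasing [ffun c => (k c).1]) P (fun c => X (k c)).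
Proof.
rewrite [RHS](partition_big (fun k : {ffun 'I_n -> A} => [ffun c => (k c).1])
  (@increasing n (size J))) //=.
apply: eq_bigr => i hi.
have -> : (fun c => alpha [set` tnth (in_tuple J) (i c)]) =
    (fun c => \sum_(j : A | j.1 == i c) X j) by apply/funext => c; exact: alpha1.
rewrite (multiadditive_expand Padd _ (fun c (t : A) => t.1 == i c)) //.
apply: eq_bigl => k; apply/forallP/andP => [h|[_ /eqP <-] c]; last by rewrite ffunE.
suff -> : [ffun c => (k c).1] = i by [].
by apply/ffunP => c; rewrite ffunE; exact/eqP.
Qed.

Let expand2 : ordered_sum P alpha J' =
  \sum_(k : {ffun 'I_n -> A} | increasing [ffun c => (k c).2]) P (fun c => X (k c)).
Proof.
rewrite [RHS](partition_big (fun k : {ffun 'I_n -> A} => [ffun c => (k c).2])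
  (@increasing n (size J'))) //=.
apply: eq_bigr => i hi.
have -> : (fun c => alpha [set` tnth (in_tuple J') (i c)]) =
    (fun c => \sum_(j : A | j.2 == i c) X j) by apply/funext => c; exact: alpha2.
rewrite (multiadditive_expand Padd _ (fun c (t : A) => t.2 == i c)) //.
apply: eq_bigl => k; apply/forallP/andP => [h|[_ /eqP <-] c]; last by rewrite ffunE.
suff -> : [ffun c => (k c).2] = i by [].
by apply/ffunP => c; rewrite ffunE; exact/eqP.
Qed.

(** Expand both sums over the common refinement.  A term in one sum but not in
    the other assigns to two variables pieces whose order agrees in one
    partition and not in the other; as nonempty pieces cannot cross, the two
    variables share a piece of one partition.  Each of the coincidences is
    controlled by [coincidence_sum_le]. *)
Lemma compare_bound : rnorm (ordered_sum P alpha J - ordered_sum P alpha J') <=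
  n%:R ^+ 2 * (2 * C * (D * V ^+ n.-1)).
Proof.
have wt0 (k : {ffun 'I_n -> A}) : 0 <= C * \prod_c w (k c).
  by rewrite mulr_ge0 // prodr_ge0 // => c _; exact: rnorm_ge0.
have orders := (ordered_partitionE I J).1 hJ.1.
pose E1 (c c' : 'I_n) (k : {ffun 'I_n -> A}) : R := if (k c).1 == (k c').1 then C * \prod_c w (k c) else 0.
pose E2 (c c' : 'I_n) (k : {ffun 'I_n -> A}) : R := if (k c).2 == (k c').2 then C * \prod_c w (k c) else 0.
have E1_ge0 c c' k : 0 <= E1 c c' k by rewrite /E1; case: ifP.
have E2_ge0 c c' k : 0 <= E2 c c' k by rewrite /E2; case: ifP.
have pick_term (k : {ffun 'I_n -> A}) c c' : c != c' ->
    E1 c c' k + E2 c c' k <= \sum_c \sum_(c' | c != c') (E1 c c' k + E2 c c' k).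
  move=> cc'; rewrite (bigD1 c) //= (bigD1 c') //= -addrA lerDl addr_ge0 //.
    by apply: sumr_ge0 => d _; apply: addr_ge0.
  by apply: sumr_ge0 => d _; apply: sumr_ge0 => d' _; apply: addr_ge0.
have term (k : {ffun 'I_n -> A}) :
    rnorm ((if increasing [ffun c => (k c).1] then P (fun c => X (k c)) else 0) -
           (if increasing [ffun c => (k c).2] then P (fun c => X (k c)) else 0)) <=
    \sum_c \sum_(c' | c != c') (E1 c c' k + E2 c c' k).
  have all0 : 0 <= \sum_c \sum_(c' | c != c') (E1 c c' k + E2 c c' k).
    by apply: sumr_ge0 => d _; apply: sumr_ge0 => d' _; apply: addr_ge0.
  have [[c Xc]|nX] := pselect (exists c, X (k c) = 0).
    by rewrite (zero_coord Padd (a := c)) // !if_same subrr rnorm0.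
  have pt c : exists2 x, x \in pc (k c).1 & x \in pc' (k c).2.
    apply: contrapT => none; apply: nX; exists c; rewrite /X.
    suff -> : [set` (pc (k c).1 `&` pc' (k c).2)%O] = set0 by exact: alpha0 halpha.
    apply/seteqP; split=> x //=; rewrite in_itvI => /andP[x1 x2].
    by case: none; exists x.
  have PB : rnorm (P (fun c => X (k c))) <= C * \prod_c w (k c) := Pbound _.
  case: (increasingP [ffun c => (k c).1]) => h1; case: (increasingP [ffun c => (k c).2]) => h2.
  - by rewrite subrr rnorm0.
  - have [c [c' [cc' hcc']]] : exists c c' : 'I_n, (c < c')%N /\ ((k c').2 <= (k c).2)%N.
      apply: contrapT => none; apply: h2 => c c' cc'; rewrite !ffunE ltnNge.
      by apply/negP => h; apply: none; exists c, c'.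
    have ncc' : c != c' by rewrite neq_ltn cc'.
    rewrite subr0; apply: le_trans PB _; apply: le_trans (pick_term k c c' ncc').
    rewrite /E2; suff -> : (k c).2 == (k c').2 by rewrite lerDr.
    move: hcc'; rewrite leq_eqVlt => /orP[/eqP E|lt]; first by apply/eqP/val_inj.
    have [x x1 x2] := pt c; have [y y1 y2] := pt c'.
    have := h1 c c' cc'; rewrite !ffunE => lt1.
    have xy := hJ.1.2 _ _ lt1 _ _ x1 y1; have yx := hJ'.1.2 _ _ lt _ _ y2 x2.
    by have := lt_trans xy yx; rewrite ltxx.
  - have [c [c' [cc' hcc']]] : exists c c' : 'I_n, (c < c')%N /\ ((k c').1 <= (k c).1)%N.
      apply: contrapT => none; apply: h1 => c c' cc'; rewrite !ffunE ltnNge.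
      by apply/negP => h; apply: none; exists c, c'.
    have ncc' : c != c' by rewrite neq_ltn cc'.
    rewrite sub0r rnormN; apply: le_trans PB _; apply: le_trans (pick_term k c c' ncc').
    rewrite /E1; suff -> : (k c).1 == (k c').1 by rewrite lerDl.
    move: hcc'; rewrite leq_eqVlt => /orP[/eqP E|lt]; first by apply/eqP/val_inj.
    have [x x1 x2] := pt c; have [y y1 y2] := pt c'.
    have := h2 c c' cc'; rewrite !ffunE => lt1.
    have xy := hJ'.1.2 _ _ lt1 _ _ x2 y2; have yx := hJ.1.2 _ _ lt _ _ y1 x1.
    by have := lt_trans xy yx; rewrite ltxx.
  - by rewrite subrr rnorm0.
rewrite expand1 expand2 big_mkcond [X in _ - X]big_mkcond -sumrB.
apply: le_trans (rnorm_sum _ _ _) _.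
apply: le_trans (ler_sum _ (fun k _ => term k)) _.
rewrite exchange_big /=; under eq_bigr do rewrite exchange_big /=.
have W0 : 0 <= \sum_j w j by apply: sumr_ge0 => j _; exact: rnorm_ge0.
have bnd (B : finType) (h : A -> B) (c c' : 'I_n) : c != c' ->
   (forall b, \sum_(a | h a == b) w a <= D) ->
   \sum_(k : {ffun 'I_n -> A}) (if h (k c) == h (k c') then C * \prod_c w (k c) else 0) <=
   C * (D * V ^+ n.-1).
  move=> cc' hD; rewrite -big_mkcond -mulr_sumr ler_wpM2l //.
  apply: le_trans (coincidence_sum_le _ cc' hD) _ => [a|]; first exact: rnorm_ge0.
  by rewrite ler_wpM2l // lerXn2r // ?nnegrE // V_ge0.
have cst0 : 0 <= C * (D * V ^+ n.-1) by rewrite !mulr_ge0 // exprn_ge0 // V_ge0.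
apply: (@le_trans _ _ (\sum_(c < n) \sum_(c' < n) 2 * C * (D * V ^+ n.-1))).
  apply: ler_sum => c _; rewrite big_mkcond; apply: ler_sum => c' _.
  case: ifP => cc'; last by rewrite -mulrA mulr_ge0.
  rewrite big_split /= -mulrA mulr2n mulrDl mul1r; apply: lerD; exact: bnd.
rewrite !sumr_const !card_ord; set a := 2 * C * _.
by rewrite -mulrnA -[leLHS]mulr_natl natrM expr2.
Qed.

End Compare.

(** By [compare_bound] the ordered sums form a Cauchy family along fine
    partitions. *)
Lemma ordered_integral_bound : ordered_integrable P alpha I /\
  rnorm (ordered_integral P alpha I) <= C / n`!%:R * V ^+ n.
Proof.
have FF := fine_partitions_proper.
have fineF (e : R) : 0 < e -> fine_partitions alpha I [set J | fine_partition e J].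
  by move=> e0; exists e.
have int : ordered_integrable P alpha I.
  apply: rnorm_cauchy_cvg => e e0.
  pose M := n%:R ^+ 2 * (2 * C * V ^+ n.-1).
  have M0 : 0 <= M by rewrite /M !mulr_ge0 // exprn_ge0 // V_ge0.
  pose D := e / (M + 1).
  have D0 : 0 < D by rewrite divr_gt0 // ltr_wpDl.
  have [J hJ] := exists_fine_partition D0.
  exists (ordered_sum P alpha J).
  have := fineF D D0; apply: filterS => J' hJ' /=.
  apply: le_lt_trans (compare_bound (ltW D0) hJ hJ') _.
  have -> : n%:R ^+ 2 * (2 * C * (D * V ^+ n.-1)) = M * D by rewrite /M; ring.
  rewrite /D mulrA ltr_pdivrMr ?ltr_wpDl // mulrC ltr_pM2l //; lra.
split=> //; apply: (cvg_rnorm_lim int).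
have := fineF 1 ltr01; apply: filterS => J hJ /=.
exact: ordered_sum_bound hJ.1.
Qed.

End Integral.

(** * The Wilcox terms *)

Section Final.
Variables (R : realType) (s : scalars) (g : completeNormedModType (scalar_field R s)).
Variables (br : g -> g -> g) (I : interval R) (alpha : set R -> g).
Hypothesis hbr : banach_lie br.
Hypothesis halpha : continuous_measure_fv I alpha.
Local Notation V := (fine (vector_variation alpha I)).

Lemma factorization_term_bound d n (L : nat -> ncpoly n) (z : lie_expr n) : (0 < n)%N ->
  homogeneous_lie L ->
  (forall N, (\prod_(i < n) texp N 1 (ncvar i))`_N =
    (\prod_(m <- factor_seq d N) texp N m (L m))`_N) ->
  ncpoly_of_lie z = multilinear_part (L n) ->
  wilcox_term_exists br alpha I z /\
  rnorm (wilcox_term br alpha I z) <= taylor_coef (wilcox_majorant V) n.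
Proof.
move=> n0 hL hf hz; rewrite taylor_coef_majorant //.
have hlie := banach_lie_bracket hbr.
have f0 : n`!%:R != 0 :> R := fact_neq0 R n.
have -> : maj_coef R n * V ^+ n = n`!%:R * maj_coef R n / n`!%:R * V ^+ n.
  by rewrite [n`!%:R * _]mulrC mulfK.
apply: ordered_integral_bound => //.
- exact: (lie_value_multiadditive hlie n0 hz).
- by rewrite mulr_ge0 ?maj_coef_ge0.
- move=> x; apply: (factorization_value_bound hlie _ _ _ _ _ n0 x hL hf hz).
  + exact: rnorm_ge0.
  + exact: rnorm0.
  + exact: rnormD.
  + exact: rnormZ.
  + exact: rnorm_br.
Qed.

(** The number [2 - sqrt 2] is the smaller root of [x^2 - 4 x + 2]. *)
Lemma majorized_series_lt_pinfty (u : nat -> R) :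
  (forall n, (0 < n)%N -> 0 <= u n <= taylor_coef (wilcox_majorant V) n) ->
  V < 2 - Num.sqrt 2 -> (\sum_(1 <= n <oo) (u n)%:E < +oo)%E.
Proof.
move=> hu hV.
have s2 : Num.sqrt 2 ^+ 2 = 2 :> R by rewrite sqr_sqrtr.
have s0 : 0 <= Num.sqrt 2 :> R := sqrtr_ge0 _.
have V0 : 0 <= V := V_ge0 halpha.
have V1 : V <= 1 by nra.
have Vq : 0 <= V ^+ 2 - 4 * V + 2 by nra.
apply: (@le_lt_trans _ _ 1%:E); last exact: ltry.
apply: lime_le.
  by apply: is_cvg_nneseries => k k1 _; rewrite lee_fin; case/andP: (hu k k1).
apply: nearW => m; rewrite sumEFin lee_fin.
case: m => [|m]; first by rewrite big_geq.
apply: le_trans (maj_coef_sum_le1 m V0 V1 Vq).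
apply: ler_sum_nat => k /andP[k1 _].
by rewrite -taylor_coef_majorant //; case/andP: (hu k k1).
Qed.

End Final.

Theorem proposition3p4 (R : realType) (s : scalars)
    (g : completeNormedModType (scalar_field R s)) (br : g -> g -> g)
    (hbr : banach_lie br)
    (I : interval R) (alpha : set R -> g)
    (halpha : continuous_measure_fv I alpha)
    (zl zr : forall n : nat, lie_expr n)
    (hzl : forall n : nat, (0 < n)%N -> wilcox_left (zl n))
    (hzr : forall n : nat, (0 < n)%N -> wilcox_right (zr n)) :
  let v : R := fine (vector_variation alpha I) in
  let zetaL (n : nat) : g := wilcox_term br alpha I (zl n) in
  let zetaR (n : nat) : g := wilcox_term br alpha I (zr n) in
  [/\ (forall n : nat, (0 < n)%N ->
         wilcox_term_exists br alpha I (zl n) /\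
         rnorm (zetaL n) <= taylor_coef (wilcox_majorant v) n),
      (v < 2 - Num.sqrt 2 ->
         (\sum_(1 <= n <oo) (rnorm (zetaL n))%:E < +oo)%E),
      (forall n : nat, (0 < n)%N ->
         wilcox_term_exists br alpha I (zr n) /\
         rnorm (zetaR n) <= taylor_coef (wilcox_majorant v) n) &
      (v < 2 - Num.sqrt 2 ->
         (\sum_(1 <= n <oo) (rnorm (zetaR n))%:E < +oo)%E)].
Proof.
move=> v zetaL zetaR.
have left n : (0 < n)%N -> wilcox_term_exists br alpha I (zl n) /\
    rnorm (zetaL n) <= taylor_coef (wilcox_majorant v) n.
  move=> n0; have [L [hL hf hz]] := hzl n n0.
  exact: (factorization_term_bound (d := false) hbr halpha n0 hL hf hz).
have right n : (0 < n)%N -> wilcox_term_exists br alpha I (zr n) /\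
    rnorm (zetaR n) <= taylor_coef (wilcox_majorant v) n.
  move=> n0; have [L [hL hf hz]] := hzr n n0.
  exact: (factorization_term_bound (d := true) hbr halpha n0 hL hf hz).
split=> //; apply: majorized_series_lt_pinfty => // n n0; rewrite rnorm_ge0 /=.
  by have [] := left n n0.
by have [] := right n n0.
Qed.
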